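(* Let $\lambda\in\mathcal M$ and $\mu$ be nonzero finite even Borel measures on $S^{n-1}$ not concentrated on any great subsphere. Let $G,\Psi\in\mathcal C$ with $G(\xi,t)=G(-\xi,t)$, $\Psi(\xi,t)=\Psi(-\xi,t)$ for all $(\xi,t)$, and $\Theta=(G,\Psi,\lambda)$. (i) If either $\Psi\in\mathcal C_I$ with $\lim_{t\to\infty}\Psi(\xi,t)=+\infty$ for each $\xi$ and $G\in\mathscr G_d$, or $G\in\mathcal C_d$ with $\lim_{t\to0^+}G(\xi,t)=+\infty$ for each $\xi$ and $\Psi\in\mathscr G_I$, then there exists $K_0\in\mathscr K^n_e$ with $\frac{\mu}{|\mu|}=\frac{\widetilde C_\Theta(K_0,\cdot)}{\widetilde C_\Theta(K_0,S^{n-1})}$. If in addition $\lambda$ is strictly positive on nonempty open subsets of $S^{n-1}$, then for a nonzero finite even Borel measure $\mu$, being not concentrated on any great subsphere is also necessary for this identity to hold for some $K_0\in\mathscr K^n_e$. (ii) If in addition $\mu$ vanishes on great subspheres, $\Psi\in\mathcal C_d$ and $G\in\mathscr G_d$, then there exists $K_0\in\mathscr K^n_e$ with $\frac{\mu}{|\mu|}=\frac{\widetilde C_\Theta(K_0,\cdot)}{\widetilde C_\Theta(K_0,S^{n-1})}$.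
   Context: $S^{n-1}$ unit sphere of $\mathbb R^n$, $n\ge2$, $d\xi$ spherical Lebesgue measure, $|\mu|=\mu(S^{n-1})$. Even measure: $\mu(-\omega)=\mu(\omega)$. Not concentrated on any great subsphere: $\mu(S^{n-1}\setminus v^\perp)>0$ for all $v\in S^{n-1}$; vanishes on great subspheres: $\mu(S^{n-1}\cap v^\perp)=0$ for all $v$. $\mathscr K^n_{(o)}$: compact convex sets with the origin in their interior; $\mathscr K^n_e$: origin-symmetric members. For $K$: $h_K(x)=\max\{x\cdot y:y\in K\}$, $\rho_K(x)=\max\{t\ge0:tx\in K\}$; $\pmb\alpha_K(\xi)$ set of outer unit normals at $\rho_K(\xi)\xi$, singleton $\{\alpha_K(\xi)\}$ a.e.; $\pmb\alpha^*_K(\omega)=\{\xi:\pmb\alpha_K(\xi)\cap\omega\ne\emptyset\}$. $\mathcal C$: $G:S^{n-1}\times(0,\infty)\to\mathbb R$ with $G,G_t$ continuous; $\mathcal C_I=\{G_t>0\}$, $\mathcal C_d=\{G_t<0\}$. $\mathscr G_I$: positive $G\in\mathcal C$ with, for each $u$, $G_t(u,\cdot)>0$, $\lim_{t\to0^+}G(u,t)=0$, $\lim_{t\to\infty}G(u,t)=\infty$; $\mathscr G_d$: positive $G\in\mathcal C$ with $G_t(u,\cdot)<0$, $\lim_{t\to0^+}G(u,t)=\infty$, $\lim_{t\to\infty}G(u,t)=0$. $\mathcal M$: nonzero finite Borel measures absolutely continuous w.r.t. $d\xi$. $\widetilde C_\Theta(K,\omega)=\int_{\pmb\alpha^*_K(\omega)}\frac{\rho_K(\xi)G_t(\xi,\rho_K(\xi))}{h_K(\alpha_K(\xi))\Psi_t(\alpha_K(\xi),h_K(\alpha_K(\xi)))}d\lambda(\xi)$.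 *)

(* Defs.v *)
(* MathComp + MathComp-Analysis, over an abstract R : realType.
   R^n is modelled by row vectors 'rV[R]_n with the Euclidean dot product;
   the topology on 'rV[R]_n is the library's product (matrix) topology,
   which coincides with the Euclidean one. *)
From HB Require Import structures.
From mathcomp Require Import all_boot all_order all_algebra.
From mathcomp Require Import all_classical all_reals all_analysis.
Set Implicit Arguments.
Unset Strict Implicit.
Unset Printing Implicit Defensive.
Import Order.TTheory GRing.Theory Num.Theory.
Import numFieldTopology.Exports numFieldNormedType.Exports.
Local Open Scope classical_set_scope.
Local Open Scope ring_scope.

Section Defs.
Variables (R : realType) (n : nat).
Implicit Types (x y u xi : 'rV[R]_n) (K : set 'rV[R]_n).

Definition dotv x y : R := \sum_(i < n) x ord0 i * y ord0 i.

Definition sphere : set 'rV[R]_n := [set x | dotv x x = 1].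

Definition great_subsphere v : set 'rV[R]_n := [set x | sphere x /\ dotv v x = 0].

(** Borel sets of R^n: the sigma-algebra generated by the open sets.
    A Borel measure on S^{n-1} is represented by a Borel measure on R^n
    giving zero mass to the complement of S^{n-1} (S^{n-1} is closed, so its
    Borel sets are exactly the Borel sets of R^n contained in it). *)
Definition open_sets : set (set 'rV[R]_n) := open.
Definition borelRn := g_sigma_algebraType open_sets.

Definition convex_set K := forall x y (t : R), K x -> K y -> 0 <= t <= 1 ->
  K (t *: x + (1 - t) *: y).

Definition convex_body_o K := compact K /\ convex_set K /\ (interior K) 0.

Definition convex_body_e K := convex_body_o K /\ (forall x, K x -> K (- x)).

Definition supp_fun K x : R := sup [set dotv x y | y in K].
Definition radial_fun K x : R := sup [set t : R | 0 <= t /\ K (t *: x)].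

Definition normals K xi : set 'rV[R]_n :=
  [set u | sphere u /\ dotv u (radial_fun K xi *: xi) = supp_fun K u].

(** The radial Gauss image alpha_K(xi) (a chosen outer unit normal; it is
    unique for spherical-Lebesgue-a.e. xi). *)
Definition radial_gauss K xi : 'rV[R]_n := xget 0 (normals K xi).

Definition rev_radial_gauss K (omega : set 'rV[R]_n) : set 'rV[R]_n :=
  [set xi | sphere xi /\ exists u, normals K xi u /\ omega u].

Definition open_cube (c : 'rV[R]_n) (r : R) : set 'rV[R]_n :=
  [set x | forall i : 'I_n, `|x ord0 i - c ord0 i| < r].

Definition lebesgue_null (A : set 'rV[R]_n) : Prop :=
  forall eps : R, 0 < eps -> exists (c : nat -> 'rV[R]_n) (r : nat -> R),
    (forall k, 0 < r k) /\
    A `<=` \bigcup_k open_cube (c k) (r k) /\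
    (forall N, \sum_(k < N) (2 * r k) ^+ n <= eps).

(** Null sets of the spherical Lebesgue measure: A \subseteq S^{n-1} is null
    iff the cone {t xi : xi in A, 0 < t <= 1} is Lebesgue null in R^n
    (the spherical Lebesgue measure being  sigma(A) = n * vol_n(cone A)). *)
Definition cone (A : set 'rV[R]_n) : set 'rV[R]_n :=
  [set y | exists t : R, exists2 xi, A xi & 0 < t <= 1 /\ y = t *: xi].

Definition spherical_null (A : set 'rV[R]_n) : Prop :=
  A `<=` sphere /\ lebesgue_null (cone A).

Definition dt (G : 'rV[R]_n -> R -> R) (u : 'rV[R]_n) (t : R) : R :=
  derive1 (G u) t.

Definition S_pos : set ('rV[R]_n * R) := [set p | sphere p.1 /\ 0 < p.2].

(** The class \mathcal C: G : S^{n-1} x (0,oo) -> R with G and G_t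
    continuous (only the values on S^{n-1} x (0,oo) matter). *)
Definition class_C (G : 'rV[R]_n -> R -> R) : Prop :=
  (forall u t, sphere u -> 0 < t -> derivable (G u) t 1) /\
  {within S_pos, continuous (fun p => G p.1 p.2)} /\
  {within S_pos, continuous (fun p => dt G p.1 p.2)}.

Definition class_CI G : Prop :=
  class_C G /\ forall u t, sphere u -> 0 < t -> 0 < dt G u t.
Definition class_Cd G : Prop :=
  class_C G /\ forall u t, sphere u -> 0 < t -> dt G u t < 0.

Definition class_GI G : Prop :=
  class_C G /\
  (forall u t, sphere u -> 0 < t -> 0 < G u t) /\
  (forall u t, sphere u -> 0 < t -> 0 < dt G u t) /\
  (forall u, sphere u -> G u t @[t --> 0^'+] --> 0) /\
  (forall u, sphere u -> G u t @[t --> +oo] --> +oo).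

Definition class_Gd G : Prop :=
  class_C G /\
  (forall u t, sphere u -> 0 < t -> 0 < G u t) /\
  (forall u t, sphere u -> 0 < t -> dt G u t < 0) /\
  (forall u, sphere u -> G u t @[t --> 0^'+] --> +oo) /\
  (forall u, sphere u -> G u t @[t --> +oo] --> 0).

Definition even_fun (G : 'rV[R]_n -> R -> R) : Prop :=
  forall u t, sphere u -> 0 < t -> G u t = G (- u) t.

Definition sphere_measure (mu : {measure set borelRn -> \bar R}) : Prop :=
  mu (~` sphere) = 0%E /\ (mu setT < +oo)%E /\ mu setT != 0%E.

Definition even_measure (mu : {measure set borelRn -> \bar R}) : Prop :=
  forall A : set borelRn, measurable A -> mu [set - x | x in A] = mu A.

Definition not_concentrated (mu : {measure set borelRn -> \bar R}) : Prop :=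
  forall v, sphere v -> (0 < mu (sphere `\` great_subsphere v))%E.

Definition vanishes_on_great_subspheres (mu : {measure set borelRn -> \bar R})
  : Prop := forall v, sphere v -> mu (great_subsphere v) = 0%E.

Definition class_M (lam : {measure set borelRn -> \bar R}) : Prop :=
  sphere_measure lam /\
  forall A : set borelRn, measurable A -> spherical_null A -> lam A = 0%E.

Definition positive_on_open (lam : {measure set borelRn -> \bar R}) : Prop :=
  forall O : set 'rV[R]_n, open O -> O `&` sphere !=set0 ->
    (0 < lam (O `&` sphere))%E.

Definition Ctilde (G Psi : 'rV[R]_n -> R -> R)
    (lam : {measure set borelRn -> \bar R}) K (omega : set 'rV[R]_n) : \bar R :=
  (\int[lam]_(xi in rev_radial_gauss K omega)
     (radial_fun K xi * dt G xi (radial_fun K xi) /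
      (supp_fun K (radial_gauss K xi) *
       dt Psi (radial_gauss K xi) (supp_fun K (radial_gauss K xi))))%:E)%E.

Definition normalized_eq (G Psi : 'rV[R]_n -> R -> R)
    (lam mu : {measure set borelRn -> \bar R}) K : Prop :=
  Ctilde G Psi lam K sphere \is a fin_num /\
  Ctilde G Psi lam K sphere != 0%E /\
  forall omega : set borelRn, measurable omega -> omega `<=` sphere ->
    Ctilde G Psi lam K omega \is a fin_num /\
    fine (mu omega) / fine (mu sphere) =
    fine (Ctilde G Psi lam K omega) / fine (Ctilde G Psi lam K sphere).

End Defs.

(* Main.v *)
Require Import Defs.
From HB Require Import structures.
From mathcomp Require Import all_boot all_order all_algebra.
From mathcomp Require Import all_classical all_reals all_analysis.
From mathcomp Require Import ring lra.
From mathcomp Require Import measurable_realfun.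
Set Implicit Arguments.
Unset Strict Implicit.
Unset Printing Implicit Defensive.
Import Order.TTheory GRing.Theory Num.Theory.
Import numFieldTopology.Exports numFieldNormedType.Exports.
Local Open Scope classical_set_scope.
Local Open Scope ring_scope.

(** An origin-symmetric convex body [K] is encoded by its gauge [p] on the sphere, so that the
    radial function is [1/p] and the support function is [h u = sup_x (u . x) / p x].  Put
    [E p = \int G(x, 1/p) dlam] and [F p = \int Psi(u, h) dmu], with [Psi] replaced by [-Psi] in
    case (ii), so that [G_t < 0 < Psi_t].  The divergence hypotheses on [G] and [Psi],
    together with (non-)concentration made uniform by compactness, bound [p] and [h] from below
    on [{E <= E 1, F <= F 1}]; hence [E + F] is minimised there over a compact set of uniformly
    Lipschitz gauges, and the minimiser is weakly Pareto optimal: no even gauge decreases both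
    energies.  Perturbing the Wulff shape of [h] by [1/h + t g] and applying Danskin's formula for
    the gauge at [lam]-almost every [x] gives two linear forms in [g], the derivatives of [E] and
    [F], that are never both negative, hence are proportional.  This is the desired equality
    tested against even continuous functions, and evenness turns it into equality of measures.
    The almost everywhere differentiability comes from the singular set being a countable union
    of pieces whose cones lie on Lipschitz graphs.
    Conversely, the curvature measure of a body charges the complement of each great subsphere
    [v^perp], since the normals at points near [v] are not orthogonal to [v]. *)

(** * Gauges and polarity on the sphere *)

(** [G] and [Psi] have no homogeneity, so a body cannot be rescaled to meet a normalisation, and a
    constrained problem would require correcting every perturbation. Weak Pareto optimality avoids a
    constraint: a competitor lowering both energies stays in the sublevel set and lowers [E + F].
    Only proportionality of the two first variations results, which is exactly what the normalised
    identity asks for. The perturbation is made in [1/h] because the gauge [sup_u (x . u) / h u] has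
    an objective linear in [1/h]. For [F] no derivative of the support function is needed: the Wulff
    shape of a function has support function at most that function, and [Psi] increases. Lower
    bounds on [p] and [h] are enough for compactness: when [p] is the polar of [h], the bound
    [a <= h] gives both [p <= 1/a] and a Lipschitz constant. In case (ii) the function [-Psi]
    increases but need not diverge. It yields only a fixed gain away from a thin slab around a great
    subsphere, and the vanishing of [mu] there makes the loss on the slab smaller than this gain. *)

Section Geometry.
Variables (R : realType) (n : nat).
Implicit Types (x y z u v : 'rV[R]_n) (a b t : R).
Local Notation S := (@sphere R n).

Lemma dotvC x y : dotv x y = dotv y x.
Proof. by apply: eq_bigr => i _; rewrite mulrC. Qed.

Lemma dotvDl x y z : dotv (x + y) z = dotv x z + dotv y z.
Proof. by rewrite -big_split; apply: eq_bigr => i _; rewrite mxE mulrDl. Qed.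

Lemma dotvZl t x y : dotv (t *: x) y = t * dotv x y.
Proof. by rewrite /dotv mulr_sumr; apply: eq_bigr => i _; rewrite mxE mulrA. Qed.

Lemma dotvNl x y : dotv (- x) y = - dotv x y.
Proof. by rewrite -scaleN1r dotvZl mulN1r. Qed.

Lemma dotvBl x y z : dotv (x - y) z = dotv x z - dotv y z.
Proof. by rewrite dotvDl dotvNl. Qed.

Lemma dotvDr x y z : dotv z (x + y) = dotv z x + dotv z y.
Proof. by rewrite dotvC dotvDl !(dotvC z). Qed.

Lemma dotvZr t x y : dotv x (t *: y) = t * dotv x y.
Proof. by rewrite dotvC dotvZl dotvC. Qed.

Lemma dotvNr x y : dotv x (- y) = - dotv x y.
Proof. by rewrite dotvC dotvNl dotvC. Qed.

Lemma dotvBr x y z : dotv z (x - y) = dotv z x - dotv z y.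
Proof. by rewrite dotvDr dotvNr. Qed.

Lemma dotv0l x : dotv 0 x = 0.
Proof. by rewrite -(scale0r 0) dotvZl mul0r. Qed.

Lemma dotvv_ge0 x : 0 <= dotv x x.
Proof. by apply: sumr_ge0 => i _; rewrite -expr2 sqr_ge0. Qed.

Lemma dotvv_eq0 x : dotv x x = 0 -> x = 0.
Proof.
move=> xx0; apply/rowP => i; rewrite mxE; apply/eqP; rewrite -sqrf_eq0.
have : \sum_(i < n) x ord0 i * x ord0 i == 0 by rewrite -/(dotv x x) xx0.
rewrite psumr_eq0; last by move=> j _; rewrite -expr2 sqr_ge0.
by move=> /allP/(_ i (mem_index_enum i)); rewrite /= -expr2.
Qed.

Lemma sphereN u : S u -> S (- u).
Proof. by rewrite /sphere /= dotvNl dotvNr opprK. Qed.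

Lemma norm_coord_le x i : `|x ord0 i| <= `|x|.
Proof.
rewrite [leRHS]/Num.norm/= mx_normrE.
exact: (@le_bigmax_cond _ _ _ 0 (ord0, i) xpredT (fun ij : 'I_1 * 'I_n => `|x ij.1 ij.2|)).
Qed.

Lemma sphere_coord_le1 u i : S u -> `|u ord0 i| <= 1.
Proof.
move=> Su; rewrite -(@ler_pXn2r _ 2) ?nnegrE// expr1n real_normK ?num_real//.
rewrite -Su /dotv (bigD1 i)//= -expr2 lerDl.
by apply: sumr_ge0 => j _; rewrite -expr2 sqr_ge0.
Qed.

Lemma sphere_norm_le1 u : S u -> `|u| <= 1.
Proof.
move=> Su; rewrite [leLHS]/Num.norm/= mx_normrE; apply: bigmax_le => //= -[i j] _ /=.
by rewrite (ord1 i); exact: sphere_coord_le1.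
Qed.

(** The norm on row vectors is the max norm, whence the factor [n]; it reappears in all Lipschitz
    constants below. *)
Lemma dotv_norm_le x u : S u -> `|dotv x u| <= n%:R * `|x|.
Proof.
move=> Su; apply: le_trans (ler_norm_sum _ _ _) _.
apply: (@le_trans _ _ (\sum_(i < n) `|x|)); last by rewrite sumr_const card_ord mulr_natl.
apply: ler_sum => i _.
rewrite normrM -[leRHS]mulr1 ler_pM//; first exact: norm_coord_le.
exact: sphere_coord_le1.
Qed.

Lemma dotv_sphere_le1 u v : S u -> S v -> dotv u v <= 1.
Proof.
move=> Su Sv; have := dotvv_ge0 (u - v).
by rewrite dotvBl !dotvBr (dotvC v u) Su Sv; lra.
Qed.

Lemma continuous_coord (i : 'I_n) : continuous (fun x : 'rV[R]_n => x ord0 i).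
Proof. exact: coord_continuous. Qed.

Lemma continuous_dotv (T : topologicalType) (f g : T -> 'rV[R]_n) (F : set_system T)
    x y : Filter F -> f @ F --> x -> g @ F --> y ->
  (fun s => dotv (f s) (g s)) @ F --> dotv x y.
Proof.
move=> FF fx gy; apply: cvg_big => [|i _]; first exact: add_continuous.
apply: cvgM.
- exact: (cvg_comp _ _ fx (@continuous_coord i x)).
- exact: (cvg_comp _ _ gy (@continuous_coord i y)).
Qed.

Lemma closed_sphere : closed S.
Proof.
have -> : S = (fun x => dotv x x) @^-1` [set (1 : R)] by [].
apply: closed_comp => [x _|]; last exact: closed_eq.
apply: (@continuous_dotv _ idfun idfun (nbhs x)); exact: cvg_id.
Qed.

Lemma compact_sphere : compact S.
Proof.
apply: bounded_closed_compact closed_sphere.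
exists 1; split => // t t1 x /sphere_norm_le1 /le_trans; apply; exact: ltW.
Qed.

Lemma sphere_scale x : x != 0 -> exists2 t, 0 < t & exists2 u, S u & x = t *: u.
Proof.
move=> x0; have xx0 : 0 < dotv x x.
  by rewrite lt0r dotvv_ge0 andbT; apply: contra_neq x0; exact: dotvv_eq0.
exists (Num.sqrt (dotv x x)); first by rewrite sqrtr_gt0.
exists ((Num.sqrt (dotv x x))^-1 *: x); last first.
  by rewrite scalerA divff ?scale1r// gt_eqF// sqrtr_gt0.
rewrite /sphere/= dotvZl dotvZr mulrA -invfM -expr2 sqr_sqrtr ?dotvv_ge0//.
by rewrite mulVf// gt_eqF.
Qed.

Lemma sphere_nonempty : (0 < n)%N -> S !=set0.
Proof.
move=> n0; have : const_mx 1 != 0 :> 'rV[R]_n.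
  by apply/eqP => /rowP/(_ (Ordinal n0)); rewrite !mxE => /eqP; rewrite oner_eq0.
by move=> /sphere_scale[t _ [u Su _]]; exists u.
Qed.

End Geometry.

Section Polar.
Variables (R : realType) (n : nat).
Implicit Types (x y z u v : 'rV[R]_n) (C : set 'rV[R]_n) (w p : 'rV[R]_n -> R).
Local Notation S := (@sphere R n).

(** With [w = 1/h] this is the gauge of the Wulff shape of [h]; with [w = 1/p] it is the
    support function of the star body with gauge [p]. *)
Definition pol C w x : R := sup [set dotv x u * w u | u in C].

Section Bounded.
Variables (C : set 'rV[R]_n) (w : 'rV[R]_n -> R) (W : R).
Hypotheses (CS : C `<=` S) (C0 : C !=set0) (wW : forall u, C u -> 0 <= w u <= W).

Lemma pol_has_sup x : has_sup [set dotv x u * w u | u in C].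
Proof.
split; first by have [u Cu] := C0; exists (dotv x u * w u); exists u.
exists (n%:R * `|x| * W) => _ [u Cu <-].
have /andP[w0 wle] := wW Cu.
apply: le_trans (ler_norm _) _; rewrite normrM (ger0_norm w0).
by apply: ler_pM => //; apply/dotv_norm_le/CS.
Qed.

Lemma pol_ub x u : C u -> dotv x u * w u <= pol C w x.
Proof. by move=> Cu; apply: sup_upper_bound; [exact: pol_has_sup|exists u]. Qed.

Lemma pol_le x (M : R) : (forall u, C u -> dotv x u * w u <= M) -> pol C w x <= M.
Proof.
move=> h; apply: ge_sup; first exact: (pol_has_sup x).1.
by move=> _ [u Cu <-]; exact: h.
Qed.

Lemma pol_subadd x y : pol C w (x + y) <= pol C w x + pol C w y.
Proof. by apply: pol_le => u Cu; rewrite dotvDl mulrDl lerD// pol_ub. Qed.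

Lemma pol_norm_le x : pol C w x <= n%:R * W * `|x|.
Proof.
apply: pol_le => u Cu; have /andP[w0 wle] := wW Cu.
apply: le_trans (ler_norm _) _; rewrite normrM (ger0_norm w0) mulrAC.
by apply: ler_pM => //; apply/dotv_norm_le/CS.
Qed.

Lemma pol_lipschitz x y : `|pol C w x - pol C w y| <= n%:R * W * `|x - y|.
Proof.
rewrite ler_norml lerBrDr lerBlDr; apply/andP; split.
  rewrite addrC lerBlDr; have := pol_subadd x (y - x); rewrite subrKC.
  by move=> /le_trans; apply; rewrite lerD2l -normrN opprB pol_norm_le.
have := pol_subadd (x - y) y; rewrite subrK => /le_trans; apply.
by rewrite lerD2r pol_norm_le.
Qed.

Lemma continuous_pol : continuous (pol C w).
Proof.
move=> x.
have W0 : 0 <= W by have [u /wW/andP[]] := C0; exact: le_trans.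
have c0 : 0 < n%:R * W + 1 by rewrite ltr_wpDl// mulr_ge0.
apply/(@cvgrPdist_le _ _ _ (nbhs x) (nbhs_filter x)) => e e0; near=> y.
apply: le_trans (pol_lipschitz x y) _.
apply: (@le_trans _ _ ((n%:R * W + 1) * `|x - y|)).
  by apply: ler_wpM2r => //; rewrite lerDl.
rewrite -ler_pdivlMl//.
near: y; apply: (@cvgr_dist_le _ _ _ (nbhs x) _ idfun x (@cvg_id _ _)).
by rewrite mulr_gt0// invr_gt0.
Unshelve. all: by end_near. Qed.

Lemma pol_attained x : compact C -> {within C, continuous w} ->
  exists2 u, C u & dotv x u * w u = pol C w x.
Proof.
move=> cC cw.
have cf : {within C, continuous (fun u => dotv x u * w u)}.
  apply/subspace_continuousP => u Cu; apply: cvgM; last exact: (subspace_continuousP _ _).1.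
  by apply: (@continuous_dotv _ _ _ (cst x) idfun); [exact: cvg_cst|exact: cvg_within].
have [u /set_mem Cu umax] := EVT_max_rV C0 cC cf.
exists u => //; apply/eqP; rewrite eq_le pol_ub//=.
by apply: pol_le => v Cv; apply: umax; exact: mem_set.
Qed.

Lemma polZ x (t : R) : 0 <= t -> pol C w (t *: x) = t * pol C w x.
Proof.
move=> t0; apply/eqP; rewrite eq_le; apply/andP; split.
  by apply: pol_le => u Cu; rewrite dotvZl -mulrA ler_wpM2l// pol_ub.
have [->|t_neq0] := eqVneq t 0.
  rewrite mul0r scale0r; have [u Cu] := C0.
  by apply: le_trans (pol_ub _ Cu); rewrite dotv0l mul0r.
have {t0 t_neq0}t0 : 0 < t by rewrite lt0r t_neq0.
rewrite -ler_pdivlMl//; apply: pol_le => u Cu.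
by rewrite ler_pdivlMl// mulrA -dotvZl pol_ub.
Qed.

End Bounded.

Section Sphere.
Variables (w : 'rV[R]_n -> R) (a b : R).
Hypotheses (n0 : (0 < n)%N) (a0 : 0 < a) (wab : forall u, S u -> a <= w u <= b).

Let wW u : S u -> 0 <= w u <= b.
Proof. by move=> /wab/andP[aw wb]; rewrite wb (le_trans _ aw)// ltW. Qed.

Lemma polS_ub x u : S u -> dotv x u * w u <= pol S w x.
Proof. exact: pol_ub (sphere_nonempty R n0) wW _ _. Qed.

Lemma polS_le x (M : R) : (forall u, S u -> dotv x u * w u <= M) -> pol S w x <= M.
Proof. exact: pol_le (sphere_nonempty R n0) wW _ _. Qed.

Lemma polS_bounds x : S x -> a <= pol S w x <= b.
Proof.
move=> Sx; apply/andP; split.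
  by apply: le_trans (polS_ub x Sx); rewrite Sx mul1r; have /andP[] := wab Sx.
apply: polS_le => u Su; have /andP[w0 wb] := wW Su.
by apply: le_trans wb; rewrite ler_piMl// dotv_sphere_le1.
Qed.

Lemma polN x : (forall u, S u -> w (- u) = w u) -> pol S w (- x) = pol S w x.
Proof.
move=> we; apply/eqP; rewrite eq_le; apply/andP; split; apply: polS_le => u Su.
  by rewrite -(we _ Su) dotvNl -dotvNr; apply/polS_ub/sphereN.
have -> : dotv x u = dotv (- x) (- u) by rewrite dotvNl dotvNr opprK.
by rewrite -(we _ Su); apply/polS_ub/sphereN.
Qed.

End Sphere.

Lemma sphere_within_inv w (a : R) : 0 < a -> (forall u, S u -> a <= w u) ->
  {within S, continuous w} -> {within S, continuous (fun u => (w u)^-1)}.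
Proof.
move=> a0 aw /subspace_continuousP cw; apply/subspace_continuousP => u Su.
by apply: cvgV; [rewrite gt_eqF// (lt_le_trans a0)// aw|exact: cw].
Qed.

Lemma inv_bounds w (a b : R) u : 0 < a -> a <= w u <= b -> b^-1 <= (w u)^-1 <= a^-1.
Proof.
move=> a0 /andP[aw wb]; have w0 : 0 < w u := lt_le_trans a0 aw.
by rewrite !lef_pV2 ?posrE ?aw ?wb// (lt_le_trans w0).
Qed.

Section Bipolar.
Variables (p : 'rV[R]_n -> R) (a b : R).
Hypotheses (n0 : (0 < n)%N) (a0 : 0 < a) (b0 : 0 < b)
  (pab : forall u, S u -> a <= p u <= b).
Local Notation h := (pol S (fun u => (p u)^-1)).
Local Notation p' := (pol S (fun u => (h u)^-1)).

Let pV u : S u -> b^-1 <= (p u)^-1 <= a^-1.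
Proof. by move=> Su; exact: inv_bounds a0 (pab Su). Qed.

Let bV0 : 0 < b^-1. Proof. by rewrite invr_gt0. Qed.

Lemma polar_bounds u : S u -> b^-1 <= h u <= a^-1.
Proof. by move=> Su; exact: polS_bounds n0 bV0 pV u Su. Qed.

Let hV u : S u -> a <= (h u)^-1 <= b.
Proof. by move=> Su; have := inv_bounds bV0 (polar_bounds Su); rewrite !invrK. Qed.

Lemma bipolar_bounds u : S u -> a <= p' u <= b.
Proof. by move=> Su; exact: polS_bounds n0 a0 hV u Su. Qed.

Lemma bipolar_le x : S x -> p' x <= p x.
Proof.
move=> Sx; apply: (polS_le n0 a0 hV) => u Su.
have hu : 0 < h u by have /andP[+ _] := polar_bounds Su; apply: lt_le_trans.
have px : 0 < p x by have /andP[+ _] := pab Sx; apply: lt_le_trans.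
rewrite ler_pdivrMr// -ler_pdivrMl// mulrC dotvC.
exact: (polS_ub n0 bV0 pV u Sx).
Qed.

(** One inequality unfolds the supremum defining [p']; the other inverts [bipolar_le]. *)
Lemma tripolar u : S u -> pol S (fun x => (p' x)^-1) u = h u.
Proof.
move=> Su; have p'V v : S v -> b^-1 <= (p' v)^-1 <= a^-1.
  by move=> Sv; exact: inv_bounds a0 (bipolar_bounds Sv).
apply/eqP; rewrite eq_le; apply/andP; split.
  apply: (polS_le n0 bV0 p'V) => x Sx.
  have p'x : 0 < p' x by have /andP[+ _] := bipolar_bounds Sx; apply: lt_le_trans.
  have hu : 0 < h u by have /andP[+ _] := polar_bounds Su; apply: lt_le_trans.
  rewrite ler_pdivrMr// -ler_pdivrMl// mulrC dotvC.
  exact: (polS_ub n0 a0 hV x Su).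
apply: (polS_le n0 bV0 pV) => x Sx.
(* For a nonpositive pairing, replacing [p x] by the smaller [p' x] goes the wrong way, so
   positivity of the right-hand side is used instead. *)
have [ux0|ux0] := leP (dotv u x) 0.
  have px : 0 < p x by have /andP[+ _] := pab Sx; apply: lt_le_trans.
  have /andP[+ _] := polS_bounds n0 bV0 p'V Su; apply: le_trans.
  by rewrite (le_trans _ (ltW bV0))// mulr_le0_ge0// invr_ge0 ltW.
apply: le_trans (polS_ub n0 bV0 p'V u Sx).
rewrite ler_pM2l// lef_pV2 ?posrE ?bipolar_le//.
- by have /andP[+ _] := pab Sx; apply: lt_le_trans.
- by have /andP[+ _] := bipolar_bounds Sx; apply: lt_le_trans.
Qed.

End Bipolar.

End Polar.

(** * Functions of class C over compact bands of the half-cylinder *)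

Lemma cvg_within_comp (T : Type) (U V : topologicalType) (F : set_system T) (A : set U)
    (f : T -> U) (g : U -> V) (x : U) (y : V) : Filter F ->
  f @ F --> x -> (\forall t \near F, A (f t)) -> g @ within A (nbhs x) --> y ->
  (fun t => g (f t)) @ F --> y.
Proof.
move=> FF fx Af gy B nB; have /fx := gy B nB; rewrite !nbhs_simpl/=.
by move: Af; apply: filterS2 => t At; apply.
Qed.

Lemma cvg_pair_pt (T : Type) (U V : topologicalType) (F : set_system T)
    (f : T -> U) (g : T -> V) (x : U) (y : V) : Filter F ->
  f @ F --> x -> g @ F --> y -> (fun t => (f t, g t)) @ F --> (x, y).
Proof. by move=> FF; exact: (@cvg_pair _ _ _ F (nbhs x) (nbhs y)). Qed.

Section ClassC.
Variables (R : realType) (n : nat).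
Implicit Types (u v : 'rV[R]_n) (G : 'rV[R]_n -> R -> R) (q g : 'rV[R]_n -> R).
Local Notation S := (@sphere R n).
Local Notation cvg_S q u := (q @ within S (nbhs u) --> q u).

Definition continuousC G := {within @S_pos R n, continuous (fun z => G z.1 z.2)}.

Lemma continuousC_comp G q : continuousC G -> (forall u, S u -> 0 < q u) ->
  {within S, continuous q} -> {within S, continuous (fun u => G u (q u))}.
Proof.
move=> /subspace_continuousP cG q0 /subspace_continuousP cq.
apply/subspace_continuousP => u Su.
have Sp : S_pos (u, q u) by split => //; exact: q0.
apply: (@cvg_within_comp _ _ _ (within S (nbhs u)) (@S_pos R n) (fun v => (v, q v)) (fun z => G z.1 z.2) (u, q u) (G u (q u)) _ _ _ (cG _ Sp)).
  by apply: (@cvg_pair_pt _ _ _ (within S (nbhs u)) idfun q); [exact: cvg_within|exact: cq].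
by apply: filterS (withinT S (nbhs_filter u)) => v Sv; split => //; exact: q0.
Qed.

Lemma compact_band (a b : R) : compact (S `*` `[a, b]%classic).
Proof. by apply: compact_setX; [exact: compact_sphere|exact: segment_compact]. Qed.

Lemma continuousC_band G (a b : R) : continuousC G -> 0 < a ->
  {within S `*` `[a, b]%classic, continuous (fun z => G z.1 z.2)}.
Proof.
move=> cG a0; apply: continuous_subspaceW cG => -[u s] [/= Su].
by rewrite in_itv/= => /andP[as_ _]; split => //=; exact: lt_le_trans as_.
Qed.

Lemma continuousC_bounded G (a b : R) : continuousC G -> 0 < a ->
  exists2 M, 0 <= M & forall u s, S u -> a <= s <= b -> `|G u s| <= M.
Proof.
move=> cG a0.
have /compact_bounded[M [Mr hM]] := continuous_compact (continuousC_band (b := b) cG a0) (@compact_band a b).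
exists (`|M| + 1) => // u s Su sab; apply: hM; first by rewrite ltr_pwDr// ler_norm.
by exists (u, s).
Qed.

Lemma continuousC_lbound G (a b : R) : continuousC G -> 0 < a ->
  (forall u s, S u -> 0 < s -> 0 < G u s) ->
  exists2 m, 0 < m & forall u s, S u -> a <= s <= b -> m <= G u s.
Proof.
move=> cG a0 G0.
have [E0|] := eqVneq (S `*` `[a, b]%classic) set0.
  exists 1 => // u s Su sab; suff : (set0 : set ('rV[R]_n * R)) (u, s) by [].
  by rewrite -E0; split.
move=> /set0P ne.
have [[u s] /set_mem[/= Su sab] umin] := compact_EVT_min ne (@compact_band a b) (continuousC_band (b := b) cG a0).
exists (G u s) => [|v t Sv tab].
  by move: sab; rewrite in_itv/= => /andP[as_ _]; apply: G0 => //; exact: lt_le_trans as_.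
by apply: (umin (v, t)); rewrite inE; split.
Qed.

Lemma continuous_sphere_bounded q : {within S, continuous q} ->
  exists2 M, 0 <= M & forall u, S u -> `|q u| <= M.
Proof.
move=> cq.
have /compact_bounded[M [Mr hM]] := continuous_compact cq (@compact_sphere R n).
exists (`|M| + 1) => // u Su; apply: hM; first by rewrite ltr_pwDr// ler_norm.
by exists u.
Qed.

Lemma continuous_sphere_lbound q : {within S, continuous q} ->
  (forall u, S u -> 0 < q u) -> exists2 m, 0 < m & forall u, S u -> m <= q u.
Proof.
move=> cq q0; have [E0|/set0P ne] := eqVneq S set0.
  by exists 1 => // u; rewrite E0.
have [u /set_mem Su umin] := compact_EVT_min ne (@compact_sphere R n) cq.
by exists (q u) => [|v Sv]; [exact: q0|apply: umin; exact: mem_set].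
Qed.

(** The point [c] is located twice: [|c - t| <= |s - t|] makes it converge to [t] together with [s],
    and the min-max bounds keep it positive and in a compact band, whatever the order of [s] and
    [t]. *)
Lemma class_C_MVT G u (s t : R) : class_C G -> S u -> 0 < s -> 0 < t ->
  exists2 c, `|c - t| <= `|s - t| /\ Num.min s t <= c <= Num.max s t &
    G u s - G u t = dt G u c * (s - t).
Proof.
move=> [dG _] Su; wlog st : s t / s <= t.
  move=> wl s0 t0; have [st|] := boolP (s <= t); first exact: wl.
  rewrite -ltNge => /ltW ts.
  have [c [_ cb] e] := wl _ _ ts t0 s0; exists c; last first.
    by rewrite -opprB e -mulrN opprB.
  rewrite minC maxC; split => //; move: cb; rewrite min_l// max_r//.
  by move=> /andP[tc cs]; rewrite !ger0_norm ?subr_ge0// lerD2r.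
move=> s0 t0.
have dx x : x \in `[s, t] -> derivable (G u) x 1.
  by rewrite in_itv/= => /andP[sx _]; apply: dG => //; exact: lt_le_trans sx.
have [x|c cst e] := @MVT_segment _ (G u) (dt G u) s t st _ (derivable_within_continuous dx).
  move=> xst; rewrite /dt derive1E; apply: derivableP; apply: dx.
  by move: xst; rewrite !in_itv/= => /andP[/ltW -> /ltW ->].
move: cst; rewrite in_itv/= => /andP[sc ct]; exists c.
  by rewrite min_l// max_r// sc ct; split => //; rewrite !ler0_norm ?subr_le0// lerN2 lerD2r.
by rewrite -opprB e -mulrN opprB.
Qed.

Lemma dt_even G u (t : R) : class_C G -> even_fun G -> S u -> 0 < t -> dt G (- u) t = dt G u t.
Proof.
move=> _ eG Su t0; rewrite /dt !derive1E; apply: near_eq_derive.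
by near=> s; rewrite (eG u)//; near: s; exact: lt_nbhsr.
Unshelve. all: by end_near. Qed.

(** Chain rule for difference quotients of step [1/(k+1)]. The bound [C] forces [q k] to tend to
    [q0], so the mean value points do too, and [dt G] is continuous there. *)
Lemma class_C_diff_cvg G u (q : nat -> R) (q0 d C : R) : class_C G -> S u ->
  (forall k, 0 < q k) -> 0 < q0 ->
  (forall k, `|k.+1%:R * (q k - q0)| <= C) ->
  (fun k => k.+1%:R * (q k - q0)) @ \oo --> d ->
  (fun k => k.+1%:R * (G u (q k) - G u q0)) @ \oo --> dt G u q0 * d.
Proof.
move=> cG Su qp q0p qC qd.
have C0 : 0 <= C := le_trans (normr_ge0 _) (qC 0%N).
have qq k : `|q k - q0| <= C * k.+1%:R^-1.
  by rewrite ler_pdivlMr// -(@ger0_norm _ k.+1%:R)// -normrM mulrC.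
have [c hc] := choice (fun k => let: ex_intro2 c c1 c2 := class_C_MVT cG Su (qp k) q0p in
   ex_intro (fun c => (`|c - q0| <= `|q k - q0| /\ Num.min (q k) q0 <= c <= Num.max (q k) q0) /\
     G u (q k) - G u q0 = dt G u c * (q k - q0)) c (conj c1 c2)).
have -> : (fun k => k.+1%:R * (G u (q k) - G u q0)) =
    (fun k => dt G u (c k) * (k.+1%:R * (q k - q0))).
  by apply/funext => k; rewrite (hc k).2 mulrCA.
apply: cvgM => //.
have c0 k : 0 < c k.
  have [[_ /andP[+ _]] _] := hc k; apply: lt_le_trans.
  by rewrite lt_min qp q0p.
have cq : c @ \oo --> q0.
  apply/cvgrPdist_le => e e0; near=> k.
  rewrite distrC (le_trans (hc k).1.1)// (le_trans (qq k))//.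
  near: k; apply: (@cvgr_le _ _ _ _ _ (0 : R)) => //.
  rewrite -[0](mulr0 C); apply: cvgM; first exact: cvg_cst.
  exact: cvg_harmonic.
have /subspace_continuousP/(_ (u, q0)) := cG.2.2.
move=> /(_ (conj Su q0p)) cdG.
apply: (@cvg_within_comp _ _ _ _ (@S_pos R n) (fun k => (u, c k)) (fun z => dt G z.1 z.2) (u, q0) (dt G u q0) _ _ _ cdG).
  by apply: (@cvg_pair_pt _ _ _ _ (cst u) c) => //; exact: cvg_cst.
by apply: nearW => k; split => /=.
Unshelve. all: by end_near. Qed.

End ClassC.

(** * Borel integrals on the sphere *)

Section BorelIntegrals.
Variables (R : realType) (n : nat).
Implicit Types (u v : 'rV[R]_n) (A D : set 'rV[R]_n) (f g q : 'rV[R]_n -> R).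
Local Notation S := (@sphere R n).
Local Notation T := (borelRn R n).

Lemma open_borel A : open A -> measurable (A : set T).
Proof. by move=> oA; apply: sub_sigma_algebra. Qed.

Lemma closed_borel A : closed A -> measurable (A : set T).
Proof. by move=> /closed_openC/open_borel/measurableC; rewrite setCK. Qed.

Lemma measurable_sphere : measurable (S : set T).
Proof. by apply: closed_borel; exact: closed_sphere. Qed.

Lemma continuous_borel D f : measurable (D : set T) -> {within D, continuous f} ->
  measurable_fun (D : set T) (f : T -> R).
Proof.
move=> mD /continuousP cf; apply: (measurability _ (measurable_realfun.RGenOpens.measurableE R)).
move=> _ [_ [a [b ->] <-]].
have /open_subspaceP[V oV VD] := cf _ (@interval_open R (BRight a) (BLeft b) isT isT).
by rewrite setIC -VD; apply: measurableI => //; exact: open_borel.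
Qed.

Lemma sphere_continuous_borel D f : measurable (D : set T) -> D `<=` S ->
  {within S, continuous f} -> measurable_fun (D : set T) (f : T -> R).
Proof. by move=> mD DS cf; apply: continuous_borel => //; exact: continuous_subspaceW cf. Qed.

Lemma oppv_borel : measurable_fun setT (-%R : T -> T).
Proof.
apply: (@measurability _ _ T T setT -%R (@open_sets R n) erefl) => _ [A oA <-]; rewrite setTI.
apply: open_borel; apply: (@open_comp 'rV[R]_n 'rV[R]_n -%R A) => // x _.
exact: opp_continuous.
Qed.

Variable mu : {measure set T -> \bar R}.
Hypothesis mu_fin : (mu setT < +oo)%E.
Variable D : set 'rV[R]_n.
Hypothesis mD : measurable (D : set T).
Local Notation I f := (Rintegral mu D f).

Lemma finite_measureS A : measurable (A : set T) -> (mu A < +oo)%E.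
Proof. by move=> mA; apply: le_lt_trans mu_fin; apply: le_measure => //; rewrite inE. Qed.

Lemma bounded_integrable f (M : R) : measurable_fun (D : set T) (f : T -> R) ->
  (forall u, D u -> `|f u| <= M) -> mu.-integrable D (EFin \o f).
Proof.
move=> mf fM; apply: measurable_bounded_integrable => //; first exact: finite_measureS.
exists M; split => [|x Mx y Dy]; first exact: num_real.
apply: le_trans (fM _ Dy) _; exact: ltW.
Qed.

Lemma Rint_dominated (fk : nat -> 'rV[R]_n -> R) f (M : R) :
  (forall k, measurable_fun (D : set T) (fk k : T -> R)) ->
  (forall k u, D u -> `|fk k u| <= M) ->
  (forall u, D u -> fk ^~ u @ \oo --> f u) ->
  measurable_fun (D : set T) (f : T -> R) /\ (fun k => I (fk k)) @ \oo --> I f.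
Proof.
move=> mfk fM ff.
have mf : measurable_fun (D : set T) (f : T -> R).
  exact: (@measurable_realfun.measurable_fun_cvg _ T R D fk f mfk ff).
split=> //.
have fb u : D u -> `|f u| <= M.
  move=> Du; apply: (cvgr_to_le (cvg_norm (ff u Du))).
  by apply: nearW => k; exact: fM.
have M0 : mu.-integrable D (EFin \o cst M).
  by apply: (@bounded_integrable _ `|M|) => //; exact: measurable_cst.
have ffE u : D u -> (fun k => (fk k u)%:E) @ \oo --> (f u)%:E.
  by move=> Du; apply: cvg_EFin; [exact: nearW|exact: ff].
have [_ _] := @dominated_convergence _ T R mu D mD (fun k => EFin \o fk k) (EFin \o f) (cst M%:E)
  (fun k => (measurable_EFinP _ _).2 (mfk k))
  ((measurable_EFinP _ _).2 mf)
  (aeW mu ffE)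
  M0 (aeW mu (fun x k Dx => fM k x Dx)).
rewrite -[X in _ --> X]fineK; first by move=> /fine_cvg.
exact/integrable_fin_num/(bounded_integrable mf fb).
Qed.

Lemma RintD f g (M : R) : measurable_fun (D : set T) (f : T -> R) ->
  measurable_fun (D : set T) (g : T -> R) ->
  (forall u, D u -> `|f u| <= M) -> (forall u, D u -> `|g u| <= M) ->
  I (fun u => f u + g u) = I f + I g.
Proof. by move=> mf mg fM gM; exact: RintegralD mD (bounded_integrable mf fM) (bounded_integrable mg gM). Qed.

Lemma RintB f g (M : R) : measurable_fun (D : set T) (f : T -> R) ->
  measurable_fun (D : set T) (g : T -> R) ->
  (forall u, D u -> `|f u| <= M) -> (forall u, D u -> `|g u| <= M) ->
  I (fun u => f u - g u) = I f - I g.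
Proof. by move=> mf mg fM gM; exact: RintegralB mD (bounded_integrable mf fM) (bounded_integrable mg gM). Qed.

Lemma RintZ c f (M : R) : measurable_fun (D : set T) (f : T -> R) ->
  (forall u, D u -> `|f u| <= M) -> I (fun u => c * f u) = c * I f.
Proof. by move=> mf fM; exact: RintegralZl mD (bounded_integrable mf fM). Qed.

Lemma Rint_le f g (M : R) : measurable_fun (D : set T) (f : T -> R) ->
  measurable_fun (D : set T) (g : T -> R) ->
  (forall u, D u -> `|f u| <= M) -> (forall u, D u -> `|g u| <= M) ->
  (forall u, D u -> f u <= g u) -> I f <= I g.
Proof. by move=> mf mg fM gM; exact: le_Rintegral mD (bounded_integrable mf fM) (bounded_integrable mg gM). Qed.

Lemma Rint_dist f g (M e : R) : measurable_fun (D : set T) (f : T -> R) ->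
  measurable_fun (D : set T) (g : T -> R) ->
  (forall u, D u -> `|f u| <= M) -> (forall u, D u -> `|g u| <= M) ->
  (forall u, D u -> `|f u - g u| <= e) -> `|I f - I g| <= e * fine (mu D).
Proof.
move=> mf mg fM gM fg; rewrite -(RintB mf mg fM gM) -Rintegral_cst//.
have mfg : measurable_fun (D : set T) ((f \- g)%R : T -> R) by exact: measurable_funB.
have ifg := bounded_integrable mfg fg.
apply: le_trans (le_normr_Rintegral mD ifg) _.
apply: le_Rintegral => //.
  by apply: (@bounded_integrable _ e) => [|u Du]; [exact: measurableT_comp|rewrite normr_id; exact: fg].
by apply: (@bounded_integrable _ `|e|) => //; exact: measurable_cst.
Qed.

Hypothesis DS : D `<=` S.

(** Differentiation under the integral by dominated convergence: the mean value theorem bounds the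
    quotients by [C] times the supremum of [|dt G|] on the band [[a, b]]. The limits are required on
    [D] only, because the variation of the gauge is known only at regular directions. *)
Lemma Rint_derivative G (q : nat -> 'rV[R]_n -> R) q0 d (a b C : R) :
  class_C G -> 0 < a ->
  (forall k, {within S, continuous (q k)}) -> {within S, continuous q0} ->
  (forall k u, S u -> a <= q k u <= b) -> (forall u, S u -> a <= q0 u <= b) ->
  (forall k u, D u -> `|k.+1%:R * (q k u - q0 u)| <= C) ->
  (forall u, D u -> (fun k => k.+1%:R * (q k u - q0 u)) @ \oo --> d u) ->
  [/\ measurable_fun (D : set T) ((fun u => dt G u (q0 u) * d u) : T -> R),
     exists M, forall u, D u -> `|dt G u (q0 u) * d u| <= M &
     (fun k => k.+1%:R * (I (fun u => G u (q k u)) - I (fun u => G u (q0 u)))) @ \oo -->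
        I (fun u => dt G u (q0 u) * d u)].
Proof.
move=> cG a0 cq cq0 qab q0ab qC qd.
have qp k u : S u -> 0 < q k u by move=> /(qab k)/andP[+ _]; exact: lt_le_trans.
have q0p u : S u -> 0 < q0 u by move=> /q0ab/andP[+ _]; exact: lt_le_trans.
have [M M0 GM] := continuousC_bounded b cG.2.1 a0.
have [M' M'0 G'M] := continuousC_bounded b cG.2.2 a0.
have mG k : measurable_fun (D : set T) ((fun u => G u (q k u)) : T -> R).
  by apply: sphere_continuous_borel => //; apply: continuousC_comp => //; [exact: cG.2.1|exact: qp].
have mG0 : measurable_fun (D : set T) ((fun u => G u (q0 u)) : T -> R).
  by apply: sphere_continuous_borel => //; apply: continuousC_comp => //; exact: cG.2.1.
pose Dk k u := k.+1%:R * (G u (q k u) - G u (q0 u)).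
have Db k u : D u -> `|Dk k u| <= M' * C.
  move=> Du; have Su := DS Du; have [c [_ /andP[c1 c2]] e] := class_C_MVT cG Su (qp k u Su) (q0p u Su).
  rewrite /Dk e mulrCA normrM ler_pM//; last exact: qC.
  apply: G'M => //; have /andP[qa qb] := qab k u Su; have /andP[q0a q0b] := q0ab u Su.
  by rewrite (le_trans _ c1) ?le_min ?qa// (le_trans c2)// ge_max qb.
have Dd u : D u -> Dk ^~ u @ \oo --> dt G u (q0 u) * d u.
  move=> Du; have Su := DS Du.
  apply: (class_C_diff_cvg cG Su (fun k => qp k u Su) (q0p u Su) (fun k => qC k u Du)).
  exact: qd.
have mD' k : measurable_fun (D : set T) (Dk k : T -> R).
  by apply: measurable_funM; [exact: measurable_cst|exact: measurable_funB].
have [mf cf] := Rint_dominated mD' Db Dd; split => //.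
  exists (M' * C) => u Du; apply: (cvgr_to_le (cvg_norm (Dd u Du))).
  by apply: nearW => k; exact: Db.
suff -> : (fun k => k.+1%:R * (I (fun u => G u (q k u)) - I (fun u => G u (q0 u)))) =
  (fun k => I (Dk k)) by [].
apply/funext => k; rewrite /Dk.
have GMk u : D u -> `|G u (q k u)| <= M by move=> /DS Su; apply: GM => //; exact: qab.
have GM0 u : D u -> `|G u (q0 u)| <= M by move=> /DS Su; apply: GM => //; exact: q0ab.
rewrite -(RintB (mG k) mG0 GMk GM0) -(@RintZ _ _ (M + M))//; first exact: measurable_funB.
by move=> u Du; apply: le_trans (ler_normB _ _) _; rewrite lerD// ?GMk ?GM0.
Qed.

End BorelIntegrals.

(** * Null sets and singular directions *)

Section LipschitzGraph.
Variables (R : realType) (n : nat).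
Implicit Types (x y : 'rV[R]_n) (A : set 'rV[R]_n).

Lemma sum_head_tail (K N : nat) (v : R) : 0 <= v ->
  \sum_(k < N) (if (k < K)%N then v else 0) <= K%:R * v.
Proof.
move=> v0; suff -> : \sum_(k < N) (if (k < K)%N then v else 0) = (minn N K)%:R * v.
  by rewrite ler_wpM2r// ler_nat geq_minr.
elim: N => [|N IH]; first by rewrite big_ord0 min0n mul0r.
rewrite big_ord_recr/= IH; case: ltnP => NK.
  by rewrite (minn_idPl NK) -natr1 mulrDl mul1r.
by rewrite addr0 (minn_idPr (leq_trans NK (leqnSn N))).
Qed.

Lemma sum_geometric_le (N : nat) (e : R) : 0 <= e ->
  \sum_(k < N) (e / 2 ^+ k.+2) <= e / 2.
Proof.
move=> e0; suff -> : \sum_(k < N) (e / 2 ^+ k.+2) = e / 2 - e / 2 ^+ N.+1.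
  by rewrite gerBl divr_ge0// exprn_ge0.
elim: N => [|N IH]; first by rewrite big_ord0 expr1 subrr.
rewrite big_ord_recr/= IH !(exprS 2 N.+1); have : (2 : R) ^+ N.+1 != 0 by rewrite expf_neq0.
by move: (2 ^+ N.+1) => c c0; field.
Qed.

(** Cover by about [M ^ (n - 1)] cubes of side [O(1/M)], one over each cell of the grid of the
    remaining coordinates; the infinitely many cubes left over in the definition of
    [lebesgue_null] are given radii summing to at most [eps / 2]. *)
Lemma lipschitz_graph_null A (i : 'I_n) (L : R) : 0 <= L ->
  (forall x j, A x -> `|x ord0 j| <= 1) ->
  (forall x y B, A x -> A y -> 0 <= B -> (forall j, j != i -> `|x ord0 j - y ord0 j| <= B) ->
     `|x ord0 i - y ord0 i| <= L * B) ->
  lebesgue_null A.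
Proof.
move=> L0 A1 AL eps eps0; have n0 : (0 < n)%N by apply: leq_ltn_trans (ltn_ord i).
(* [c1 / M] bounds the total volume of the main cubes: there are [(2M+1)^(n-1) <= (3M)^(n-1)] of
   them, each of side [2(2+L)/M]. *)
pose c1 : R := 3 ^+ n.-1 * (2 * (2 + L)) ^+ n.
have c10 : 0 <= c1 by rewrite mulr_ge0// exprn_ge0// mulr_ge0// addr_ge0.
pose M := (Num.truncn (c1 / (eps / 2))).+1.
have M0 : 0 < M%:R :> R by rewrite ltr0n.
have cM : c1 / M%:R <= eps / 2.
  rewrite ler_pdivrMr// mulrC -ler_pdivrMr ?divr_gt0//.
  by apply: ltW; have /andP[] := truncn_itv (divr_ge0 c10 (ltW (divr_gt0 eps0 (ltr0n R 2)))).
pose F := {ffun 'I_n.-1 -> 'I_(2 * M).+1}.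
(* [lift i] runs through the coordinates other than [i]. They lie in [-1, 1], so the integer parts
   are at most [2M] and [inord] does not truncate on [A]. *)
pose key x : F := [ffun j => inord (Num.truncn ((x ord0 (lift i j) + 1) * M%:R))].
have keyP x y : A x -> A y -> key x = key y -> forall j, j != i ->
    `|x ord0 j - y ord0 j| <= M%:R^-1.
  move=> Ax Ay /ffunP kxy j ji; have [l -> _] := unlift_some (negbT (introF eqP (fun e => elimN eqP ji (esym e)))).
  have b z : A z -> 0 <= (z ord0 (lift i l) + 1) * M%:R <= (2 * M)%:R.
    move=> Az; have := A1 _ (lift i l) Az; rewrite ler_norml => /andP[z1 z2].
    apply/andP; split; first by rewrite mulr_ge0 ?(ltW M0)//; move: z1; lra.
    by rewrite natrM ler_pM2r//; move: z2; lra.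
  have tr z : A z -> (Num.truncn ((z ord0 (lift i l) + 1) * M%:R) < (2 * M).+1)%N.
    move=> Az; have /andP[z0 z1] := b _ Az; rewrite ltnS -(ler_nat R).
    by apply: le_trans z1; have /andP[] := truncn_itv z0.
  have := congr1 val (kxy l); rewrite !ffunE/= !inordK ?tr// => e.
  have /andP[x0 _] := b _ Ax; have /andP[y0 _] := b _ Ay.
  have /andP[x1 x2] := truncn_itv x0; have /andP[y1 y2] := truncn_itv y0.
  rewrite e -natr1 in x1 x2; rewrite -natr1 in y2.
  rewrite -(ler_pM2r M0) mulVf ?gt_eqF// -{1}(gtr0_norm M0) -normrM mulrBl ler_norml.
  by move: x1 x2 y1 y2; lra.
(* One point of [A] per grid cell; the default 0 serves the cells that miss [A]. *)
pose yk (f : F) := xget 0 [set x | A x /\ key x = f].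
have ykP x : A x -> A (yk (key x)) /\ key (yk (key x)) = key x.
  by move=> Ax; rewrite /yk; case: xgetP => [z _|/(_ x)/not_andP[]].
pose r : R := (2 + L) / M%:R.
have r0 : 0 < r by rewrite divr_gt0// ltr_pwDl.
pose K := #|{: F}|.
(* The minimum with 1 makes the side at most 1, so that its [n]-th power is at most the side
   itself. *)
pose tl k : R := Num.min 1 eps / 2 ^+ k.+3.
have tl0 k : 0 < tl k by rewrite divr_gt0// ?exprn_gt0// lt_min ltr01.
have key0 : F := [ffun=> ord0].
exists (fun k => yk (nth key0 (enum {: F}) k)), (fun k => if (k < K)%N then r else tl k).
split; first by move=> k; case: ifP.
split.
  move=> x Ax; exists (index (key x) (enum {: F})) => // j.
  have kx : (index (key x) (enum {: F}) < K)%N by rewrite /K cardE index_mem mem_enum.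
  rewrite kx nth_index ?mem_enum//; have [Ay ky] := ykP _ Ax.
  have hj := keyP _ _ Ax Ay (esym ky).
  have [->|ji] := eqVneq j i.
    apply: le_lt_trans (AL _ _ M%:R^-1 Ax Ay _ hj) _; first by rewrite invr_ge0 ltW.
    by rewrite ltr_pM2r ?invr_gt0// ltrDr.
  apply: le_lt_trans (hj _ ji) _.
  by rewrite -[ltLHS]mul1r ltr_pM2r ?invr_gt0//; move: L0; lra.
move=> N; pose v := (2 * r) ^+ n.
have v0 : 0 <= v by rewrite exprn_ge0// mulr_ge0// ltW.
apply: (@le_trans _ _ (\sum_(k < N) ((if (k < K)%N then v else 0) + eps / 2 ^+ k.+2))).
  apply: ler_sum => k _; case: ifP => _; first by rewrite lerDl divr_ge0 ?exprn_ge0// ltW.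
  have t2 : 2 * tl k = Num.min 1 eps / 2 ^+ k.+2.
    rewrite /tl (exprS 2 k.+2); have : (2 : R) ^+ k.+2 != 0 by rewrite expf_neq0.
    by move: (2 ^+ k.+2) (Num.min 1 eps) => c m ce; field.
  rewrite add0r t2; apply: (@le_trans _ _ (Num.min 1 eps / 2 ^+ k.+2)).
    rewrite -[leRHS]expr1; apply: ler_wiXn2l => //.
      by rewrite divr_ge0 ?exprn_ge0// le_min ler01 ltW.
    by rewrite ler_pdivrMr ?exprn_gt0// mul1r ge_min exprn_ege1 ?ler1n.
  by rewrite ler_pM2r ?invr_gt0 ?exprn_gt0// ge_min lexx orbT.
rewrite big_split/= [leRHS](splitr eps) lerD ?sum_geometric_le ?(ltW eps0)//.
apply: le_trans (sum_head_tail _ _ v0) _; apply: le_trans cM.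
rewrite /K card_ffun !card_ord natrX /v /r /c1.
apply: (@le_trans _ _ ((3 * M%:R) ^+ n.-1 * (2 * ((2 + L) / M%:R)) ^+ n)).
  apply: ler_wpM2r => //; apply: lerXn2r; rewrite ?nnegrE ?mulr_ge0 ?(ltW M0)//.
  by rewrite -natrM ler_nat (mulSn 2 M) -add1n leq_add2r.
have eS (z : R) : z ^+ n = z * z ^+ n.-1 by rewrite -exprS prednK.
rewrite (mulrA 2) !exprMn exprVn (eS M%:R).
have X0 : M%:R ^+ n.-1 != 0 :> R by rewrite expf_neq0// gt_eqF.
have Y0 : M%:R != 0 :> R by rewrite gt_eqF.
move: X0 Y0; move: (M%:R ^+ n.-1) => X; move: (M%:R : R) => Y X0 Y0.
by rewrite le_eqVlt; apply/orP; left; apply/eqP; field; rewrite ?X0 ?Y0.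
Qed.

End LipschitzGraph.

(** * Directions with several outer normals *)

Lemma closed_within_preimage (T U : topologicalType) (A : set T) (f : T -> U) (B : set U) :
  closed A -> closed B -> {within A, continuous f} -> closed (A `&` f @^-1` B).
Proof.
move=> cA cB /continuous_closedP/(_ _ cB)/closed_subspaceP[V cV VA].
by rewrite setIC -VA; exact: closedI.
Qed.

Section Singular.
Variables (R : realType) (n : nat).
Implicit Types (x y u v xi : 'rV[R]_n) (C : set 'rV[R]_n).
Local Notation S := (@sphere R n).
Local Notation T := (borelRn R n).

(** For the weight [w = 1/h] of a convex body these are the outer unit normals at its boundary point
    in direction [xi]; see [normals_wulff]. *)
Definition maximizers (w : 'rV[R]_n -> R) xi : set 'rV[R]_n :=
  [set u | S u /\ dotv xi u * w u = pol S w xi].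

Definition singular (w : 'rV[R]_n -> R) : set 'rV[R]_n :=
  [set xi | S xi /\ exists u v, [/\ maximizers w xi u, maximizers w xi v & u <> v]].

Variables (w : 'rV[R]_n -> R) (a b : R).
Hypotheses (n0 : (0 < n)%N) (a0 : 0 < a) (wab : forall u, S u -> a <= w u <= b)
  (cw : {within S, continuous w}).
Local Notation p := (pol S w).

Let w0b u : S u -> 0 <= w u <= b.
Proof. by move=> /wab/andP[aw ->]; rewrite (le_trans _ aw)// ltW. Qed.

Let w0 u : S u -> 0 < w u.
Proof. by move=> /wab/andP[aw _]; exact: lt_le_trans aw. Qed.

Lemma maximizers_nonempty xi : maximizers w xi !=set0.
Proof.
have [u Su e] := pol_attained (@subset_refl _ S) (sphere_nonempty R n0) w0b xi (@compact_sphere R n) cw.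
by exists u.
Qed.

(** A maximizer can be found in [C] exactly when the supremum over [S] and [C] reaches the supremum
    over [S], and both suprema are continuous in [xi]. The case of an empty intersection is
    separate, since the supremum of the empty set carries no meaning. *)
Lemma closed_maximizers_meet C : closed C ->
  closed [set xi | S xi /\ exists2 u, C u & maximizers w xi u].
Proof.
move=> cC; have [E0|/set0P E0] := eqVneq (S `&` C) set0.
  rewrite (_ : [set xi | _] = set0); first exact: closed0.
  apply/seteqP; split=> // xi [_ [u Cu [Su _]]].
  by suff : set0 u by []; rewrite -E0.
have CS : S `&` C `<=` S by move=> u [].
have wC u : (S `&` C) u -> 0 <= w u <= b by move=> [Su _]; exact: w0b.
have cwC : {within S `&` C, continuous w} by exact: continuous_subspaceW cw.
have cSC : compact (S `&` C) by apply: compact_closedI => //; exact: compact_sphere.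
rewrite (_ : [set xi | _] = S `&` (fun xi => pol (S `&` C) w xi - p xi) @^-1` [set t | 0 <= t]).
  apply: closed_within_preimage; [exact: closed_sphere|exact: closed_ge|].
  apply: continuous_subspaceT => xi.
  apply: (@cvgB _ _ _ (nbhs xi) (nbhs_filter xi)).
    exact: (continuous_pol CS E0 wC).
  exact: (continuous_pol (@subset_refl _ S) (sphere_nonempty R n0) w0b).
apply/seteqP; split => [xi [Sxi [u Cu [Su e]]]|xi [Sxi /=]].
  by split => //=; rewrite subr_ge0 -e; exact: (pol_ub CS E0 wC).
rewrite subr_ge0 => h; split => //.
have [u [Su Cu] e] := pol_attained CS E0 wC xi cSC cwC.
exists u => //; split => //; apply/eqP; rewrite eq_le (polS_ub n0 a0 wab)//=.
by rewrite e.
Qed.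

(** For a maximizer [u], the vector [w u *: u] is a subgradient of [p] at [xi]. Two distinct
    subgradients are separated in some coordinate [i] by rationals [r < s], so countably many sets
    [Zle i r] meeting [Zge i s] exhaust the singular set. *)
Let Zle i (r : R) := [set xi | S xi /\ exists2 u, (S `&` [set u | w u * u ord0 i <= r]) u & maximizers w xi u].
Let Zge i (r : R) := [set xi | S xi /\ exists2 u, (S `&` [set u | r <= w u * u ord0 i]) u & maximizers w xi u].

Let continuous_wi i : {within S, continuous (fun u => w u * u ord0 i)}.
Proof.
apply/subspace_continuousP => u Su; apply: cvgM; first exact: (subspace_continuousP _ _).1.
apply: (cvg_trans _ (@continuous_coord _ _ i u)).
by apply: cvg_app; exact: cvg_within.
Qed.

Let closedZ i r s : closed (Zle i r `&` Zge i s).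
Proof.
apply: closedI; apply: closed_maximizers_meet.
  apply: (@closed_within_preimage _ _ S (fun u => w u * u ord0 i) [set t | t <= r]).
  - exact: closed_sphere.
  - exact: closed_le.
  - exact: continuous_wi.
apply: (@closed_within_preimage _ _ S (fun u => w u * u ord0 i) [set t | s <= t]).
- exact: closed_sphere.
- exact: closed_ge.
- exact: continuous_wi.
Qed.

(** For [y], [y'] in the cone with subgradients [P] at [y] and [Q] at [y'] of the gauge,
    monotonicity gives [(P - Q) . (y - y') >= 0], while [P_i <= r < s <= Q_i]. *)
Let coneZ i r s : r < s -> spherical_null (Zle i r `&` Zge i s).
Proof.
move=> rs; split; first by move=> xi [[]].
(* Subgradients have coordinates of size at most [b], so each coordinate other than [i] contributes
   at most [B * (2b)] to the pairing, while coordinate [i] costs at least [s - r] per unit. *)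
pose L : R := n%:R * (2 * b) / (s - r).
have b0 : 0 <= b by have [u /w0b/andP[]] := sphere_nonempty R n0; exact: le_trans.
have sr : 0 < s - r by rewrite subr_gt0.
have pZ xi t : 0 <= t -> p (t *: xi) = t * p xi.
  exact: (polZ (@subset_refl _ S) (sphere_nonempty R n0) w0b).
apply: (@lipschitz_graph_null _ _ _ i L).
- by rewrite divr_ge0 ?mulr_ge0// ltW.
- move=> _ j [t [xi [[Sxi _] _] [/andP[t0 t1] ->]]]; rewrite mxE normrM.
  by rewrite (gtr0_norm t0) mulr_ile1 ?(ltW t0)// sphere_coord_le1.
suff main y y' B : cone (Zle i r `&` Zge i s) y -> cone (Zle i r `&` Zge i s) y' ->
   0 <= B -> (forall j, j != i -> `|y ord0 j - y' ord0 j| <= B) -> y ord0 i - y' ord0 i <= L * B.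
  move=> y y' B Zy Zy' B0 h; rewrite ler_norml lerNl opprB !main//.
  by move=> j ji; rewrite distrC h.
move=> [t [xi [[Sxi [u [Su ur] [_ ue]]] _] [/andP[t0 _] ->]]].
move=> [t' [xi' [_ [Sxi' [v [Sv vs] [_ ve]]]] [/andP[t'0 _] ->]]] B0 hB.
set z := t *: xi - t' *: xi'.
have z1 : dotv z (w u *: u - w v *: v) >= 0.
  rewrite dotvBr !dotvZr /z !dotvBl !dotvZl !mulrBr.
  have h1 := ler_wpM2l (ltW t'0) (polS_ub n0 a0 wab xi' Su).
  have h2 := ler_wpM2l (ltW t0) (polS_ub n0 a0 wab xi Sv).
  rewrite /= in ue ve; move: h1 h2; rewrite -ue -ve; nra.
have zi : z ord0 i * (s - r) <= \sum_(j < n | j != i) B * (2 * b).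
  move: z1; rewrite /dotv (bigD1 i)//= -lerBlDl sub0r => h.
  have h3 : z ord0 i * (s - r) <= - (z ord0 i * (w u *: u - w v *: v) ord0 i) \/ z ord0 i <= 0.
    have [z0|z0] := leP (z ord0 i) 0; [by right|left].
    rewrite -mulrN ler_pM2l// !mxE opprB; move: ur vs => /=; lra.
  have sum0 : 0 <= \sum_(j < n | j != i) B * (2 * b) by apply: sumr_ge0 => j _; rewrite !mulr_ge0.
  case: h3 => [h3|z0]; last by rewrite (le_trans _ sum0)// mulr_le0_ge0// ltW.
  apply: le_trans h3 _; apply: le_trans h _; apply: ler_sum => j ji.
  apply: le_trans (ler_norm _) _; rewrite normrM ler_pM//.
    by have := hB j ji; rewrite !mxE.
  rewrite !mxE; apply: le_trans (ler_normB _ _) _; rewrite !normrM.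
  have bd u' : S u' -> `|w u'| * `|u' ord0 j| <= b.
    move=> Su'; rewrite (ger0_norm (ltW (w0 Su'))) -[leRHS]mulr1 ler_pM ?(ltW (w0 Su'))//.
      by have /andP[] := w0b Su'.
    exact: sphere_coord_le1.
  by rewrite mulr_natl mulr2n lerD// bd.
have -> : L * B = B * (n%:R * (2 * b)) / (s - r) by rewrite /L mulrAC [in LHS](mulrC _ B).
rewrite ler_pdivlMr//.
have -> : (t *: xi) ord0 i - (t' *: xi') ord0 i = z ord0 i by rewrite !mxE.
apply: le_trans zi _; apply: (@le_trans _ _ (\sum_(j < n) B * (2 * b))).
  by rewrite [leRHS](bigD1 i)//= lerDr !mulr_ge0.
by rewrite sumr_const card_ord -(mulr_natl (B * (2 * b)) n) mulrCA.
Qed.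

Let N k : set 'rV[R]_n := if @unpickle ('I_n * (rat * rat))%type k is Some (i, (r, s)) then
  if (ratr r < ratr s :> R) then Zle i (ratr r) `&` Zge i (ratr s) else set0 else set0.

Let singularE : singular w = \bigcup_k N k.
Proof.
apply/seteqP; split => [xi [Sxi [u [v [mu mv uv]]]]|xi [k _]].
  (* Distinct maximizers give distinct subgradients: if [w u *: u = w v *: v], comparing lengths
     gives [w u = w v] and then [u = v]. *)
  have [i] : exists i, w u * u ord0 i != w v * v ord0 i.
    apply/existsP; rewrite -negb_forall; apply: contra_notN uv => /forallP/(_ _)/eqP h.
    have e : w u *: u = w v *: v by apply/rowP => i; rewrite !mxE.
    have Su := mu.1; have Sv := mv.1.
    have : dotv (w u *: u) (w u *: u) = dotv (w v *: v) (w v *: v) by rewrite e.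
    rewrite !dotvZl !dotvZr Su Sv !mulr1 -!expr2 => /eqP.
    rewrite eqrXn2 ?(ltW (w0 _))// => /eqP e2.
    by move: e; rewrite e2 => /(scalerI (lt0r_neq0 (w0 Sv))).
  wlog lt : u v mu mv {uv} / w u * u ord0 i < w v * v ord0 i.
    move=> wl ne; have := ne; rewrite neq_lt => /orP[l|l].
      by apply: (wl u v) => //; rewrite lt_eqF.
    by apply: (wl v u) => //; rewrite lt_eqF.
  move=> _; have [r] := rat_in_itvoo lt; rewrite in_itv/= => /andP[r1 r2].
  have [s] := rat_in_itvoo r2; rewrite in_itv/= => /andP[s1 s2].
  exists (pickle (i, (r, s))) => //; rewrite /N pickleK s1; split; split => //.
    by exists u => //; split; [exact: mu.1|exact: ltW].
  by exists v => //; split; [exact: mv.1|exact: ltW].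
rewrite /N; case: unpickle => // -[i [r s]]; case: ifP => // rs [[Sxi [u [_ ur] mu]] [_ [v [_ vs] mv]]].
split => //; exists u, v; split => // e; move: ur vs; rewrite e /= => h1 h2.
by have := lt_le_trans rs (le_trans h2 h1); rewrite ltxx.
Qed.

Lemma singular_null (lam : {measure set T -> \bar R}) : class_M lam ->
  measurable (singular w : set T) /\ lam (singular w) = 0%E.
Proof.
move=> [_ lam0].
have mN k : measurable (N k : set T).
  rewrite /N; case: unpickle => [[i [r s]]|//]; case: ifP => // _.
  by apply: closed_borel; exact: closedZ.
have N0 k : lam (N k) = 0%E.
  have := mN k; rewrite /N; case: unpickle => [[i [r s]]|] //; rewrite ?measure0//.
  by case: ifP => [rs mZ|]; rewrite ?measure0//; apply: lam0 => //; exact: coneZ.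
rewrite singularE; split; first exact: bigcupT_measurable.
apply: (@measure_negligible _ _ _ lam); first exact: bigcupT_measurable.
apply: negligible_bigcup => k; exists (N k); split => //.
Qed.

End Singular.

(** * Coercivity of the energies *)

(** Compactness in the form used for all uniformity statements below: thresholds valid on a ball
    around each point yield one index valid on all of [A]. *)
Lemma near_covering_nat (R : realType) (V : pseudoMetricType R) (A : set V) (P : nat -> V -> Prop) :
  compact A ->
  (forall x, A x -> exists2 e, 0 < e & exists k0, forall y k, ball x e y -> (k0 <= k)%N -> P k y) ->
  exists k, forall x, A x -> P k x.
Proof.
move=> /compact_near_coveringP cA h.
have [k _ hk] : \forall k \near \oo, A `<=` P k.
  apply: cA => x Ax; have [e e0 [k0 hk]] := h x Ax.
  exists (ball x e, [set k | (k0 <= k)%N]) => /=; last by move=> [y k] [/= ye ke]; exact: hk.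
  by split; [exact: nbhsx_ballx|exists k0].
by exists k => x Ax; exact: (hk k (leqnn k)).
Qed.

Section Coercivity.
Variables (R : realType) (n : nat).
Implicit Types (u v x y xi : 'rV[R]_n) (Phi Psi G : 'rV[R]_n -> R -> R) (f p q : 'rV[R]_n -> R).
Local Notation S := (@sphere R n).
Local Notation T := (borelRn R n).
Hypothesis n0 : (0 < n)%N.

Definition even_on_sphere p := forall u, S u -> p (- u) = p u.

Definition slab v (d : R) : set 'rV[R]_n := [set u | S u /\ `|dotv v u| < d].

Lemma continuous_absdot v : continuous (fun u : 'rV[R]_n => `|dotv v u|).
Proof.
move=> u; apply: (@cvg_norm _ _ _ (nbhs u)).
by apply: (@continuous_dotv _ _ _ (cst v) idfun (nbhs u)); [exact: cvg_cst|exact: cvg_id].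
Qed.

Lemma measurable_slab v d : measurable (slab v d : set T).
Proof.
rewrite (_ : slab v d = S `&` [set u | `|dotv v u| < d]) //.
apply: measurableI; first exact: measurable_sphere.
apply: open_borel; apply: (@open_comp 'rV[R]_n R (fun u => `|dotv v u|) [set t | t < d]).
  by move=> u _; exact: continuous_absdot.
exact: open_lt.
Qed.

Lemma slab_sub u v (d : R) : ball u (d / (2 * n%:R)) v ->
  slab v (d / 2) `<=` slab u d.
Proof.
have nR : 0 < n%:R :> R by rewrite ltr0n.
rewrite -ball_normE /= => uv x [Sx vx]; split => //.
have -> : dotv u x = dotv v x + dotv (u - v) x by rewrite dotvBl; ring.
apply: le_lt_trans (ler_normD _ _) _; rewrite (splitr d) ltrD//.
apply: le_lt_trans (dotv_norm_le _ Sx) _.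
rewrite -ltr_pdivlMl//; apply: lt_le_trans uv _.
by rewrite le_eqVlt; apply/orP; left; apply/eqP; field; rewrite gt_eqF.
Qed.

Section OneMeasure.
Variable mu : {measure set T -> \bar R}.
Hypothesis smu : sphere_measure mu.
Local Notation I f := (Rintegral mu S f).
Local Notation m A := (fine (mu A)).

Let mu_fin : (mu setT < +oo)%E := smu.2.1.

Let mass_fin (A : set T) : measurable A -> mu A \is a fin_num.
Proof. by move=> mA; rewrite ge0_fin_numE//; exact: finite_measureS. Qed.

Lemma measure_setD_eq0 (A B : set T) : measurable A -> measurable B -> B `<=` A ->
  mu B = mu A -> mu (A `\` B) = 0%E.
Proof.
move=> mA mB BA e; have h : (mu A - mu B)%E = 0%E by rewrite e subee// mass_fin.
by rewrite measureD//; [rewrite (setIidr BA); exact: h|exact: finite_measureS].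
Qed.

Lemma mass_sphere_gt0 : 0 < m S.
Proof.
have mS := @measurable_sphere R n.
have e : mu setT = mu S.
  rewrite -(setUv S) measureU//; last by rewrite setICr.
    by rewrite [X in (_ + X)%E]smu.1 adde0.
  exact: measurableC.
rewrite fine_gt0// -e smu.2.1 andbT lt0e smu.2.2 measure_ge0//.
Qed.

(** The complement of a great subsphere is the union of the complements of ever thinner slabs, so
    some slab around it misses positive mass. [slab_sub] makes the width locally uniform in the axis
    and compactness makes it global. A single [d] serves as width and as missing mass. *)
Lemma not_concentrated_slab : not_concentrated mu ->
  exists2 d, 0 < d & forall v, S v -> m (slab v d) <= m S - d.
Proof.
move=> nc; have mS := @measurable_sphere R n.
pose P (k : nat) v := m (slab v k.+1%:R^-1) <= m S - k.+1%:R^-1.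
suff [k hk] : exists k, forall v, S v -> P k v.
  by exists k.+1%:R^-1 => //; rewrite invr_gt0.
apply: near_covering_nat (@compact_sphere R n) _ => v Sv.
have [k0 mk0] : exists k, m (slab v k.+1%:R^-1) < m S.
  apply: contrapT => /forallNP h.
  have h0 k : mu (S `\` slab v k.+1%:R^-1) = 0%E.
    have mk : mu (slab v k.+1%:R^-1) = mu S.
      have := h k => /negP; rewrite -leNgt => hk.
      apply/eqP; rewrite eq_le; apply/andP; split.
        by apply: le_measure; rewrite ?inE//; [exact: measurable_slab|move=> u []].
      rewrite -(fineK (mass_fin mS)) -(fineK (mass_fin (measurable_slab v _))).
      by rewrite lee_fin.
    by apply: measure_setD_eq0 => //; [exact: measurable_slab|move=> u []].
  suff : mu (S `\` great_subsphere v) = 0%E by move=> e; have := nc v Sv; rewrite e ltxx.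
  have -> : S `\` great_subsphere v = \bigcup_k (S `\` slab v k.+1%:R^-1).
    apply/seteqP; split => [u [Su gu]|u [k _ [Su uk]]].
      have vu : 0 < `|dotv v u| by rewrite normr_gt0; apply/eqP => e; apply: gu.
      pose k := Num.truncn `|dotv v u|^-1; exists k => //; split => // -[_].
      apply/negP; rewrite -leNgt invf_ple ?posrE// ltW//.
      by have /andP[] := truncn_itv (ltW (etrans (invr_gt0 _) vu)).
    by split => // -[_ e]; apply: uk; split => //; rewrite e normr0 invr_gt0.
  have mD k : measurable ((S `\` slab v k.+1%:R^-1) : set T).
    by apply: measurableD => //; exact: measurable_slab.
  apply: (@measure_negligible _ _ _ mu); first exact: bigcupT_measurable.
  by apply: negligible_bigcup => k; exists (S `\` slab v k.+1%:R^-1); split => //.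
pose e : R := k0.+1%:R^-1 / (2 * n%:R).
have nR : 0 < n%:R :> R by rewrite ltr0n.
exists e; first by rewrite divr_gt0 ?invr_gt0 ?mulr_gt0.
pose c := m S - m (slab v k0.+1%:R^-1).
have c0 : 0 < c by rewrite subr_gt0.
(* The first bound halves the width, as [slab_sub] demands; the second makes [1/(k+1)] at most the
   missing mass [c]. *)
exists (maxn (2 * k0.+1) (Num.truncn c^-1)) => v' k vv' kk; rewrite /P.
have k1 : k.+1%:R^-1 <= k0.+1%:R^-1 / 2 :> R.
  rewrite -invfM lef_pV2 ?posrE ?mulr_gt0// -natrM ler_nat mulnC.
  exact: leq_trans (leq_trans (leq_maxl _ _) kk) (leqnSn k).
have k2 : k.+1%:R^-1 <= c.
  rewrite invf_ple ?posrE//; apply: ltW.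
  have /andP[_ h] := truncn_itv (ltW (etrans (invr_gt0 _) c0)).
  apply: lt_le_trans h _; rewrite ler_nat ltnS.
  exact: leq_trans (leq_maxr _ _) kk.
apply: (@le_trans _ _ (m (slab v k0.+1%:R^-1))).
  apply: fine_le; rewrite ?mass_fin//; try exact: measurable_slab.
  apply: le_measure; rewrite ?inE; try exact: measurable_slab.
  apply: subset_trans (slab_sub vv') => u [Su h]; split => //; exact: lt_le_trans h _.
by rewrite lerBrDr addrC -lerBrDr; exact: le_trans k2 _.
Qed.

(** Continuity of the finite measure [mu] from above along slabs shrinking to a great subsphere,
    made uniform in the axis as in [not_concentrated_slab]. *)
Lemma vanishing_slab (eps : R) : vanishes_on_great_subspheres mu -> 0 < eps ->
  exists2 d, 0 < d & forall v, S v -> m (slab v d) <= eps.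
Proof.
move=> va e0; have mS := @measurable_sphere R n.
suff [k hk] : exists k, forall v, S v -> m (slab v k.+1%:R^-1) <= eps.
  by exists k.+1%:R^-1 => //; rewrite invr_gt0.
apply: near_covering_nat (@compact_sphere R n) _ => v Sv.
have [k0 mk0] : exists k, m (slab v k.+1%:R^-1) < eps.
  have cv : (fun k => mu (slab v k.+1%:R^-1)) @ \oo --> mu (great_subsphere v).
    have -> : great_subsphere v = \bigcap_k slab v k.+1%:R^-1.
      apply/seteqP; split => [u [Su e] k _|u h].
        by split => //; rewrite e normr0 invr_gt0.
      have [Su _] := h 0%N Logic.I; split => //; apply: contrapT => /eqP vu0.
      have vu : 0 < `|dotv v u| by rewrite normr_gt0.
      have [_] := h (Num.truncn `|dotv v u|^-1) Logic.I; apply/negP.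
      rewrite -leNgt invf_ple ?posrE// ltW//.
      by have /andP[] := truncn_itv (ltW (etrans (invr_gt0 _) vu)).
    apply: nonincreasing_cvg_mu.
    - by apply: finite_measureS => //; exact: measurable_slab.
    - by move=> k; exact: measurable_slab.
    - by apply: bigcapT_measurable => k; exact: measurable_slab.
    - apply/nonincreasing_seqP => k; apply/subsetPset => u [Su uk]; split => //.
      by apply: lt_le_trans uk _; rewrite lef_pV2 ?posrE// ler_nat.
  rewrite va// in cv; have /fine_cvg/cvgr_lt/(_ _ e0)[k _ hk] : (fun k => mu (slab v k.+1%:R^-1)) @ \oo --> (0 : R)%:E := cv.
  by exists k; exact: (hk k (leqnn k)).
have nR : 0 < n%:R :> R by rewrite ltr0n.
exists (k0.+1%:R^-1 / (2 * n%:R)); first by rewrite divr_gt0 ?invr_gt0 ?mulr_gt0.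
exists (2 * k0.+1)%N => v' k vv' kk.
have k1 : k.+1%:R^-1 <= k0.+1%:R^-1 / 2 :> R.
  rewrite -invfM lef_pV2 ?posrE ?mulr_gt0// -natrM ler_nat mulnC.
  exact: leq_trans kk (leqnSn k).
apply: le_trans (ltW mk0).
apply: fine_le; rewrite ?mass_fin//; try exact: measurable_slab.
apply: le_measure; rewrite ?inE; try exact: measurable_slab.
by apply: subset_trans (slab_sub vv') => u [Su h]; split => //; exact: lt_le_trans h _.
Qed.

(** Comparison with the step function [al - be * \1_B]. In the applications [B] is a slab, on which
    only a weak lower bound is known. *)
Lemma Rint_ge_indic f (B : set 'rV[R]_n) (al be M : R) :
  measurable (B : set T) -> B `<=` S ->
  measurable_fun (S : set T) (f : T -> R) -> (forall u, S u -> `|f u| <= M) ->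
  (forall u, S u -> ~ B u -> al <= f u) -> (forall u, B u -> al - be <= f u) ->
  al * m S - be * m B <= I f.
Proof.
move=> mB BS mf fM h1 h2; have mS := @measurable_sphere R n.
pose g : 'rV[R]_n -> R := fun u => al - be * \1_B u.
have mg : measurable_fun (S : set T) (g : T -> R).
  apply: measurable_funB; first exact: measurable_cst.
  by apply: measurable_funM; [exact: measurable_cst|exact: measurable_indic].
have gb u : S u -> `|g u| <= `|al| + `|be|.
  move=> _; apply: le_trans (ler_normB _ _) _; rewrite lerD2l normrM indicE.
  by case: (u \in B); rewrite ?normr1 ?mulr1// normr0 mulr0.
apply: (@le_trans _ _ (I g)).
  rewrite /g (@RintB _ _ _ mu_fin _ mS (cst al) (fun u => be * \1_B u) (`|al| + `|be|)); last first.
  - by move=> u _; rewrite normrM indicE; case: (u \in B); rewrite ?normr1 ?mulr1 ?lerDr// normr0 mulr0 addr_ge0.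
  - by move=> u _; rewrite /= lerDl.
  - by apply: measurable_funM; [exact: measurable_cst|exact: measurable_indic].
  - exact: measurable_cst.
  rewrite Rintegral_cst// (@RintZ _ _ _ mu_fin _ mS be (\1_B) 1)//; last first.
    by move=> u _; rewrite indicE; case: (u \in B); rewrite ?normr1// normr0.
  rewrite lerB// le_eqVlt; apply/orP; left; apply/eqP; congr (_ * _).
  by rewrite /Rintegral integral_indic// (setIidl BS).
apply: (Rint_le mu_fin mS mg mf (M := `|al| + `|be| + `|M|)) => u Su.
- by apply: le_trans (gb u Su) _; rewrite lerDl.
- by apply: le_trans (fM u Su) _; rewrite (le_trans (ler_norm _))// lerDr addr_ge0.
rewrite /g indicE; case: (boolP (u \in B)) => [/set_mem Bu|]; first by rewrite mulr1; exact: h2.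
by rewrite mulr0 subr0 => /negP nB; apply: h1 => // Bu; apply: nB; rewrite inE.
Qed.

End OneMeasure.

End Coercivity.

Section Monotone.
Variables (R : realType) (n : nat).
Implicit Types (u v x y xi : 'rV[R]_n) (G : 'rV[R]_n -> R -> R).
Local Notation S := (@sphere R n).

Lemma dt_gt0_lt G u (s t : R) : class_C G -> (forall v r, S v -> 0 < r -> 0 < dt G v r) ->
  S u -> 0 < s -> s < t -> G u s < G u t.
Proof.
move=> cG dG Su s0 st; have t0 := lt_trans s0 st.
have [c [_ /andP[c1 _]] e] := class_C_MVT cG Su s0 t0.
rewrite -subr_lt0 e pmulr_rlt0 ?subr_lt0// dG// (lt_le_trans _ c1)//.
by rewrite lt_min s0.
Qed.

Lemma dt_lt0_lt G u (s t : R) : class_C G -> (forall v r, S v -> 0 < r -> dt G v r < 0) ->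
  S u -> 0 < s -> s < t -> G u t < G u s.
Proof.
move=> cG dG Su s0 st; have t0 := lt_trans s0 st.
have [c [_ /andP[c1 _]] e] := class_C_MVT cG Su s0 t0.
rewrite -subr_gt0 e nmulr_rgt0 ?subr_lt0// dG// (lt_le_trans _ c1)//.
by rewrite lt_min s0.
Qed.

Lemma dini_infty (Phi : 'rV[R]_n -> R -> R) (L : R) :
  (forall s, 0 < s -> {within S, continuous (Phi ^~ s)}) ->
  (forall u s t, S u -> 0 < s -> s <= t -> Phi u s <= Phi u t) ->
  (forall u, S u -> forall M, exists2 s, 0 < s & M <= Phi u s) ->
  exists2 s0, 0 < s0 & forall u s, S u -> s0 <= s -> L <= Phi u s.
Proof.
move=> cP mP iP.
(* The second [S u] belongs to the covering property, since balls around points of the sphere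
   contain points off it. *)
suff [k hk] : exists k, forall u, S u -> S u -> forall s, k.+1%:R <= s -> L <= Phi u s.
  by exists k.+1%:R => // u s Su; exact: hk.
apply: near_covering_nat (@compact_sphere R n) _ => u Su.
(* The extra 1 leaves room for the variation of [Phi ^~ s1] near [u]; monotonicity then passes from
   [s1] to all larger [s]. *)
have [s1 s10 Ls1] := iP u Su (L + 1).
have /subspace_continuousP/(_ u Su) := cP _ s10.
move=> /cvgrPdist_lt/(_ _ ltr01); rewrite near_withinE => /nbhs_ballP[e e0 he].
exists e => //; exists (Num.truncn s1) => y k uy ks Sy s ss.
have h : Phi u s1 - Phi y s1 < 1 by exact: le_lt_trans (ler_norm _) (he y uy Sy).
apply: (@le_trans _ _ (Phi y s1)); first by move: h Ls1; lra.
apply: mP => //; apply: le_trans ss; apply: ltW.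
have /andP[_ h1] := truncn_itv (ltW s10).
by apply: lt_le_trans h1 _; rewrite ler_nat.
Qed.

End Monotone.

Section CoerciveSteps.
Variables (R : realType) (n : nat).
Implicit Types (u v x y xi : 'rV[R]_n).
Local Notation S := (@sphere R n).
Local Notation T := (borelRn R n).
Hypothesis n0 : (0 < n)%N.
Variable mu : {measure set T -> \bar R}.
Hypothesis smu : sphere_measure mu.
Local Notation I f := (Rintegral mu S f).
Local Notation m A := (fine (mu A)).

Let mS0 : 0 < m S := mass_sphere_gt0 smu.

(** Here [f] is an energy integrand and [tau] stands for [1/h] or [1/p] in direction [v]. A large
    [tau] makes [f] huge outside the slab around the great subsphere of [v], a region whose mass is
    bounded below, while [-C] limits the loss on the slab. *)
Lemma coercive_infty (Phi : 'rV[R]_n -> R -> R) (C c : R) :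
  not_concentrated mu ->
  (forall L, exists2 s0, 0 < s0 & forall u s, S u -> s0 <= s -> L <= Phi u s) ->
  exists2 t0, 0 < t0 & forall (f : 'rV[R]_n -> R) v tau M,
    measurable_fun (S : set T) (f : T -> R) -> (forall u, S u -> `|f u| <= M) ->
    S v -> (forall u, S u -> - C <= f u) ->
    (forall u s, S u -> 0 < s -> s <= tau * `|dotv v u| -> Phi u s <= f u) ->
    I f <= c -> tau <= t0.
Proof.
move=> nc dini.
have [d d0 hd] := not_concentrated_slab n0 smu nc.
pose C' := Num.max C 0.
(* Chosen so that a gain [L] on mass [d], against a loss of at most [C'] on the rest, exceeds
   [c]. *)
pose L := (`|c| + C' * m S + 1) / d.
have C'0 : 0 <= C' by rewrite le_max lexx orbT.
have [s0 s00 hs] := dini L.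
exists (s0 / d); first by rewrite divr_gt0.
move=> f v tau M mf fM Sv fC fPhi If; rewrite leNgt; apply/negP => st.
have L0 : 0 < L by rewrite divr_gt0// ltr_wpDl// addr_ge0// mulr_ge0// ltW.
have Ld : L * d = `|c| + C' * m S + 1 by rewrite mulrVK// unitfE gt_eqF.
have tau0 : 0 < tau by apply: lt_trans st; rewrite divr_gt0.
have h1 u : S u -> ~ slab v d u -> L <= f u.
  move=> Su nu; have du : d <= `|dotv v u|.
    by rewrite leNgt; apply/negP => ud; apply: nu.
  apply: le_trans (hs u s0 Su (lexx _)) _; apply: fPhi => //.
  rewrite ltr_pdivrMr// in st; apply: le_trans (ltW st) _.
  by rewrite ler_pM2l.
have h2 u : slab v d u -> L - (L + C') <= f u.
  move=> [Su _]; rewrite opprD addNKr; apply: le_trans (fC u Su).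
  by rewrite lerN2 le_max lexx.
have := @Rint_ge_indic _ _ _ smu f (slab v d) L (L + C') M (measurable_slab _ _)
  (fun u h => h.1) mf fM h1 h2.
have := hd v Sv; have := If; have := ler_norm c; nra.
Qed.

(** Without divergence of [Psi], the integrand is compared with its value at the unit ball: for
    large [tau] it exceeds [Psi u 2] off a slab, a uniform gain over [Psi u 1], and the slab has
    mass too small to compensate. *)
Lemma coercive_vanish (Psi : 'rV[R]_n -> R -> R) (r : R) :
  vanishes_on_great_subspheres mu -> class_C Psi ->
  (forall v s, S v -> 0 < s -> 0 < dt Psi v s) -> 0 < r ->
  exists2 t0, 0 < t0 & forall (f : 'rV[R]_n -> R) v tau M,
    measurable_fun (S : set T) (f : T -> R) -> (forall u, S u -> `|f u| <= M) ->
    S v -> (forall u, S u -> Psi u r <= f u) ->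
    (forall u s, S u -> 0 < s -> s <= tau * `|dotv v u| -> Psi u s <= f u) ->
    I f <= I (Psi ^~ 1) -> tau <= t0.
Proof.
move=> va cP dP r0; have mS := @measurable_sphere R n.
have cPs s : 0 < s -> {within S, continuous (Psi ^~ s)}.
  by move=> s0; apply: (@continuousC_comp _ _ _ (cst s) cP.2.1) => // u; exact: cst_continuous.
have [ka ka0 hka] : exists2 ka, 0 < ka & forall u, S u -> ka <= Psi u 2 - Psi u 1.
  apply: continuous_sphere_lbound => [|u Su]; last by rewrite subr_gt0 dt_gt0_lt// ltr1n.
  by move=> u; apply: cvgB; apply: cPs.
have [M1 M10 hM1] := continuous_sphere_bounded (cPs _ (@ltr01 R)).
have [Mr Mr0 hMr] := continuous_sphere_bounded (cPs _ r0).
(* On the slab only [-(M1 + Mr) = ka - be] bounds the difference from below; [eps] then limits the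
   loss to half of the gain [ka * m S]. *)
pose be := ka + (M1 + Mr).
have be0 : 0 < be by rewrite ltr_wpDr// addr_ge0.
pose eps := ka * m S / (2 * be).
have eps0 : 0 < eps by rewrite divr_gt0// mulr_gt0.
have [d d0 hd] := vanishing_slab n0 smu va eps0.
exists (2 / d); first by rewrite divr_gt0.
move=> f v tau M mf fM Sv fr fPsi If; rewrite leNgt; apply/negP => st.
have tau0 : 0 < tau by apply: lt_trans st; rewrite divr_gt0.
have mP1 : measurable_fun (S : set T) (Psi ^~ 1 : T -> R) by apply: sphere_continuous_borel => //; exact: cPs.
pose g u := f u - Psi u 1.
have mg : measurable_fun (S : set T) (g : T -> R) by exact: measurable_funB.
have gM u : S u -> `|g u| <= M + M1.
  by move=> Su; apply: le_trans (ler_normB _ _) _; rewrite lerD ?fM ?hM1.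
have Ig : I g = I f - I (Psi ^~ 1).
  apply: (@RintB _ _ _ smu.2.1 _ mS _ _ (`|M| + M1)) => // u Su.
    by apply: le_trans (fM u Su) _; rewrite (le_trans (ler_norm _))// lerDl.
  by apply: le_trans (hM1 u Su) _; rewrite lerDr.
have h1 u : S u -> ~ slab v d u -> ka <= g u.
  move=> Su nu; have du : d <= `|dotv v u|.
    by rewrite leNgt; apply/negP => ud; apply: nu.
  apply: le_trans (hka u Su) _; rewrite lerB//; apply: fPsi => //.
  rewrite ltr_pdivrMr// in st; apply: le_trans (ltW st) _.
  by rewrite ler_pM2l.
have h2 u : slab v d u -> ka - be <= g u.
  move=> [Su _]; have := hM1 u Su; have := hMr u Su; have := fr u Su.
  by rewrite !ler_norml /g /be => ? /andP[? ?] /andP[? ?]; lra.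
have := @Rint_ge_indic _ _ _ smu g (slab v d) ka be (M + M1) (measurable_slab _ _)
  (fun u h => h.1) mg gM h1 h2.
have bd : be * m (slab v d) <= ka * m S / 2.
  have -> : ka * m S / 2 = be * eps by rewrite /eps; field; rewrite gt_eqF.
  by rewrite ler_pM2l// hd.
have kS : 0 < ka * m S by rewrite mulr_gt0.
by move: If bd kS; rewrite Ig; lra.
Qed.

End CoerciveSteps.

(** * Polarity of positive even functions on the sphere *)

Section GoodFunctions.
Variables (R : realType) (n : nat).
Implicit Types (u v x y xi : 'rV[R]_n) (p q : 'rV[R]_n -> R).
Local Notation S := (@sphere R n).
Local Notation T := (borelRn R n).
Hypothesis n0 : (0 < n)%N.

Definition good p := [/\ {within S, continuous p}, (forall u, S u -> 0 < p u) & even_on_sphere p].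

(** The same operation leads from a gauge to the support function and from a support function back
    to the gauge, so [polar (polar p) = p] on the sphere says that [p] is the gauge of a convex
    body. *)
Definition polar p : 'rV[R]_n -> R := pol S (fun x => (p x)^-1).

Lemma good_bounds p : good p ->
  exists a b, [/\ 0 < a, 0 < b & forall u, S u -> a <= p u <= b].
Proof.
move=> [cp p0 _]; have [a a0 ha] := continuous_sphere_lbound cp p0.
have [b b0 hb] := continuous_sphere_bounded cp.
exists a, (b + 1); split => // [|u Su]; first by rewrite ltr_wpDl.
by rewrite ha//= (le_trans (ler_norm _))// (le_trans (hb u Su))// lerDl.
Qed.

Lemma good_inv p : good p -> good (fun x => (p x)^-1).
Proof.
move=> gp; have [a [b [a0 _ pab]]] := good_bounds gp; have [cp p0 ep] := gp.
split => [|u Su|u Su]; last by rewrite ep.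
  by apply: (sphere_within_inv a0) => // u /pab/andP[].
by rewrite invr_gt0 p0.
Qed.

Lemma good_pol p : good p -> good (pol S p).
Proof.
move=> gp; have [a [b [a0 _ pab]]] := good_bounds gp; have [cp p0 ep] := gp.
split => [|u Su|u Su].
- apply: continuous_subspaceT => x.
  apply: (continuous_pol (@subset_refl _ S) (sphere_nonempty R n0) (W := b)) => u /pab/andP[au ->].
  by rewrite (le_trans _ au)// ltW.
- have /andP[+ _] := polS_bounds n0 a0 pab Su; exact: lt_le_trans.
- exact: (polN n0 a0 pab).
Qed.

Lemma good_polar p : good p -> good (polar p).
Proof. by move=> /good_inv/good_pol. Qed.

Lemma good_pol_ub p x u : good p -> S u -> dotv x u * p u <= pol S p x.
Proof. by move=> gp; have [a [b [a0 _ pab]]] := good_bounds gp; exact: (polS_ub n0 a0 pab). Qed.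

Lemma good_pol_le p x M : good p -> (forall u, S u -> dotv x u * p u <= M) -> pol S p x <= M.
Proof. by move=> gp; have [a [b [a0 _ pab]]] := good_bounds gp; exact: (polS_le n0 a0 pab). Qed.

(** The body contains both points [x / p x] and [- x / p x], by evenness. This inequality converts a
    small [h] or a small [p] into largeness of an energy integrand. *)
Lemma polar_mul_ge p x u : good p -> S x -> S u -> `|dotv u x| <= p x * polar p u.
Proof.
move=> gp Sx Su; have [_ p0 ep] := gp.
have h y : S y -> p y = p x -> dotv u y <= p x * polar p u.
  move=> Sy <-; rewrite mulrC -ler_pdivrMr ?p0//; exact: good_pol_ub (good_inv gp) Sy.
rewrite ler_norml lerNl; apply/andP; split; last exact: h.
by rewrite -dotvNr h ?ep//; exact: sphereN.
Qed.

Lemma eq_pol p q x : (forall u, S u -> p u = q u) -> pol S p x = pol S q x.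
Proof.
move=> pq; rewrite /pol; congr sup; apply/seteqP.
by split => _ [u Su <-]; exists u => //; rewrite pq.
Qed.

Lemma eq_polar p q x : (forall u, S u -> p u = q u) -> polar p x = polar q x.
Proof. by move=> pq; apply: eq_pol => u Su; rewrite pq. Qed.

Lemma polar_one u : S u -> polar (cst 1) u = 1.
Proof.
move=> Su; have := @polar_bounds _ _ (cst 1) 1 1 n0 ltr01 ltr01 (fun _ _ => introT andP (conj (lexx _) (lexx _))) u Su.
move=> /andP[h1 h2]; apply/eqP; rewrite eq_le; apply/andP; split.
  by apply: le_trans h2 _; rewrite invr1.
by apply: le_trans _ h1; rewrite invr1.
Qed.

Lemma polar_bipolar_le p x : good p -> S x -> polar (polar p) x <= p x.
Proof.
by move=> gp; have [a [b [a0 b0 pab]]] := good_bounds gp; exact: (bipolar_le n0 a0 b0 pab).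
Qed.

Lemma polar_tripolar p u : good p -> S u -> polar (polar (polar p)) u = polar p u.
Proof.
by move=> gp; have [a [b [a0 b0 pab]]] := good_bounds gp; exact: (tripolar n0 a0 b0 pab).
Qed.

Lemma good_int (H : 'rV[R]_n -> R -> R) q : continuousC H -> good q ->
  measurable_fun (S : set T) ((fun u => H u (q u)) : T -> R) /\
  exists M, forall u, S u -> `|H u (q u)| <= M.
Proof.
move=> cH [cq q0 _]; have cHq := continuousC_comp cH q0 cq.
split; first by apply: sphere_continuous_borel => //; exact: measurable_sphere.
by have [M _ hM] := continuous_sphere_bounded cHq; exists M.
Qed.

End GoodFunctions.

(** * Coercivity under the three sets of hypotheses *)

Section Energy.
Variables (R : realType) (n : nat).
Implicit Types (u v x y xi : 'rV[R]_n) (p q : 'rV[R]_n -> R).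
Local Notation S := (@sphere R n).
Local Notation T := (borelRn R n).
Variables (lam mu : {measure set T -> \bar R}) (G Psi : 'rV[R]_n -> R -> R).

Definition energyG p : R := Rintegral lam S (fun x => G x (p x)^-1).
Definition energyPsi p : R := Rintegral mu S (fun u => Psi u (polar p u)).

(** The sublevels are those of the unit ball, [cst 1]. The bounds must hold for every good [p], not
    only for gauges, with [polar p] as its support function. *)
Definition coercive := exists2 a, 0 < a & forall p, good p ->
  energyG p <= energyG (cst 1) -> energyPsi p <= energyPsi (cst 1) ->
  forall u, S u -> a <= p u /\ a <= polar p u.

Hypotheses (n0 : (0 < n)%N) (slam : sphere_measure lam) (smu : sphere_measure mu)
  (cG : class_C G) (cPsi : class_C Psi)
  (dG : forall v r, S v -> 0 < r -> dt G v r < 0)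
  (dPsi : forall v r, S v -> 0 < r -> 0 < dt Psi v r).

Lemma G_nonincr u s t : S u -> 0 < s -> s <= t -> G u t <= G u s.
Proof. by move=> Su s0; rewrite le_eqVlt => /predU1P[->//|st]; exact/ltW/(dt_lt0_lt cG). Qed.

Lemma Psi_nondecr u s t : S u -> 0 < s -> s <= t -> Psi u s <= Psi u t.
Proof. by move=> Su s0; rewrite le_eqVlt => /predU1P[->//|st]; exact/ltW/(dt_gt0_lt cPsi). Qed.

(** If [h u] is small the body is thin: [1 / p x <= h u / |u . x|] is small off a slab, where [G] is
    then large. *)
Lemma energyG_coercive (C c : R) : not_concentrated lam ->
  (forall u, S u -> forall M, exists2 s, 0 < s & M <= G u s) ->
  exists2 a, 0 < a & forall p, good p -> (forall u, S u -> - C <= G u (p u)^-1) ->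
    energyG p <= c -> forall u, S u -> a <= polar p u.
Proof.
move=> nc iG.
have dini L : exists2 s0, 0 < s0 & forall u s, S u -> s0 <= s -> L <= G u s^-1.
  apply: (@dini_infty _ _ (fun u s => G u s^-1)).
  - move=> s s0; have s1 : 0 < s^-1 by rewrite invr_gt0.
    by apply: (@continuousC_comp _ _ _ (cst s^-1) cG.2.1) => // u; exact: cst_continuous.
  - move=> u s t Su s0 st; apply: G_nonincr => //; first by rewrite invr_gt0 (lt_le_trans s0).
    by rewrite lef_pV2 ?posrE// (lt_le_trans s0).
  - move=> u Su M; have [s s0 h] := iG u Su M.
    by exists s^-1; rewrite ?invr_gt0// invrK.
have [t0 t00 ht0] := coercive_infty n0 slam C c nc dini.
exists t0^-1; first by rewrite invr_gt0.
move=> p gp GC Ep u Su; have [_ h0 _] := good_polar n0 gp; have [_ p0 _] := gp.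
have [mf [M fM]] := good_int cG.2.1 (good_inv gp).
rewrite invf_ple ?posrE ?h0//.
apply: (ht0 _ u _ M mf fM Su GC _ Ep) => x s Sx s0 sx.
apply: G_nonincr => //; first by rewrite invr_gt0 p0.
rewrite lef_pV2 ?posrE ?p0//; apply: le_trans sx _.
by rewrite mulrC ler_pdivrMr ?h0// polar_mul_ge.
Qed.

(** If [p v] is small the body contains a long segment along [v], so [h u >= |v . u| / p v] is large
    off a slab, where [Psi] is then large. *)
Lemma energyPsi_coercive (C c : R) : not_concentrated mu ->
  (forall u, S u -> forall M, exists2 s, 0 < s & M <= Psi u s) ->
  exists2 a, 0 < a & forall p, good p -> (forall u, S u -> - C <= Psi u (polar p u)) ->
    energyPsi p <= c -> forall u, S u -> a <= p u.
Proof.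
move=> nc iP.
have dini L : exists2 s0, 0 < s0 & forall u s, S u -> s0 <= s -> L <= Psi u s.
  apply: (@dini_infty _ _ Psi) => // [s s0|]; last exact: Psi_nondecr.
  by apply: (@continuousC_comp _ _ _ (cst s) cPsi.2.1) => // u; exact: cst_continuous.
have [t0 t00 ht0] := coercive_infty n0 smu C c nc dini.
exists t0^-1; first by rewrite invr_gt0.
move=> p gp PC Fp v Sv; have [_ h0 _] := good_polar n0 gp; have [_ p0 _] := gp.
have [mf [M fM]] := good_int cPsi.2.1 (good_polar n0 gp).
rewrite invf_ple ?posrE ?p0//.
apply: (ht0 _ v _ M mf fM Sv PC _ Fp) => u s Su s0 su.
apply: Psi_nondecr => //; apply: le_trans su _.
by rewrite mulrC ler_pdivrMr ?p0// mulrC dotvC polar_mul_ge.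
Qed.

Lemma energyPsi_coercive_vanish (r : R) : vanishes_on_great_subspheres mu -> 0 < r ->
  exists2 a, 0 < a & forall p, good p -> (forall u, S u -> r <= polar p u) ->
    energyPsi p <= energyPsi (cst 1) -> forall u, S u -> a <= p u.
Proof.
move=> va r0; have [t0 t00 ht0] := coercive_vanish n0 smu va cPsi dPsi r0.
exists t0^-1; first by rewrite invr_gt0.
move=> p gp rp Fp v Sv; have [_ h0 _] := good_polar n0 gp; have [_ p0 _] := gp.
have [mf [M fM]] := good_int cPsi.2.1 (good_polar n0 gp).
rewrite invf_ple ?posrE ?p0//.
apply: (ht0 _ v _ M mf fM Sv) => [u Su|u s Su s0 su|].
- by apply: Psi_nondecr => //; exact: rp.
- apply: Psi_nondecr => //; apply: le_trans su _.
  by rewrite mulrC ler_pdivrMr ?p0// mulrC dotvC polar_mul_ge.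
- apply: le_trans Fp _; rewrite le_eqVlt; apply/orP; left; apply/eqP.
  by apply: eq_Rintegral => u /set_mem Su; rewrite polar_one.
Qed.

(** Positivity of [G] allows [C = 0] and bounds [h] below first; then [Psi u (h u) >= Psi u a1]
    supplies the lower bound that the estimate for [p] requires. *)
Lemma coercive_infty_pos : not_concentrated lam -> not_concentrated mu ->
  (forall u t, S u -> 0 < t -> 0 < G u t) ->
  (forall u, S u -> forall M, exists2 s, 0 < s & M <= G u s) ->
  (forall u, S u -> forall M, exists2 s, 0 < s & M <= Psi u s) -> coercive.
Proof.
move=> ncl ncm G0 iG iP.
have [a1 a10 h1] := energyG_coercive 0 (energyG (cst 1)) ncl iG.
have [M _ hM] := @continuousC_bounded _ _ _ a1 a1 cPsi.2.1 a10.
have [a2 a20 h2] := energyPsi_coercive M (energyPsi (cst 1)) ncm iP.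
exists (Num.min a1 a2); first by rewrite lt_min a10.
move=> p gp Ep Fp u Su; have [_ p0 _] := gp.
have ha v : S v -> a1 <= polar p v.
  by apply: h1 => // x Sx; rewrite oppr0 ltW// G0// invr_gt0 p0.
split; last by rewrite (le_trans _ (ha u Su))// ge_min lexx.
rewrite (le_trans _ (h2 p gp _ Fp u Su)) ?ge_min ?lexx ?orbT// => v Sv.
apply: (@le_trans _ _ (Psi v a1)); last by apply: Psi_nondecr => //; exact: ha.
by have := hM v a1 Sv; rewrite !lexx => /(_ isT); rewrite ler_norml => /andP[].
Qed.

(** The mirror order: positivity of [Psi] bounds [p] below first, which bounds [G] at [1/p] from
    below and yields the estimate for [h]. *)
Lemma coercive_pos_infty : not_concentrated lam -> not_concentrated mu ->
  (forall u t, S u -> 0 < t -> 0 < Psi u t) ->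
  (forall u, S u -> forall M, exists2 s, 0 < s & M <= G u s) ->
  (forall u, S u -> forall M, exists2 s, 0 < s & M <= Psi u s) -> coercive.
Proof.
move=> ncl ncm P0 iG iP.
have [a2 a20 h2] := energyPsi_coercive 0 (energyPsi (cst 1)) ncm iP.
have a2V : 0 < a2^-1 by rewrite invr_gt0.
have [M _ hM] := @continuousC_bounded _ _ _ a2^-1 a2^-1 cG.2.1 a2V.
have [a1 a10 h1] := energyG_coercive M (energyG (cst 1)) ncl iG.
exists (Num.min a1 a2); first by rewrite lt_min a10.
move=> p gp Ep Fp u Su; have [_ p0 _] := gp; have [_ h0 _] := good_polar n0 gp.
have ha v : S v -> a2 <= p v.
  by apply: h2 => // x Sx; rewrite oppr0 ltW// P0// h0.
split; first by rewrite (le_trans _ (ha u Su))// ge_min lexx orbT.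
rewrite (le_trans _ (h1 p gp _ Ep u Su)) ?ge_min ?lexx// => v Sv.
apply: (@le_trans _ _ (G v a2^-1)).
  by have := hM v a2^-1 Sv; rewrite !lexx => /(_ isT); rewrite ler_norml => /andP[].
apply: G_nonincr => //; first by rewrite invr_gt0 p0.
by rewrite lef_pV2 ?posrE ?p0// ha.
Qed.

Lemma coercive_vanishing : not_concentrated lam -> vanishes_on_great_subspheres mu ->
  (forall u t, S u -> 0 < t -> 0 < G u t) ->
  (forall u, S u -> forall M, exists2 s, 0 < s & M <= G u s) -> coercive.
Proof.
move=> ncl va G0 iG.
have [a1 a10 h1] := energyG_coercive 0 (energyG (cst 1)) ncl iG.
have [a2 a20 h2] := energyPsi_coercive_vanish va a10.
exists (Num.min a1 a2); first by rewrite lt_min a10.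
move=> p gp Ep Fp u Su; have [_ p0 _] := gp.
have ha v : S v -> a1 <= polar p v.
  by apply: h1 => // x Sx; rewrite oppr0 ltW// G0// invr_gt0 p0.
split; last by rewrite (le_trans _ (ha u Su))// ge_min lexx.
by rewrite (le_trans _ (h2 p gp ha Fp u Su)) ?ge_min ?lexx ?orbT.
Qed.

End Energy.

(** * Pareto optimal gauges *)

Section Minimizer.
Variables (R : realType) (n : nat).
Implicit Types (u v x y xi : 'rV[R]_n) (p q : 'rV[R]_n -> R).
Local Notation S := (@sphere R n).
Local Notation T := (borelRn R n).

Lemma energy_lipschitz (nu : {measure set T -> \bar R}) (H : 'rV[R]_n -> R -> R) (a b : R) :
  sphere_measure nu -> class_C H -> 0 < a ->
  exists2 M, 0 <= M & forall q1 q2 e, good q1 -> good q2 ->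
    (forall u, S u -> a <= q1 u <= b) -> (forall u, S u -> a <= q2 u <= b) ->
    (forall u, S u -> `|q1 u - q2 u| <= e) ->
    `|Rintegral nu S (fun u => H u (q1 u)) - Rintegral nu S (fun u => H u (q2 u))| <= M * e.
Proof.
move=> snu cH a0; have mS := @measurable_sphere R n.
have [M M0 hM] := continuousC_bounded b cH.2.2 a0.
exists (M * fine (nu S)); first by rewrite mulr_ge0// fine_ge0.
move=> q1 q2 e g1 g2 b1 b2 d12.
have [m1 [M1 h1]] := good_int cH.2.1 g1; have [m2 [M2 h2]] := good_int cH.2.1 g2.
rewrite mulrAC.
apply: (Rint_dist snu.2.1 mS m1 m2 (M := `|M1| + `|M2|)).
- by move=> u Su; rewrite (le_trans (h1 u Su))// (le_trans (ler_norm _))// lerDl.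
- by move=> u Su; rewrite (le_trans (h2 u Su))// (le_trans (ler_norm _))// lerDr.
move=> u Su; have [_ q1p _] := g1; have [_ q2p _] := g2.
have [c [_ /andP[c1 c2]] ->] := class_C_MVT cH Su (q1p u Su) (q2p u Su).
rewrite normrM ler_pM ?d12// hM//; have /andP[? ?] := b1 u Su; have /andP[? ?] := b2 u Su.
rewrite (le_trans _ c1) ?le_min; last exact/andP.
by rewrite (le_trans c2)// ge_max; exact/andP.
Qed.

Lemma polar_dist p q (a b e : R) x : (0 < n)%N -> 0 < a ->
  (forall u, S u -> a <= p u <= b) -> (forall u, S u -> a <= q u <= b) ->
  (forall u, S u -> `|p u - q u| <= e) -> S x -> `|polar p x - polar q x| <= e / a ^+ 2.
Proof.
move=> n0 a0; wlog : p q / polar q x <= polar p x.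
  move=> wl pab qab d Sx; have [?|] := boolP (polar q x <= polar p x); first exact: wl.
  rewrite -ltNge => /ltW h; rewrite distrC; apply: wl => // u Su; rewrite distrC; exact: d.
move=> le pab qab d Sx; rewrite ger0_norm ?subr_ge0// lerBlDr.
have b0 : 0 < b by have /andP[h1 h2] := pab x Sx; rewrite (lt_le_trans a0)// (le_trans h1).
have bV0 : 0 < b^-1 by rewrite invr_gt0.
have pV u : S u -> b^-1 <= (p u)^-1 <= a^-1 by move=> Su; exact: inv_bounds a0 (pab u Su).
have qV u : S u -> b^-1 <= (q u)^-1 <= a^-1 by move=> Su; exact: inv_bounds a0 (qab u Su).
apply: (polS_le n0 bV0 pV) => u Su.
apply: (@le_trans _ _ (dotv x u * (q u)^-1 + e / a ^+ 2)); last first.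
  by rewrite addrC lerD2l; exact: (polS_ub n0 bV0 qV).
rewrite -lerBlDl -mulrBr.
have /andP[pa _] := pab u Su; have /andP[qa _] := qab u Su.
have p0 : 0 < p u := lt_le_trans a0 pa; have q0 : 0 < q u := lt_le_trans a0 qa.
apply: le_trans (ler_norm _) _; rewrite normrM.
have -> : (p u)^-1 - (q u)^-1 = (q u - p u) / (p u * q u) by field; rewrite ?gt_eqF.
rewrite -[leRHS]mul1r ler_pM//.
  rewrite ler_norml dotv_sphere_le1// andbT lerNl -dotvNl dotv_sphere_le1//; exact: sphereN.
have pq0 : 0 < p u * q u by rewrite mulr_gt0.
rewrite normrM (gtr0_norm (_ : 0 < (p u * q u)^-1)) ?invr_gt0// distrC.
rewrite ler_pM ?d// ?invr_ge0 ?(ltW pq0)// lef_pV2 ?posrE ?exprn_gt0//.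
by rewrite expr2 ler_pM// ltW.
Qed.

Variables (a L : R).
Hypotheses (a0 : 0 < a) (a1 : a <= 1) (L0 : 0 <= L).

Local Notation PT := (prod_topology (fun _ : 'rV[R]_n => R)).

(** The bounds are imposed on all of R^n, so that Tychonoff's theorem applies in the product
    topology; the other conditions are closed and concern the sphere only. *)
Definition lipschitz_class : set PT :=
  [set p | [/\ forall x, a <= p x <= a^-1,
               forall x y, S x -> S y -> `|p x - p y| <= L * `|x - y| &
               even_on_sphere p]].

Lemma proj_cvg (p : PT) x : (fun q : PT => q x) @ nbhs p --> p x.
Proof. exact: (@proj_continuous _ (fun _ => R) x p). Qed.

Lemma compact_lipschitz_class : compact lipschitz_class.
Proof.
have cT := @tychonoff _ (fun _ : 'rV[R]_n => R) (fun _ => `[a, a^-1]%classic)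
  (fun _ => @segment_compact R a a^-1).
have e : lipschitz_class = [set p : PT | forall x, `[a, a^-1]%classic (p x)] `&`
    ([set p : PT | forall x y, S x -> S y -> `|p x - p y| <= L * `|x - y|] `&`
     [set p : PT | even_on_sphere p]).
  apply/seteqP; split => [p [h1 h2 h3]|p [h1 [h2 h3]]].
    by split => [x|]; [rewrite /= in_itv/=; exact: h1|split].
  by split => // x; have := h1 x; rewrite /= in_itv.
rewrite e; apply: compact_closedI => //; apply: closedI.
- rewrite (_ : [set p | _] = \bigcap_(xy in [set xy : 'rV[R]_n * 'rV[R]_n | S xy.1 /\ S xy.2])
    ((fun p : PT => `|p xy.1 - p xy.2|) @^-1` [set t | t <= L * `|xy.1 - xy.2|])).
    apply: closed_bigI => -[x y] [/= Sx Sy]; apply: preimage_closed; last exact: closed_le.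
    move=> p _; apply: (@cvg_norm _ _ _ (nbhs p)); apply: (@cvgB _ _ _ (nbhs p)); exact: proj_cvg.
  apply/seteqP; split => [p h [x y] [Sx Sy]|p h x y Sx Sy]; first exact: h.
  exact: (h (x, y) (conj Sx Sy)).
- rewrite (_ : [set p | _] = \bigcap_(x in S) ((fun p : PT => p (- x) - p x) @^-1` [set 0])).
    apply: closed_bigI => x Sx; apply: preimage_closed; last exact: closed_eq.
    by move=> p _; apply: (@cvgB _ _ _ (nbhs p)); exact: proj_cvg.
  apply/seteqP; split => [p h x Sx /=|p h x Sx]; first by rewrite h// subrr.
  by apply/eqP; rewrite -subr_eq0; apply/eqP; exact: (h x Sx).
Qed.

(** Pointwise convergence of uniformly Lipschitz functions is uniform on the compact sphere. *)
Lemma lipschitz_class_unif (p : PT) (e : R) : lipschitz_class p -> 0 < e ->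
  \forall q \near within lipschitz_class (nbhs p), forall x, S x -> `|q x - p x| <= e.
Proof.
move=> [_ pL _] e0.
have /compact_near_coveringP cS := @compact_sphere R n.
have FW : Filter (within lipschitz_class (nbhs p)) by exact: within_filter.
have := cS _ (within lipschitz_class (nbhs p)) (fun q x => S x -> `|q x - p x| <= e) FW.
move=> h; suff : \forall q \near within lipschitz_class (nbhs p), S `<=` (fun x => S x -> `|q x - p x| <= e).
  by apply: filterS => q hq x Sx; exact: hq.
apply: h => x Sx.
pose d := e / (3 * (L + 1)).
have L1 : 0 < L + 1 by rewrite ltr_wpDl.
have d0 : 0 < d by rewrite divr_gt0// mulr_gt0.
have e3 : 0 < e / 3 by rewrite divr_gt0.
have nb : nbhs p [set q : PT | `|p x - q x| < e / 3].
  exact: (@cvgr_dist_lt _ _ _ _ (nbhs_filter p) (fun q : PT => q x) (p x) (@proj_cvg p x) _ e3).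
exists (ball x d, [set q | lipschitz_class q /\ `|q x - p x| < e / 3]).
  split; first exact: nbhsx_ballx.
  change (nbhs p [set q | lipschitz_class q -> lipschitz_class q /\ `|q x - p x| < e / 3]).
  apply: (@filterS _ (nbhs p) _ _ _ _ nb) => q h1 h2; split => //.
  by rewrite distrC.
move=> [y q] [/= xy [[_ qL _] qx]] Sy.
have Ld : L * `|x - y| <= e / 3.
  apply: (@le_trans _ _ ((L + 1) * d)).
    apply: ler_pM => //; first by rewrite lerDl.
    by move: xy; rewrite -ball_normE /= => /ltW.
  by rewrite le_eqVlt; apply/orP; left; apply/eqP; rewrite /d; field; rewrite gt_eqF.
have -> : q y - p y = (q y - q x) + (q x - p x) + (p x - p y) by ring.
rewrite (_ : e = e / 3 + e / 3 + e / 3); last by field.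
apply: le_trans (ler_normD _ _) _; apply: lerD; last exact: le_trans (pL x y Sx Sy) Ld.
apply: le_trans (ler_normD _ _) _; apply: lerD; last exact: ltW.
by rewrite distrC; exact: le_trans (qL x y Sx Sy) Ld.
Qed.

Lemma lipschitz_class_good (p : PT) : lipschitz_class p -> good p.
Proof.
move=> [pab pL pe]; split => // [|u Su]; last by have /andP[+ _] := pab u; exact: lt_le_trans.
apply/subspace_continuousP => u Su; apply/cvgrPdist_le => e e0.
have L1 : 0 < L + 1 by rewrite ltr_wpDl.
rewrite near_withinE; apply/nbhs_ballP; exists (e / (L + 1)) => /=; first by rewrite divr_gt0.
move=> v; rewrite -ball_normE /= => uv Sv; apply: le_trans (pL u v Su Sv) _.
apply: (@le_trans _ _ ((L + 1) * `|u - v|)); first by rewrite ler_wpM2r// lerDl.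
by rewrite mulrC -ler_pdivlMr// ltW.
Qed.

Section Energies.
Variables (lam mu : {measure set T -> \bar R}) (G Psi : 'rV[R]_n -> R -> R).
Hypotheses (n0 : (0 < n)%N) (slam : sphere_measure lam) (smu : sphere_measure mu)
  (cG : class_C G) (cPsi : class_C Psi).

Let aV0 : 0 < a^-1. Proof. by rewrite invr_gt0. Qed.

Lemma continuous_energyG : {within lipschitz_class, continuous (energyG lam G : PT -> R)}.
Proof.
apply/subspace_continuousP => p Xp; apply/cvgrPdist_le => e e0.
have [M M0 hM] := energy_lipschitz a^-1 slam cG a0.
pose d := e / (M + 1) * a ^+ 2.
have M1 : 0 < M + 1 by rewrite ltr_wpDl.
have d0 : 0 < d by rewrite mulr_gt0 ?exprn_gt0// divr_gt0.
near=> q; have Xq : lipschitz_class q by near: q; exact: withinT.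
have hd : forall x, S x -> `|q x - p x| <= d by near: q; exact: lipschitz_class_unif.
have [pab _ _] := Xp; have [qab _ _] := Xq.
have vb (r : PT) u : lipschitz_class r -> a <= (r u)^-1 <= a^-1.
  by move=> [rab _ _]; have := inv_bounds a0 (rab u); rewrite invrK.
apply: (@le_trans _ _ (M * (e / (M + 1)))); last first.
  by rewrite mulrCA ger_pMr// ler_pdivrMr// mul1r lerDl.
apply: hM => [||u Su|u Su|u Su]; try exact: vb; try by apply/good_inv/lipschitz_class_good.
have /andP[pa _] := pab u; have /andP[qa _] := qab u.
have p0 : 0 < p u := lt_le_trans a0 pa; have q0 : 0 < q u := lt_le_trans a0 qa.
have -> : (p u)^-1 - (q u)^-1 = (q u - p u) / (p u * q u) by field; rewrite ?gt_eqF.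
rewrite normrM (gtr0_norm (_ : 0 < (p u * q u)^-1)) ?invr_gt0 ?mulr_gt0//.
rewrite ler_pdivrMr ?mulr_gt0//; apply: le_trans (hd u Su) _.
rewrite /d ler_wpM2l ?divr_ge0 ?(ltW e0) ?(ltW M1)//.
by rewrite expr2 ler_pM// ltW.
Unshelve. all: by end_near. Qed.

Lemma continuous_energyPsi : {within lipschitz_class, continuous (energyPsi mu Psi : PT -> R)}.
Proof.
apply/subspace_continuousP => p Xp; apply/cvgrPdist_le => e e0.
have [M M0 hM] := energy_lipschitz a^-1 smu cPsi a0.
pose d := e / (M + 1) * a ^+ 2.
have M1 : 0 < M + 1 by rewrite ltr_wpDl.
have d0 : 0 < d by rewrite mulr_gt0 ?exprn_gt0// divr_gt0.
near=> q; have Xq : lipschitz_class q by near: q; exact: withinT.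
have hd : forall x, S x -> `|q x - p x| <= d by near: q; exact: lipschitz_class_unif.
have [pab _ _] := Xp; have [qab _ _] := Xq.
have vb (r : PT) u : lipschitz_class r -> S u -> a <= polar r u <= a^-1.
  by move=> [rab _ _] Su; have := polar_bounds n0 a0 aV0 (fun u _ => rab u) Su; rewrite invrK.
apply: (@le_trans _ _ (M * (e / (M + 1)))); last first.
  by rewrite mulrCA ger_pMr// ler_pdivrMr// mul1r lerDl.
apply: hM => [||u Su|u Su|u Su]; try exact: vb; try by apply: good_polar => //; exact: lipschitz_class_good.
have -> : e / (M + 1) = d / a ^+ 2 by rewrite /d mulfK// expf_neq0// gt_eqF.
apply: (@polar_dist _ _ a a^-1) => // v Sv; rewrite distrC; exact: hd.
Unshelve. all: by end_near. Qed.

Lemma energy_minimizer :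
  exists p, [/\ good p, energyG lam G p <= energyG lam G (cst 1),
    energyPsi mu Psi p <= energyPsi mu Psi (cst 1) &
    forall q : PT, lipschitz_class q -> energyG lam G q <= energyG lam G (cst 1) ->
      energyPsi mu Psi q <= energyPsi mu Psi (cst 1) ->
      energyG lam G p + energyPsi mu Psi p <= energyG lam G q + energyPsi mu Psi q].
Proof.
have haus : hausdorff_space PT by apply: hausdorff_product => x; exact: Rhausdorff.
have cX := compact_lipschitz_class; have clX := compact_closed haus cX.
pose K1 := lipschitz_class `&` (energyG lam G : PT -> R) @^-1` [set t | t <= energyG lam G (cst 1)].
pose K2 := lipschitz_class `&` (energyPsi mu Psi : PT -> R) @^-1` [set t | t <= energyPsi mu Psi (cst 1)].
have cl1 : closed K1 by apply: (closed_within_preimage clX _ continuous_energyG); exact: closed_le.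
have cl2 : closed K2 by apply: (closed_within_preimage clX _ continuous_energyPsi); exact: closed_le.
have cK : compact (K1 `&` K2).
  by apply: (subclosed_compact _ cX); [exact: closedI|move=> p [[]]].
(* The unit ball shows that the constraint set is nonempty; [a <= 1] enters here. *)
have X1 : lipschitz_class (cst 1 : PT).
  split => // [x|x y _ _]; last by rewrite subrr normr0 mulr_ge0.
  by rewrite a1/= invf_ge1.
have ne : K1 `&` K2 !=set0 by exists (cst 1 : PT); split; split => //=.
have cf : {within K1 `&` K2, continuous (fun p : PT => energyG lam G p + energyPsi mu Psi p)}.
  apply: (@continuous_subspaceW _ _ _ lipschitz_class); first by move=> p [[]].
  apply/subspace_continuousP => p Xp; apply: cvgD.
    exact: (subspace_continuousP _ _).1 continuous_energyG p Xp.
  exact: (subspace_continuousP _ _).1 continuous_energyPsi p Xp.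
have [p /set_mem[[Xp p1] [_ p2]] pmin] := compact_EVT_min ne cK cf.
exists p; split => //; first exact: lipschitz_class_good.
by move=> q Xq q1 q2; apply: pmin; rewrite inE; split; split.
Qed.

End Energies.

End Minimizer.

Lemma pareto_exists (R : realType) (n : nat) (n0 : (0 < n)%N)
    (lam mu : {measure set borelRn R n -> \bar R}) (G Psi : 'rV[R]_n -> R -> R) :
  sphere_measure lam -> sphere_measure mu -> class_C G -> class_C Psi ->
  (forall v r, sphere v -> 0 < r -> dt G v r < 0) -> coercive lam mu G Psi ->
  exists p, [/\ good p, forall x, sphere x -> polar (polar p) x = p x &
    forall q, good q -> (forall x, sphere x -> polar (polar q) x = q x) ->
      ~ (energyG lam G q < energyG lam G p /\ energyPsi mu Psi q < energyPsi mu Psi p)].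
Proof.
move=> slam smu cG cPsi dG [a' a'0 ca'].
pose a := Num.min a' 1.
have a0 : 0 < a by rewrite lt_min a'0 ltr01.
have a1 : a <= 1 by rewrite ge_min lexx orbT.
have ca p u : good p -> energyG lam G p <= energyG lam G (cst 1) ->
    energyPsi mu Psi p <= energyPsi mu Psi (cst 1) -> sphere u -> a <= p u /\ a <= polar p u.
  move=> gp h1 h2 Su; have [h3 h4] := ca' p gp h1 h2 u Su.
  by split; apply: le_trans (_ : a <= a') _ => //; rewrite ge_min lexx.
(* The Lipschitz constant of [pol S (1/h)] when [a <= h], so that every gauge in the sublevel set
   lies in the compact class. *)
pose L : R := n%:R * a^-1.
have L0 : 0 <= L by rewrite mulr_ge0// invr_ge0 ltW.
have [pm [gpm Em Fm pmin]] := energy_minimizer a0 a1 L0 n0 slam smu cG cPsi.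
(* The minimiser need not be a gauge. Its bipolar is one, with smaller or equal values: [E] does not
   increase because [G] decreases in [1/p], and [F] is unchanged because the support function is the
   same. *)
have gh := good_polar n0 gpm; have gp := good_polar n0 gh.
have Ep : energyG lam G (polar (polar pm)) <= energyG lam G pm.
  have [mf1 [M1 h1]] := good_int cG.2.1 (good_inv gp).
  have [mf2 [M2 h2]] := good_int cG.2.1 (good_inv gpm).
  apply: (Rint_le slam.2.1 (@measurable_sphere R n) mf1 mf2 (M := `|M1| + `|M2|)) => u Su.
  - by rewrite (le_trans (h1 u Su))// (le_trans (ler_norm _))// lerDl.
  - by rewrite (le_trans (h2 u Su))// (le_trans (ler_norm _))// lerDr.
  have [_ pm0 _] := gpm; have [_ p0 _] := gp.
  apply: (G_nonincr cG dG) => //; first by rewrite invr_gt0 pm0.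
  by rewrite lef_pV2 ?posrE ?pm0 ?p0// polar_bipolar_le.
have Fp : energyPsi mu Psi (polar (polar pm)) = energyPsi mu Psi pm.
  by apply: eq_Rintegral => u /set_mem Su; rewrite polar_tripolar.
exists (polar (polar pm)); split => //.
  by move=> x Sx; exact: polar_tripolar.
move=> q gq bq [Eq Fq].
have Eq1 : energyG lam G q <= energyG lam G (cst 1).
  exact: ltW (lt_le_trans Eq (le_trans Ep Em)).
have Fq1 : energyPsi mu Psi q <= energyPsi mu Psi (cst 1).
  by rewrite Fp in Fq; exact: ltW (lt_le_trans Fq Fm).
have qa u : sphere u -> a <= q u by move=> Su; have [] := ca q u gq Eq1 Fq1 Su.
have ha u : sphere u -> a <= polar q u by move=> Su; have [] := ca q u gq Eq1 Fq1 Su.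
have [_ h0 _] := good_polar n0 gq.
have hV u : sphere u -> 0 <= (polar q u)^-1 <= a^-1.
  move=> Su; rewrite invr_ge0 (ltW (h0 u Su))/=.
  by rewrite lef_pV2 ?posrE ?h0// ha.
(* The class bounds functions off the sphere too, so the competitor is reset to 1 there; the
   energies do not see the change. *)
pose q' := fun x => if x \in @sphere R n then q x else 1.
have qq' u : sphere u -> q' u = q u by move=> Su; rewrite /q' mem_set.
have Xq' : lipschitz_class a L q'.
  have [_ _ eq_] := gq.
  split => [x|x y Sx Sy|x Sx]; last by rewrite !qq' ?eq_//; exact: sphereN.
    rewrite /q'; case: ifPn => [/set_mem Sx|_]; last by rewrite a1 invf_ge1.
    rewrite qa//= -bq//; apply: (pol_le (@subset_refl _ _) (sphere_nonempty R n0) hV) => u Su.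
    have /andP[v0 va] := hV u Su.
    by apply: le_trans va; rewrite ler_piMl// dotv_sphere_le1.
  rewrite !qq'// -(bq x Sx) -(bq y Sy).
  exact: (pol_lipschitz (@subset_refl _ _) (sphere_nonempty R n0) hV).
have Eq' : energyG lam G q' = energyG lam G q.
  by apply: eq_Rintegral => u /set_mem Su; rewrite qq'.
have Fq' : energyPsi mu Psi q' = energyPsi mu Psi q.
  by apply: eq_Rintegral => u /set_mem Su; rewrite (eq_polar _ qq').
have := pmin q' Xq'; rewrite Eq' Fq' => /(_ Eq1 Fq1).
by rewrite leNgt ltrD// -?Fp// (lt_le_trans Eq).
Qed.

(** * First variation *)

Lemma inv_diff_cvg (R : realType) (x : nat -> R) (x0 d C a : R) : 0 < a ->
  (forall k, a <= x k) -> a <= x0 ->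
  (forall k, `|k.+1%:R * (x k - x0)| <= C) ->
  (fun k => k.+1%:R * (x k - x0)) @ \oo --> d ->
  (forall k, `|k.+1%:R * ((x k)^-1 - x0^-1)| <= C / a ^+ 2) /\
  (fun k => k.+1%:R * ((x k)^-1 - x0^-1)) @ \oo --> - d / x0 ^+ 2.
Proof.
move=> a0 ax ax0 xC xd.
have xp k : 0 < x k := lt_le_trans a0 (ax k); have x0p : 0 < x0 := lt_le_trans a0 ax0.
have e k : k.+1%:R * ((x k)^-1 - x0^-1) = - (k.+1%:R * (x k - x0)) / (x k * x0).
  by field; rewrite (gt_eqF (xp k)) (gt_eqF x0p).
split.
  move=> k; rewrite e normrM normrN normfV.
  rewrite ler_pM ?invr_ge0 ?normr_ge0// lef_pV2 ?posrE ?normr_gt0 ?exprn_gt0 ?mulf_neq0 ?gt_eqF//.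
  by rewrite gtr0_norm ?mulr_gt0// expr2 ler_pM// ltW.
under eq_fun do rewrite e.
have C0 : 0 <= C := le_trans (normr_ge0 _) (xC 0%N).
have cx : x @ \oo --> x0.
  apply/cvgrPdist_le => eps eps0; near=> k.
  have -> : x0 - x k = - ((k.+1%:R * (x k - x0)) * k.+1%:R^-1).
    by field; rewrite addrC natr1 pnatr_eq0.
  rewrite normrN normrM (@le_trans _ _ (C * k.+1%:R^-1))//.
    by rewrite (gtr0_norm (_ : 0 < k.+1%:R^-1)) ?invr_gt0// ler_pM2r ?invr_gt0.
  near: k; apply: (@cvgr_le _ _ _ _ _ (0 : R)) => //.
  by rewrite -[0](mulr0 C); apply: cvgM; [exact: cvg_cst|exact: cvg_harmonic].
apply: cvgM; first exact: cvgN.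
apply: cvgV; first by rewrite expf_neq0// gt_eqF.
by rewrite expr2; apply: cvgM => //; exact: cvg_cst.
Unshelve. all: by end_near. Qed.

Section Danskin.
Variables (R : realType) (n : nat).
Implicit Types (u v x y xi : 'rV[R]_n) (w g : 'rV[R]_n -> R).
Local Notation S := (@sphere R n).
Local Notation T := (borelRn R n).
Hypothesis n0 : (0 < n)%N.

Lemma pol_perturb_lipschitz w g (M t : R) x : 0 < t -> good w ->
  good (fun u => w u + t * g u) -> (forall u, S u -> `|g u| <= M) -> S x ->
  `|pol S (fun u => w u + t * g u) x - pol S w x| <= t * M.
Proof.
move=> t0 gw gt gM Sx.
have b u : S u -> `|dotv x u * (t * g u)| <= t * M.
  move=> Su; rewrite mulrCA normrM (gtr0_norm t0) ler_pM2l// normrM -[M]mul1r ler_pM ?gM//.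
  rewrite ler_norml dotv_sphere_le1// andbT lerNl -dotvNl dotv_sphere_le1//; exact: sphereN.
rewrite ler_norml lerBrDl lerBlDl; apply/andP; split.
  apply: (good_pol_le n0 gw) => u Su.
  have := good_pol_ub n0 x gt Su; rewrite mulrDr.
  by have := b u Su; rewrite ler_norml => /andP[]; lra.
rewrite lerBlDl; apply: (good_pol_le n0 gt) => u Su; rewrite mulrDr.
have := good_pol_ub n0 x gw Su.
by have := b u Su; rewrite ler_norml => /andP[]; lra.
Qed.

(** Danskin's envelope formula: away from a neighbourhood of the unique maximiser the
    unperturbed objective stays bounded away from its maximum. *)
Lemma danskin w g (M : R) x al : good w -> {within S, continuous g} ->
  (forall u, S u -> `|g u| <= M) ->
  (forall k, good (fun u => w u + k.+1%:R^-1 * g u)) ->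
  maximizers w x al -> (forall u, maximizers w x u -> u = al) -> S x ->
  (fun k => k.+1%:R * (pol S (fun u => w u + k.+1%:R^-1 * g u) x - pol S w x)) @ \oo
    --> dotv x al * g al.
Proof.
move=> gw cg gM gk [Sal eal] uniq Sx; have [cw w0 _] := gw.
pose A u := dotv x u * w u; pose B u := dotv x u * g u.
have cdot : {within S, continuous (dotv x)}.
  apply/subspace_continuousP => u Su.
  by apply: (@continuous_dotv _ _ _ (cst x) idfun); [exact: cvg_cst|exact: cvg_within].
have cA : {within S, continuous A}.
  apply/subspace_continuousP => u Su; apply: cvgM; first exact: (subspace_continuousP _ _).1.
  exact: (subspace_continuousP _ _).1.
have cB : {within S, continuous B}.
  apply/subspace_continuousP => u Su; apply: cvgM; first exact: (subspace_continuousP _ _).1.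
  exact: (subspace_continuousP _ _).1.
have BM u : S u -> `|B u| <= M.
  move=> Su; rewrite /B normrM -[M]mul1r ler_pM ?gM//.
  rewrite ler_norml dotv_sphere_le1// andbT lerNl -dotvNl dotv_sphere_le1//; exact: sphereN.
have M0 : 0 <= M := le_trans (normr_ge0 _) (gM al Sal).
have AB k u : dotv x u * (w u + k.+1%:R^-1 * g u) = A u + k.+1%:R^-1 * B u.
  by rewrite /A /B; ring.
apply/cvgrPdist_le => e e0.
(* The directions where the perturbation could beat its value at the maximizer by [e]; the maximizer
   itself lies outside. *)
pose C := S `&` B @^-1` [set t | B al + e <= t].
have clC : closed C.
  by apply: (closed_within_preimage (@closed_sphere R n) _ cB); exact: closed_ge.
have cC : compact C by apply: (subclosed_compact clC (@compact_sphere R n)) => u [].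
have [k0 hk0] : exists k0, forall k u, (k0 <= k)%N -> C u ->
    A u + k.+1%:R^-1 * B u <= pol S w x - k.+1%:R^-1 * M.
  have [C0|/set0P C0] := eqVneq C set0.
    by exists 0%N => k u _; rewrite C0.
  have cAC : {within C, continuous A} by apply: continuous_subspaceW cA => u [].
  have [v /set_mem[Sv Cv] vmax] := compact_EVT_max C0 cC cAC.
  have eta0 : 0 < pol S w x - A v.
    rewrite subr_gt0 lt_neqAle good_pol_ub// andbT; apply/eqP => ev.
    have va : v = al by apply: uniq.
    by move: Cv; rewrite /= va -subr_ge0 opprD addNKr oppr_ge0 leNgt e0.
  (* On [C] the perturbed objective gains at most [M/(k+1)], and another [M/(k+1)] is kept as
     margin, so twice this amount has to fit into the gap. *)
  exists (Num.truncn (2 * M / (pol S w x - A v))) => k u kk Cu.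
  have Av : A u <= A v by apply: vmax; exact: mem_set.
  have kM : k.+1%:R^-1 * (2 * M) <= pol S w x - A v.
    rewrite ler_pdivrMl// -ler_pdivrMr//; apply: ltW.
    have /andP[_ h] := truncn_itv (divr_ge0 (mulr_ge0 (ler0n R 2) M0) (ltW eta0)).
    by apply: lt_le_trans h _; rewrite ler_nat.
  have : k.+1%:R^-1 * B u <= k.+1%:R^-1 * M.
    by rewrite ler_pM2l ?invr_gt0// (le_trans (ler_norm _))// BM//; exact: Cu.1.
  by move: Av kM; move: (k.+1%:R^-1) => t; lra.
near=> k.
have k0p : 0 < k.+1%:R^-1 :> R by rewrite invr_gt0.
have lo : pol S w x + k.+1%:R^-1 * B al <= pol S (fun u => w u + k.+1%:R^-1 * g u) x.
  by rewrite -eal -/(A al) -AB; exact: good_pol_ub.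
have hi : pol S (fun u => w u + k.+1%:R^-1 * g u) x <= pol S w x + k.+1%:R^-1 * (B al + e).
  apply: (good_pol_le n0 (gk k)) => u Su; rewrite AB.
  have [uC|uC] := leP (B al + e) (B u).
    apply: le_trans (hk0 k u _ (conj Su uC)) _; first by near: k; exists k0.
    rewrite lerD2l -mulrN ler_pM2l//.
    by have := BM al Sal; rewrite ler_norml => /andP[]; lra.
  by rewrite lerD ?good_pol_ub// ler_pM2l// ltW.
have X1 : B al <= k.+1%:R * (pol S (fun u => w u + k.+1%:R^-1 * g u) x - pol S w x).
  by rewrite -ler_pdivrMl// lerBrDl.
have X2 : k.+1%:R * (pol S (fun u => w u + k.+1%:R^-1 * g u) x - pol S w x) <= B al + e.
  by rewrite -ler_pdivlMl// lerBlDl.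
rewrite distrC ger0_norm ?subr_ge0//.
by rewrite lerBlDl.
Unshelve. all: by end_near. Qed.

End Danskin.

(** * Proportionality of the two first variations *)

Section EulerLagrange.
Variables (R : realType) (n : nat).
Implicit Types (u v x y xi : 'rV[R]_n) (phi : 'rV[R]_n -> R).
Local Notation S := (@sphere R n).
Local Notation T := (borelRn R n).
Variables (lam mu : {measure set T -> \bar R}) (G Psi : 'rV[R]_n -> R -> R) (p : 'rV[R]_n -> R).
Hypotheses (n0 : (0 < n)%N) (lamM : class_M lam) (smu : sphere_measure mu)
  (cG : class_C G) (cPsi : class_C Psi) (ePsi : even_fun Psi)
  (dG : forall v r, S v -> 0 < r -> dt G v r < 0)
  (dPsi : forall v r, S v -> 0 < r -> 0 < dt Psi v r)
  (gp : good p) (bp : forall x, S x -> polar (polar p) x = p x).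

Let slam : sphere_measure lam := lamM.1.

Definition wulff_weight : 'rV[R]_n -> R := fun u => (polar p u)^-1.
Local Notation w := wulff_weight.
Local Notation h := (polar p).

Definition regular_set : set 'rV[R]_n := S `\` singular w.
Local Notation D := regular_set.

Definition gauss_map x : 'rV[R]_n := xget 0 (maximizers w x).
Local Notation al := gauss_map.

(** With radial function [1/p], the product of [density] and [dual_density] at the normal is minus
    the integrand of [Ctilde]; the sign makes both factors positive. *)
Definition density x : R := - (dt G x (p x)^-1 * (p x)^-1).
Definition dual_density u : R := (h u * dt Psi u (h u))^-1.

Lemma good_weight : good w.
Proof. exact/good_inv/good_polar. Qed.

Lemma pol_weight x : S x -> pol S w x = p x.
Proof. exact: bp. Qed.

Lemma gauss_mapP x : S x -> maximizers w x (al x).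
Proof.
have [a [b [a0 _ wab]]] := good_bounds good_weight; have [cw _ _] := good_weight.
move=> Sx; have [u mu_] := maximizers_nonempty n0 a0 wab cw x.
by rewrite /al; case: xgetP => [z _|/(_ u)].
Qed.

Lemma sphere_gauss_map x : S x -> S (al x).
Proof. by move=> /gauss_mapP[]. Qed.

Lemma gauss_map_weight x : S x -> dotv x (al x) * w (al x) = p x.
Proof. by move=> Sx; have [_ ->] := gauss_mapP Sx; exact: pol_weight. Qed.

Lemma gauss_map_uniq x u : D x -> maximizers w x u -> u = al x.
Proof.
move=> [Sx nx] mu_; apply: contrapT => ne; apply: nx; split => //.
by exists u, (al x); split => //; exact: gauss_mapP.
Qed.

Lemma regular_null : measurable (singular w : set T) /\ lam (singular w) = 0%E.
Proof.
have [a [b [a0 _ wab]]] := good_bounds good_weight; have [cw _ _] := good_weight.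
exact: singular_null n0 a0 wab cw lam lamM.
Qed.

Lemma measurable_regular : measurable (D : set T).
Proof. by apply: measurableD; [exact: measurable_sphere|exact: regular_null.1]. Qed.

Lemma regular_sphere : D `<=` S. Proof. by move=> x []. Qed.

(** On [D] the maximizer is unique, so the preimage of an open [U] is [D] minus the closed set of
    directions having a maximizer outside [U]. *)
Lemma measurable_gauss_map : measurable_fun (D : set T) (al : T -> T).
Proof.
have [a [b [a0 _ wab]]] := good_bounds good_weight; have [cw _ _] := good_weight.
apply: (@measurability _ _ T T D al (@open_sets R n) erefl) => _ [U oU <-].
have -> : D `&` al @^-1` U = D `\` [set x | S x /\ exists2 u, (~` U) u & maximizers w x u].
  apply/seteqP; split => [x [Dx Ux]|x [Dx nx]]; split => //.
    by move=> [_ [u nUu mu_]]; apply: nUu; rewrite (gauss_map_uniq Dx mu_).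
  apply: contrapT => nU; apply: nx; split; first exact: Dx.1.
  by exists (al x) => //; apply: gauss_mapP; exact: Dx.1.
apply: measurableD; first exact: measurable_regular.
apply: closed_borel; apply: (closed_maximizers_meet n0 a0 wab cw).
exact: open_closedC.
Qed.

Lemma continuous_density : {within S, continuous density}.
Proof.
have [cv v0 _] := good_inv gp.
have c1 := continuousC_comp cG.2.2 v0 cv.
apply/subspace_continuousP => x Sx; apply: cvgN; apply: cvgM.
  exact: ((subspace_continuousP _ _).1 c1 x Sx).
exact: ((subspace_continuousP _ _).1 cv x Sx).
Qed.

Lemma density_gt0 x : S x -> 0 < density x.
Proof.
move=> Sx; have [_ v0 _] := good_inv gp.
by rewrite oppr_gt0 nmulr_rlt0 ?dG ?v0//; exact: v0.
Qed.

Lemma dual_density_gt0 u : S u -> 0 < dual_density u.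
Proof.
by move=> Su; have [_ h0 _] := good_polar n0 gp; rewrite invr_gt0 mulr_gt0 ?h0// dPsi ?h0.
Qed.

Lemma continuous_dual_density : {within S, continuous dual_density}.
Proof.
have [ch h0 _] := good_polar n0 gp; have c1 := continuousC_comp cPsi.2.2 h0 ch.
apply/subspace_continuousP => u Su; apply: cvgV.
  by rewrite gt_eqF// mulr_gt0 ?h0// dPsi ?h0.
by apply: cvgM; [exact: ((subspace_continuousP _ _).1 ch u Su)|exact: ((subspace_continuousP _ _).1 c1 u Su)].
Qed.

Lemma even_dual_density : even_on_sphere dual_density.
Proof.
move=> u Su; have [_ h0 eh] := good_polar n0 gp.
by rewrite /dual_density eh// dt_even// h0.
Qed.

Local Notation J phi := (Rintegral lam D (fun x => density x * (dual_density (al x) * phi (al x)))).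

Lemma sphere_cvgM (f g : 'rV[R]_n -> R) : {within S, continuous f} -> {within S, continuous g} ->
  {within S, continuous (fun u => f u * g u)}.
Proof.
move=> /subspace_continuousP cf /subspace_continuousP cg.
by apply/subspace_continuousP => u Su; apply: cvgM; [exact: cf|exact: cg].
Qed.

Lemma measurable_gauss_comp (f : 'rV[R]_n -> R) : {within S, continuous f} ->
  measurable_fun (D : set T) ((fun x => f (al x)) : T -> R).
Proof.
move=> cf; apply: (@measurable_comp _ _ _ T T R (S : set T)).
- exact: measurable_sphere.
- by move=> _ [x Dx <-]; apply: sphere_gauss_map; exact: Dx.1.
- by apply: sphere_continuous_borel => //; exact: measurable_sphere.
- exact: measurable_gauss_map.
Qed.

Lemma J_int phi : {within S, continuous phi} ->
  measurable_fun (D : set T) ((fun x => density x * (dual_density (al x) * phi (al x))) : T -> R) /\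
  exists M, forall x, D x -> `|density x * (dual_density (al x) * phi (al x))| <= M.
Proof.
move=> cphi; have c1 := sphere_cvgM continuous_dual_density cphi; split.
  apply: measurable_funM; last exact: (measurable_gauss_comp c1).
  by apply: sphere_continuous_borel => //; [exact: measurable_regular|exact: regular_sphere|exact: continuous_density].
have [M1 M10 h1] := continuous_sphere_bounded continuous_density.
have [M2 M20 h2] := continuous_sphere_bounded c1.
exists (M1 * M2) => x Dx; rewrite normrM ler_pM ?h1//; first exact: Dx.1.
by apply: h2; apply: sphere_gauss_map; exact: Dx.1.
Qed.

Lemma Rint_regular (f : 'rV[R]_n -> R) : {within S, continuous f} ->
  Rintegral lam S f = Rintegral lam D f.
Proof.
move=> cf; have mS := @measurable_sphere R n.
have mf : measurable_fun (S : set T) (f : T -> R) by exact: sphere_continuous_borel.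
have [M _ hM] := continuous_sphere_bounded cf.
rewrite /Rintegral; congr fine; apply: negligible_integral => //.
- exact: regular_null.1.
- exact: (@bounded_integrable _ _ lam slam.2.1 S mS f M mf hM).
- exact: regular_null.2.
Qed.

Hypothesis pareto : forall q, good q -> (forall x, sphere x -> polar (polar q) x = q x) ->
  ~ (energyG lam G q < energyG lam G p /\ energyPsi mu Psi q < energyPsi mu Psi p).

(** If both signs held, perturbing the weight by a small multiple of [phi * dual_density * w]
    would decrease both energies. *)
Lemma pareto_sign phi : {within S, continuous phi} -> even_on_sphere phi ->
  ~ (J phi < 0 /\ 0 < Rintegral mu S phi).
Proof.
move=> cphi ephi [Jneg Ipos].
have mS := @measurable_sphere R n.
have gw := good_weight; have [cw w0 ew] := gw.
have [a [b [a0 b0 wab]]] := good_bounds gw.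
(* [dual_density u * w u] cancels the factor [h ^ 2 * dt Psi u h] produced by differentiating [Psi]
   at the inverse weight. The derivative of the bound for [F] becomes a negative multiple of the
   integral of [phi], and that of [E] the same positive multiple of [J phi]. *)
pose g0 u := phi u * dual_density u * w u.
have cg0 : {within S, continuous g0} by apply: sphere_cvgM => //; apply: sphere_cvgM => //; exact: continuous_dual_density.
have [Mg Mg0 hMg] := continuous_sphere_bounded cg0.
(* Keeps every perturbed weight above [a / 2]. *)
pose eps := a / (2 * (Mg + 1)).
have M1 : 0 < Mg + 1 by rewrite ltr_wpDl.
have eps0 : 0 < eps by rewrite divr_gt0// mulr_gt0.
pose g u := eps * g0 u.
have ga u : S u -> `|g u| <= a / 2.
  move=> Su; rewrite /g normrM (gtr0_norm eps0) (_ : a / 2 = eps * (Mg + 1)).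
    by rewrite ler_pM2l// (le_trans (hMg u Su))// lerDl.
  by rewrite /eps; field; rewrite gt_eqF.
have cg : {within S, continuous g}.
  by apply: sphere_cvgM => // u; exact: cst_continuous.
pose wk k u := w u + k.+1%:R^-1 * g u.
have wkab k u : S u -> a / 2 <= wk k u <= b + a / 2.
  move=> Su; have : `|k.+1%:R^-1 * g u| <= a / 2.
    rewrite normrM -[leRHS]mul1r ler_pM ?ga// ger0_norm ?invr_ge0// invf_le1//.
    by rewrite ler1n.
  rewrite /wk ler_norml; have /andP[] := wab u Su.
  by move: (_^-1 * _) => t; move=> ? ? /andP[? ?]; apply/andP; split; lra.
have a20 : 0 < a / 2 by rewrite divr_gt0.
have gwk k : good (wk k).
  split => [|u Su|u Su].
  - apply/subspace_continuousP => u Su; apply: cvgD.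
      exact: ((subspace_continuousP _ _).1 cw u Su).
    by apply: cvgM; [exact: cvg_cst|exact: ((subspace_continuousP _ _).1 cg u Su)].
  - by have /andP[+ _] := wkab k u Su; exact: lt_le_trans.
  - by rewrite /wk /g /g0 ew// ephi// even_dual_density.
pose q k := pol S (wk k).
have gq k : good (q k) by exact: good_pol.
have qab k x : S x -> a / 2 <= q k x <= b + a / 2.
  by move=> Sx; exact: (polS_bounds n0 a20 (wkab k)).
have pab x : S x -> a / 2 <= p x <= b + a / 2.
  move=> Sx; rewrite -pol_weight//; apply: (polS_bounds n0 a20) => // u Su.
  by have /andP[h1 h2] := wab u Su; apply/andP; split; lra.
have B0 : 0 < (b + a / 2)^-1 by rewrite invr_gt0 addr_gt0.
have gpV := good_inv gp.
pose dE x := - (dotv x (al x) * g (al x)) / (p x) ^+ 2.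
have limE x : D x -> (fun k => k.+1%:R * (q k x - p x)) @ \oo --> dotv x (al x) * g (al x).
  move=> Dx; have Sx := Dx.1; rewrite -(pol_weight Sx).
  apply: (danskin n0 gw cg ga gwk (gauss_mapP Sx) _ Sx) => u; exact: gauss_map_uniq.
have bdE k x : S x -> `|k.+1%:R * (q k x - p x)| <= a / 2.
  move=> Sx; rewrite -(pol_weight Sx) normrM (gtr0_norm (_ : 0 < k.+1%:R))// -ler_pdivlMl//.
  by apply: (pol_perturb_lipschitz n0 _ gw (gwk k) ga Sx); rewrite invr_gt0.
have inE_ x (Dx : D x) := inv_diff_cvg a20 (fun k => (andP (qab k x Dx.1)).1) (andP (pab x Dx.1)).1
  (fun k => bdE k x Dx.1) (limE x Dx).
have [_ _ cvE] := @Rint_derivative _ _ lam slam.2.1 D measurable_regular regular_sphere G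
  (fun k x => (q k x)^-1) (fun x => (p x)^-1) dE _ (a / 2)^-1 _ cG B0
  (fun k => let: And3 c _ _ := good_inv (gq k) in c) (let: And3 c _ _ := gpV in c)
  (fun k x Sx => inv_bounds a20 (qab k x Sx)) (fun x Sx => inv_bounds a20 (pab x Sx))
  (fun k x Dx => (inE_ x Dx).1 k) (fun x Dx => (inE_ x Dx).2).
have [mJ [MJ hJ]] := J_int cphi.
have limJ : Rintegral lam D (fun x => dt G x (p x)^-1 * dE x) = eps * J phi.
  rewrite -(RintZ slam.2.1 measurable_regular eps mJ hJ); apply: eq_Rintegral => x /set_mem Dx.
  have Sx := Dx.1; have [_ p0 _] := gp.
  have e : dotv x (al x) * g (al x) = eps * (phi (al x) * dual_density (al x)) * p x.
    by rewrite -[in RHS](gauss_map_weight Sx) /g /g0; ring.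
  by rewrite /dE e /density; field; rewrite gt_eqF ?p0.
rewrite limJ in cvE.
have EqE k : energyG lam G (q k) - energyG lam G p =
    Rintegral lam D (fun x => G x (q k x)^-1) - Rintegral lam D (fun x => G x (p x)^-1).
  have [c1 v1 _] := good_inv (gq k); have [c2 v2 _] := gpV.
  by congr (_ - _); apply: Rint_regular; apply: continuousC_comp => //; exact: cG.2.1.
have negJ : eps * J phi < 0 by rewrite pmulr_rlt0.
have [kE _ hkE] := @cvgr_lt _ _ _ _ _ _ cvE _ negJ.
have [ch h0 _] := good_polar n0 gp.
pose dF u := - g u / (w u) ^+ 2.
have limF u : S u -> (fun k => k.+1%:R * (wk k u - w u)) @ \oo --> g u.
  move=> Su; rewrite (_ : (fun k => _) = cst (g u)); first exact: cvg_cst.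
  apply/funext => k; rewrite /wk [w u + _]addrC addrK mulrA mulfV ?mul1r//.
have bdF k u : S u -> `|k.+1%:R * (wk k u - w u)| <= a / 2.
  by move=> Su; rewrite /wk [w u + _]addrC addrK mulrA mulfV ?mul1r ?ga.
have wab' u : S u -> a / 2 <= w u <= b + a / 2.
  by move=> Su; have /andP[h1 h2] := wab u Su; apply/andP; split; lra.
have inF_ u (Su : S u) := inv_diff_cvg a20 (fun k => (andP (wkab k u Su)).1)
  (andP (wab' u Su)).1 (fun k => bdF k u Su) (limF u Su).
have [_ _ cvF] := @Rint_derivative _ _ mu smu.2.1 S mS (@subset_refl _ _) Psi
  (fun k u => (wk k u)^-1) (fun u => (w u)^-1) dF _ (a / 2)^-1 _ cPsi B0
  (fun k => let: And3 c _ _ := good_inv (gwk k) in c) (let: And3 c _ _ := good_inv gw in c)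
  (fun k x Sx => inv_bounds a20 (wkab k x Sx)) (fun x Sx => inv_bounds a20 (wab' x Sx))
  (fun k x Sx => (inF_ x Sx).1 k) (fun x Sx => (inF_ x Sx).2).
have [Mp Mp0 hMp] := continuous_sphere_bounded cphi.
have mphi : measurable_fun (S : set T) (phi : T -> R) by exact: sphere_continuous_borel.
have limI : Rintegral mu S (fun u => dt Psi u (w u)^-1 * dF u) = - eps * Rintegral mu S phi.
  rewrite -(RintZ smu.2.1 mS (- eps) mphi hMp); apply: eq_Rintegral => u /set_mem Su.
  rewrite /dF /g /g0 /dual_density /w invrK; have hu := h0 u Su; have := dPsi Su hu.
  by move=> P0; field; rewrite ?gt_eqF.
rewrite limI in cvF.
have negI : - eps * Rintegral mu S phi < 0 by rewrite mulNr oppr_lt0 mulr_gt0.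
have [kF _ hkF] := @cvgr_lt _ _ _ _ _ _ cvF _ negI.
pose k := maxn kE kF.
have := hkE k (leq_maxl _ _); have := hkF k (leq_maxr _ _); rewrite /=.
rewrite !pmulr_rlt0// -EqE !subr_lt0 => Fk Ek.
apply: (pareto (gq k)).
  (* [q k] is the polar of [1 / wk k], and a polar equals its own bipolar. *)
  move=> x Sx; have := polar_tripolar n0 (good_inv (gwk k)) Sx.
  have e y : polar (fun u => (wk k u)^-1) y = q k y by apply: eq_pol => u _; rewrite invrK.
  rewrite e => <-; apply: eq_polar => u _; apply: eq_polar => v _; exact/esym/e.
(* [1 / wk k] need not be the support function of its Wulff shape, but it dominates it, and [Psi] is
   increasing. *)
split => //; apply: le_lt_trans (_ : Rintegral mu S (fun u => Psi u (wk k u)^-1) < _).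
  have [m1 [N1 hN1]] := good_int cPsi.2.1 (good_polar n0 (gq k)).
  have [m2 [N2 hN2]] := good_int cPsi.2.1 (good_inv (gwk k)).
  apply: (Rint_le smu.2.1 mS m1 m2 (M := `|N1| + `|N2|)) => u Su.
  - by rewrite (le_trans (hN1 u Su))// (le_trans (ler_norm _))// lerDl.
  - by rewrite (le_trans (hN2 u Su))// (le_trans (ler_norm _))// lerDr.
  have [_ q0 _] := good_polar n0 (gq k); have [_ wk0 _] := gwk k.
  apply: (Psi_nondecr cPsi dPsi) => //; first exact: q0.
  apply: (good_pol_le n0 (good_inv (gq k))) => x Sx; have [_ qk0 _] := gq k.
  rewrite ler_pdivrMr ?qk0// -ler_pdivrMl ?invr_gt0 ?wk0// invrK mulrC dotvC.
  exact: good_pol_ub.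
apply: lt_le_trans Fk _; rewrite le_eqVlt; apply/orP; left; apply/eqP.
by apply: eq_Rintegral => u _; rewrite /w invrK.
Qed.

Lemma J_one_gt0 : 0 < J (cst 1).
Proof.
have [c c0 hc] := continuous_sphere_lbound continuous_density density_gt0.
have [c' c'0 hc'] := continuous_sphere_lbound continuous_dual_density dual_density_gt0.
have c1 : {within S, continuous (cst 1 : 'rV[R]_n -> R)} by move=> ?; exact: cst_continuous.
have [mJ [MJ hJ]] := J_int c1.
apply: (@lt_le_trans _ _ (Rintegral lam D (cst (c * c')))).
  rewrite Rintegral_cst; last exact: measurable_regular.
  rewrite mulr_gt0// ?mulr_gt0//.
  have := Rint_regular c1.
  rewrite !Rintegral_cst ?mul1r; [|exact: measurable_regular|exact: measurable_sphere].
  by move=> <-; exact: mass_sphere_gt0.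
apply: (Rint_le slam.2.1 measurable_regular _ mJ (M := `|c * c'| + `|MJ|)).
- exact: measurable_cst.
- by move=> x Dx; rewrite lerDl.
- by move=> x Dx; rewrite (le_trans (hJ x Dx))// (le_trans (ler_norm _))// lerDr.
move=> x Dx; have Sx := Dx.1; have Sal := sphere_gauss_map Sx.
by rewrite mulr1; apply: ler_pM; [exact: ltW|exact: ltW|exact: hc|exact: hc'].
Qed.

(** Subtracting the [mu]-mean makes the integral of [phi] zero. [J] is then nonnegative on this
    function and on its opposite, hence zero, which gives the factor of proportionality. *)
Lemma euler_lagrange phi : {within S, continuous phi} -> even_on_sphere phi ->
  Rintegral mu S phi = fine (mu S) / J (cst 1) * J phi.
Proof.
have mS := @measurable_sphere R n; have mD := measurable_regular.
have J1 := J_one_gt0; have m0 := mass_sphere_gt0 smu.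
have c1 : {within S, continuous (cst 1 : 'rV[R]_n -> R)} by move=> ?; exact: cst_continuous.
have [mJ1 [MJ1 hJ1]] := J_int c1.
have aff phi' s t : {within S, continuous phi'} ->
    Rintegral mu S (fun u => s * phi' u + t) = s * Rintegral mu S phi' + t * fine (mu S) /\
    J (fun u => s * phi' u + t) = s * J phi' + t * J (cst 1).
  move=> cphi; have [M _ hM] := continuous_sphere_bounded cphi.
  have mphi : measurable_fun (S : set T) (phi' : T -> R) by exact: sphere_continuous_borel.
  have [mJ [MJ hJ]] := J_int cphi.
  split.
    rewrite (RintD smu.2.1 mS (f := fun u => s * phi' u) (g := cst t) (M := `|s| * M + `|t|)).
    - by rewrite (RintZ smu.2.1 mS s mphi hM) Rintegral_cst.
    - by apply: measurable_funM => //; exact: measurable_cst.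
    - exact: measurable_cst.
    - by move=> u Su; rewrite normrM (le_trans (ler_wpM2l _ (hM u Su)))// lerDl.
    - by move=> u Su; rewrite lerDr mulr_ge0// (le_trans _ (hM u Su)).
  rewrite -(RintZ slam.2.1 mD s mJ hJ) -(RintZ slam.2.1 mD t mJ1 hJ1).
  rewrite -(RintD slam.2.1 mD (M := `|s| * `|MJ| + `|t| * `|MJ1|)).
  - by apply: eq_Rintegral => x _ /=; ring.
  - by apply: measurable_funM => //; exact: measurable_cst.
  - by apply: measurable_funM => //; exact: measurable_cst.
  - move=> x Dx; rewrite normrM (@le_trans _ _ (`|s| * `|MJ|))// ?lerDl ?mulr_ge0//.
    by rewrite ler_wpM2l// (le_trans (hJ x Dx))// ler_norm.
  - move=> x Dx; rewrite normrM (@le_trans _ _ (`|t| * `|MJ1|))// ?lerDr ?mulr_ge0//.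
    by rewrite ler_wpM2l// (le_trans (hJ1 x Dx))// ler_norm.
have ge phi' : {within S, continuous phi'} -> even_on_sphere phi' -> Rintegral mu S phi' = 0 ->
    0 <= J phi'.
  move=> cphi ephi I0; rewrite leNgt; apply/negP => Jn.
  (* Adding the constant [t] makes the [mu]-integral positive and leaves half of the negative value
     of [J], against [pareto_sign]. *)
  pose t := - J phi' / (2 * J (cst 1)).
  have t0 : 0 < t by rewrite divr_gt0 ?oppr_gt0// mulr_gt0.
  apply: (@pareto_sign (fun u => 1 * phi' u + t)).
  - apply/subspace_continuousP => u Su; apply: cvgD; last exact: cvg_cst.
    apply: cvgM; first exact: cvg_cst.
    exact: ((subspace_continuousP _ _).1 cphi u Su).
  - by move=> u Su; rewrite ephi.
  have [-> ->] := aff phi' 1 t cphi.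
  rewrite I0 mulr0 add0r mulr_gt0// mul1r; split => //.
  have -> : t * J (cst 1) = - J phi' / 2 by rewrite /t; field; rewrite gt_eqF.
  by lra.
move=> cphi ephi; set I := Rintegral mu S phi.
have [e1 e2] := aff phi 1 (- I / fine (mu S)) cphi.
have [e3 e4] := aff phi (-1) (I / fine (mu S)) cphi.
have cs s t : {within S, continuous (fun u => s * phi u + t)}.
  apply/subspace_continuousP => u Su; apply: cvgD; last exact: cvg_cst.
  apply: cvgM; first exact: cvg_cst.
  exact: ((subspace_continuousP _ _).1 cphi u Su).
have es s t : even_on_sphere (fun u => s * phi u + t) by move=> u Su; rewrite ephi.
have mS_neq0 : fine (mu S) != 0 by rewrite gt_eqF.
have h1 := ge _ (cs 1 (- I / fine (mu S))) (es _ _).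
have h2 := ge _ (cs (-1) (I / fine (mu S))) (es _ _).
rewrite e1 e2 -/I in h1; rewrite e3 e4 -/I in h2.
have {}h1 : 0 <= J phi - I / fine (mu S) * J (cst 1).
  move: h1; rewrite mul1r mulfVK// subrr !mulNr mul1r; exact.
have {}h2 : 0 <= - J phi + I / fine (mu S) * J (cst 1).
  move: h2; rewrite !mulN1r mulfVK// addNr; exact.
have e : J phi = I / fine (mu S) * J (cst 1) by apply/eqP; rewrite eq_le; apply/andP; split; lra.
by rewrite e; field; rewrite mS_neq0 gt_eqF.
Qed.

End EulerLagrange.

(** * Passage to measures *)

Section OpenApprox.
Variables (R : realType) (n : nat).
Implicit Types (u v c : 'rV[R]_n) (A C : set 'rV[R]_n).

Definition dist_set C u : R := inf [set `|u - c| | c in C].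

Lemma dist_set_has_inf C u : C !=set0 -> has_inf [set `|u - c| | c in C].
Proof.
move=> [c Cc]; split; first by exists `|u - c|; exists c.
by exists 0 => _ [d _ <-].
Qed.

Lemma dist_set_ge0 C u : C !=set0 -> 0 <= dist_set C u.
Proof. by move=> [c Cc]; apply: lb_le_inf; [exists `|u - c|; exists c|move=> _ [d _ <-]]. Qed.

Lemma dist_set_lip C u v : C !=set0 -> dist_set C u <= `|u - v| + dist_set C v.
Proof.
move=> C0; rewrite -lerBlDl; apply: lb_le_inf; first by have [c Cc] := C0; exists `|v - c|; exists c.
move=> _ [c Cc <-]; rewrite lerBlDl.
apply: (@le_trans _ _ `|u - c|); last by rewrite -(subrKA v u) ler_normD.
by apply: ge_inf; [exact: (dist_set_has_inf u C0).2|exists c].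
Qed.

Lemma dist_set_in C u : C u -> dist_set C u = 0.
Proof.
move=> Cu; have C0 : C !=set0 by exists u.
apply/eqP; rewrite eq_le dist_set_ge0// andbT.
by apply: ge_inf; [exact: (dist_set_has_inf u C0).2|exists u; rewrite ?subrr ?normr0].
Qed.

Lemma dist_set_gt0 C u : C !=set0 -> closed C -> ~ C u -> 0 < dist_set C u.
Proof.
move=> C0 cC nCu; have : nbhs u (~` C) by apply: open_nbhs_nbhs; split => //; exact: closed_openC.
move=> /nbhs_ballP[e /= e0 he]; apply: lt_le_trans e0 _.
apply: lb_le_inf; first by have [c Cc] := C0; exists `|u - c|; exists c.
move=> _ [c Cc <-]; rewrite leNgt; apply/negP => uc.
by apply: (he c); rewrite -?ball_normE.
Qed.

Lemma continuous_dist_set C : C !=set0 -> continuous (dist_set C).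
Proof.
move=> C0 u; apply/(@cvgrPdist_le _ _ _ (nbhs u) (nbhs_filter u)) => e e0.
apply/nbhs_ballP; exists e => //= v; rewrite -ball_normE /= => uv.
have := dist_set_lip v u C0; rewrite distrC; have := dist_set_lip u v C0.
by rewrite ler_norml; move: uv; lra.
Qed.

(** With [d] the distance to the complement, [k d / (1 + k d)] is 0 off [A] and tends to 1 on [A].
    If the complement is empty, [d] is meaningless and constants serve. *)
Lemma open_approx A : open A -> exists phi : nat -> 'rV[R]_n -> R,
  [/\ forall k, continuous (phi k), forall k u, 0 <= phi k u <= 1 &
      forall u, phi ^~ u @ \oo --> (\1_A u : R)].
Proof.
move=> oA; have [C0|/set0P C0] := eqVneq (~` A) set0.
  exists (fun _ => cst 1); split => [k u|k u|u]; first exact: cst_continuous.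
    by rewrite ler01 lexx.
  have Au : A u by apply: contrapT => nA; suff : set0 u by []; rewrite -C0.
  by rewrite indicE mem_set//; exact: cvg_cst.
pose d := dist_set (~` A); have d0 u : 0 <= d u by exact: dist_set_ge0.
have cA : closed (~` A) by exact: open_closedC.
have den k u : 0 < 1 + k%:R * d u by rewrite ltr_pwDl// mulr_ge0.
exists (fun k u => k%:R * d u / (1 + k%:R * d u)); split => [k u|k u|u].
- have ckd : (fun v => k%:R * d v) @ nbhs u --> k%:R * d u.
    apply: (@cvgM _ _ (nbhs u)); first exact: cvg_cst.
    exact: continuous_dist_set.
  apply: (@cvgM _ _ (nbhs u)) => //; apply: (@cvgV _ _ (nbhs u)); first by rewrite gt_eqF.
  by apply: (@cvgD _ _ _ (nbhs u)) => //; exact: cvg_cst.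
- by rewrite divr_ge0 ?mulr_ge0 ?(ltW (den k u))//= ler_pdivrMr// mul1r lerDr.
have [Au|nA] := pselect (A u); last first.
  rewrite indicE memNset//; have -> : d u = 0 by apply: dist_set_in.
  rewrite (_ : (fun k => _) = cst 0); first exact: cvg_cst.
  by apply/funext => k; rewrite mulr0 mul0r.
have du : 0 < d u by apply: dist_set_gt0 => //=; exact.
rewrite indicE mem_set//; apply/cvgrPdist_le => e e0; near=> k.
have -> : 1 - k%:R * d u / (1 + k%:R * d u) = (1 + k%:R * d u)^-1.
  have dn := lt0r_neq0 (den k u).
  by apply: (mulIf dn); rewrite mulrBl mul1r mulVf// mulfVK// addrK.
rewrite gtr0_norm ?invr_gt0// invf_ple ?posrE//.
rewrite -[leLHS]add0r lerD// -ler_pdivrMr//; near: k; exact: nbhs_infty_ger.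
Unshelve. all: by end_near. Qed.

End OpenApprox.

(** * Integrals over arbitrary domains and pushed densities *)

Section NonmeasurableDomain.
Context d (T : measurableType d) (R : realType).
Variable mu : {measure set T -> \bar R}.
Local Open Scope ereal_scope.
Import HBNNSimple.

(** Every simple function below [f] on [A] lies below [g] on [B]. This is meant for reverse radial
    Gauss images, which are not known to be Borel. *)
Lemma le_integral_nonmeasurable (A B : set T) (f g : T -> \bar R) :
  (forall x, A x -> 0 <= f x) -> (forall x, B x -> 0 <= g x) ->
  (forall x, (f \_ A) x <= (g \_ B) x) ->
  \int[mu]_(x in A) f x <= \int[mu]_(x in B) g x.
Proof.
move=> f0 g0 fg; rewrite !ge0_integralE//; apply: ge_ereal_sup => _ [h /= hf <-].
by apply: ereal_sup_ubound; exists h => //= x; exact: le_trans (fg x).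
Qed.

(** The library's integral of a nonnegative function is a supremum over simple functions,
    so null sets can be discarded without measurability of the domain or the integrand. *)
Lemma ge0_integral_setD_null (A N : set T) (f : T -> \bar R) :
  measurable N -> mu N = 0 -> (forall x, A x -> 0 <= f x) ->
  \int[mu]_(x in A) f x = \int[mu]_(x in A `\` N) f x.
Proof.
move=> mN N0 f0; apply/eqP; rewrite eq_le; apply/andP; split; last first.
  apply: le_integral_nonmeasurable => // [x [/f0]//|x].
  rewrite !patchE; case: ifPn => [/set_mem[Ax _]|_]; first by rewrite mem_set.
  by case: ifPn => // xA; apply: f0; exact: set_mem.
have f0' x : (A `\` N) x -> 0 <= f x by move=> [/f0].
rewrite !ge0_integralE//; apply: ge_ereal_sup => _ [h /= hf <-].
have mNc : measurable (~` N) by exact: measurableC.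
(* A simple function below [f] on [A] is cut off on the null set [N]: its integral is unchanged and
   it becomes admissible for [A] minus [N]. *)
have -> : sintegral mu h = sintegral mu (proj_nnsfun h mNc).
  rewrite -[LHS](integralT_nnsfun mu h) -[RHS](integralT_nnsfun mu (proj_nnsfun h mNc)).
  rewrite (ge0_negligible_integral mN)//; last 2 first.
  - exact/measurable_EFinP/measurable_funP.
  - by move=> x _; rewrite lee_fin.
  rewrite setTD integral_mkcond; apply: eq_integral => x _.
  rewrite patchE /= mindicE; case: ifPn; rewrite ?mulr1// => _.
  by rewrite mulr0.
apply: ereal_sup_ubound; exists (proj_nnsfun h mNc) => //= x.
rewrite mindicE patchE; have := hf x; rewrite patchE.
have [xN|xN] := boolP (x \in ~` N); last first.
  by rewrite mulr0 => _; case: ifPn => // xA; apply: f0'; exact: set_mem.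
rewrite mulr1; case: ifPn => xA; first by rewrite mem_set//; split; [exact: set_mem xA|exact: set_mem xN].
by rewrite ifN//; apply/negP => /set_mem[Ax _]; move: xA; rewrite notin_setE.
Qed.

(** The image under [al] of the measure with density [f] on [D], written as an integral over a
    preimage because [al] is measurable on [D] only. *)
Lemma push_density (D : set T) (al : T -> T) (f : T -> R) :
  measurable D -> measurable_fun D al -> measurable_fun D f -> (forall x, D x -> (0 <= f x)%R) ->
  exists m : {measure set T -> \bar R}, forall A, m A = \int[mu]_(x in D `&` al @^-1` A) (f x)%:E.
Proof.
move=> mD mal mf f0; pose m A := \int[mu]_(x in D `&` al @^-1` A) (f x)%:E.
have m0 : m set0 = 0 by rewrite /m preimage_set0 setI0 integral_set0.
have mge0 A : 0 <= m A by apply: integral_ge0 => x [Dx _]; rewrite lee_fin f0.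
have msa : semi_sigma_additive m.
  move=> F mF tF mUF; rewrite /m preimage_bigcup setI_bigcupr ge0_integral_bigcup//.
  - apply: is_cvg_nneseries => k _ _; apply: integral_ge0 => x [Dx _]; rewrite lee_fin f0//.
  - by move=> k; exact: mal.
  - apply/measurable_EFinP; apply: measurable_funS mf => //.
    by move=> x [k _ []].
  - by move=> x [k _ [Dx _]]; rewrite lee_fin f0.
  - apply/trivIsetP => i j _ _ ij; rewrite -subset0 => x [[_ Fi] [_ Fj]].
    have /trivIsetP/(_ i j Logic.I Logic.I ij) e := tF.
    by suff : set0 (al x) by []; rewrite -e; split.
pose M := isMeasure.Build _ _ _ m m0 mge0 msa.
by exists (HB.pack_for (Measure.type T R) m M).
Qed.

End NonmeasurableDomain.

Section EvenMeasures.
Variables (R : realType) (n : nat).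
Local Notation S := (@sphere R n).
Local Notation T := (borelRn R n).

Lemma even_measure_preimage (mu : {measure set T -> \bar R}) (A : set T) :
  even_measure mu -> measurable A -> mu ((-%R : 'rV[R]_n -> 'rV[R]_n) @^-1` A) = mu A.
Proof.
move=> emu mA; rewrite -[RHS](emu A mA); congr (mu _).
apply/seteqP; split => [x /= Ax|_ [x Ax <-]]; last by rewrite /= opprK.
by exists (- x); rewrite ?opprK.
Qed.

Lemma measurable_preimage_opp (A : set T) : measurable A ->
  measurable ((-%R : 'rV[R]_n -> 'rV[R]_n) @^-1` A : set T).
Proof. by move=> mA; rewrite -[X in measurable X]setTI; exact: oppv_borel. Qed.

Lemma sphere_measure_setI (mu : {measure set T -> \bar R}) (A : set T) :
  sphere_measure mu -> measurable A -> mu A = mu (A `&` S).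
Proof.
move=> smu mA; have mS := @measurable_sphere R n.
rewrite -{1}(setUIDK A S) measureU; last first.
- by apply/seteqP; split => // x [[_ Sx] [_ /(_ Sx)]].
- exact: measurableD.
- exact: measurableI.
suff e : mu (A `\` S) = 0%E by rewrite [X in (_ + X)%E]e adde0.
apply: (@subset_measure0 _ _ _ mu _ (~` S)) => //.
- exact: measurableD.
- exact: measurableC.
- exact: smu.1.
Qed.

Lemma even_integral (nu : {measure set T -> \bar R}) (A : set T) (f : T -> R) :
  even_measure nu -> measurable A -> measurable_fun A f -> (forall x, A x -> 0 <= f x) ->
  (\int[nu]_(x in (-%R : 'rV[R]_n -> 'rV[R]_n) @^-1` A) (f (- (x : 'rV[R]_n)))%:E =
   \int[nu]_(x in A) (f x)%:E)%E.
Proof.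
move=> enu mA mf f0.
have mopp := @oppv_borel R n.
have e := @ge0_integral_pushforward _ _ T T R (-%R : 'rV[R]_n -> 'rV[R]_n) mopp nu A (EFin \o f)
  mA ((measurable_EFinP _ _).2 mf) (fun x => fun xA => f0 x (set_mem xA)).
transitivity (\int[nu]_(x in (-%R : 'rV[R]_n -> 'rV[R]_n) @^-1` A) ((EFin \o f) \o (-%R : 'rV[R]_n -> 'rV[R]_n)) x)%E => //.
rewrite -e; apply: eq_measure_integral => B mB BA.
by rewrite -[RHS](even_measure_preimage enu mB).
Qed.

End EvenMeasures.

(** * Equality of the two even measures *)

Section MassIdentity.
Variables (R : realType) (n : nat).
Implicit Types (u v x y xi : 'rV[R]_n) (phi : 'rV[R]_n -> R).
Local Notation S := (@sphere R n).
Local Notation T := (borelRn R n).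
Variables (lam mu : {measure set T -> \bar R}) (G Psi : 'rV[R]_n -> R -> R) (p : 'rV[R]_n -> R).
Hypotheses (n0 : (0 < n)%N) (lamM : class_M lam) (smu : sphere_measure mu)
  (elam : even_measure lam) (emu : even_measure mu)
  (cG : class_C G) (cPsi : class_C Psi) (eG : even_fun G) (ePsi : even_fun Psi)
  (dG : forall v r, S v -> 0 < r -> dt G v r < 0)
  (dPsi : forall v r, S v -> 0 < r -> 0 < dt Psi v r)
  (gp : good p) (bp : forall x, S x -> polar (polar p) x = p x).
Hypothesis pareto : forall q, good q -> (forall x, sphere x -> polar (polar q) x = q x) ->
  ~ (energyG lam G q < energyG lam G p /\ energyPsi mu Psi q < energyPsi mu Psi p).

Local Notation w := (wulff_weight p).
Local Notation D := (regular_set p).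
Local Notation al := (gauss_map p).
Local Notation opp := (-%R : 'rV[R]_n -> 'rV[R]_n).

Definition gauss_density x : R := density G p x * dual_density Psi p (al x).
Local Notation f := gauss_density.

Lemma maximizersN x u : S x -> maximizers w x u -> maximizers w (- x) (- u).
Proof.
have gw := good_weight n0 gp; have [_ _ ew] := gw; have [a [b [a0 _ wab]]] := good_bounds gw.
move=> Sx [Su e]; split; first exact: sphereN.
by rewrite dotvNl dotvNr opprK ew// e (polN n0 a0 wab).
Qed.

Lemma regular_setN x : D x -> D (- x).
Proof.
move=> [Sx nx]; split; first exact: sphereN.
move=> [_ [u [v [mu_ mv uv]]]]; apply: nx; split => //; exists (- u), (- v); split.
- by have := maximizersN (sphereN Sx) mu_; rewrite opprK.
- by have := maximizersN (sphereN Sx) mv; rewrite opprK.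
- by move=> /oppr_inj.
Qed.

Lemma gauss_mapN x : D x -> al (- x) = - al x.
Proof.
move=> Dx; apply/esym/(gauss_map_uniq n0 gp (regular_setN Dx)).
by apply: maximizersN; [exact: Dx.1|exact: (gauss_mapP n0 gp Dx.1)].
Qed.

Lemma gauss_densityN x : D x -> f (- x) = f x.
Proof.
move=> Dx; have Sx := Dx.1; have [_ p0 ep] := gp.
rewrite /f gauss_mapN// (even_dual_density n0 cPsi ePsi gp); last exact: (sphere_gauss_map n0 gp).
by rewrite /density ep// dt_even// invr_gt0 p0.
Qed.

Lemma gauss_density_gt0 x : S x -> 0 < f x.
Proof.
move=> Sx; rewrite mulr_gt0//; first exact: (density_gt0 dG gp).
by apply: (dual_density_gt0 n0 dPsi gp); exact: (sphere_gauss_map n0 gp).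
Qed.

Let c1 : {within S, continuous (cst 1 : 'rV[R]_n -> R)}.
Proof. by move=> ?; exact: cst_continuous. Qed.

Lemma gauss_density_int : measurable_fun (D : set T) (f : T -> R) /\
  exists M, forall x, D x -> `|f x| <= M.
Proof.
have [mJ [M hM]] := J_int n0 lamM cG cPsi dPsi gp c1.
have e : (fun x => density G p x * (dual_density Psi p (al x) * cst 1 (al x))) = f.
  by apply/funext => x; rewrite /= mulr1.
by rewrite e in mJ; split => //; exists M => x Dx; have := hM x Dx; rewrite mulr1.
Qed.

(** For open [A] the symmetrised indicator is a limit of even continuous functions, to which
    [euler_lagrange] applies. Both measures are even, so each symmetrised integral is twice the
    measure of [A]; open sets are stable under intersection and generate the Borel sets. *)
Lemma mass_identity : exists2 kap, 0 < kap & forall A : set T, measurable A ->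
  mu A = (\int[lam]_(x in D `&` al @^-1` A) (kap * f x)%:E)%E.
Proof.
have mS := @measurable_sphere R n; have mD := measurable_regular n0 lamM gp.
have mal := measurable_gauss_map n0 lamM gp.
have [mf [M hM]] := gauss_density_int.
have EL := euler_lagrange n0 lamM smu cG cPsi ePsi dG dPsi gp bp pareto.
have J1 := J_one_gt0 n0 lamM cG cPsi dG dPsi gp.
set kap := fine (mu S) / _ in EL.
have kap0 : 0 < kap by rewrite divr_gt0// mass_sphere_gt0.
exists kap => //.
have mkf : measurable_fun (D : set T) ((fun x => kap * f x) : T -> R).
  by apply: measurable_funM => //; exact: measurable_cst.
have kf0 x : D x -> 0 <= kap * f x.
  by move=> Dx; rewrite mulr_ge0 ?(ltW kap0)// ltW// gauss_density_gt0//; exact: Dx.1.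
have kfM x : D x -> `|kap * f x| <= kap * M.
  by move=> Dx; rewrite normrM (gtr0_norm kap0) ler_pM2l// hM.
have [m mE] := push_density lam mD mal mkf kf0.
have ikf := bounded_integrable lamM.1.2.1 mD mkf kfM.
have mfin (A : set T) : measurable A -> m A \is a fin_num.
  move=> mA; rewrite mE; apply: integrable_fin_num.
    by apply: mal.
  by apply: (integrableS mD _ _ ikf); [exact: mal|move=> x []].
have mufin (A : set T) : measurable A -> mu A \is a fin_num.
  by move=> mA; rewrite ge0_fin_numE//; exact: finite_measureS smu.2.1 _ mA.
(* [m] is even since, on [D], the Gauss map is odd and the density is even, while [lam] is even. *)
have mN (A : set T) : measurable A -> m (opp @^-1` A) = m A.
  move=> mA; have mDA : measurable (D `&` al @^-1` A : set T) by exact: mal.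
  have sDA : D `&` al @^-1` A `<=` D by move=> x [].
  have mkfA := measurable_funS mD sDA mkf.
  have e := even_integral elam mDA mkfA (fun x Ax => kf0 x (sDA x Ax)).
  rewrite mE mE -[RHS]e.
  rewrite (_ : opp @^-1` (D `&` al @^-1` A) = D `&` al @^-1` (opp @^-1` A)); last first.
    apply/seteqP; split => x [Dx Ax].
      have Dx2 : D x by rewrite -[x]opprK; exact: regular_setN.
      split; first exact: Dx2.
      by change (A (- al x)); rewrite -(gauss_mapN Dx2); exact: Ax.
    split; first exact: regular_setN.
    by change (A (al (- x))); rewrite (gauss_mapN Dx); exact: Ax.
  apply: eq_integral => x xDA; have [Dx _] := set_mem xDA.
  by rewrite gauss_densityN.
have ind_m (A : set T) : measurable A ->
    Rintegral lam D (fun x => kap * (f x * \1_A (al x))) = fine (m A).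
  move=> mA; rewrite mE -[RHS]/(Rintegral lam (D `&` al @^-1` A) (fun x => kap * f x)).
  rewrite [RHS]Rintegral_mkcondr; apply: eq_Rintegral => x _.
  rewrite patchE indicE; have -> : (x \in al @^-1` A) = (al x \in A) by apply/idP/idP; rewrite !inE.
  by case: ifP; rewrite ?mulr1// !mulr0.
have ind_mu (A : set T) : measurable A -> Rintegral mu S \1_A = fine (mu A).
  by move=> mA; rewrite /Rintegral integral_indic// -sphere_measure_setI.
have open_eq (A : set T) : @open_sets R n A -> mu A = m A.
  move=> oA; have [phi [cphi phi01 phil]] := open_approx oA.
  have mA : measurable A by exact: open_borel.
  have mA' := measurable_preimage_opp mA.
  pose psi k u := phi k u + phi k (- u).
  pose lim u : R := \1_A u + \1_(opp @^-1` A) u.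
  have cpsi k : {within S, continuous (psi k)}.
    apply: continuous_subspaceT => u; apply: (@cvgD _ _ _ (nbhs u)); first exact: cphi.
    apply: (@cvg_comp _ _ _ opp (phi k) (nbhs u) (nbhs (- u))); [exact: opp_continuous|exact: cphi].
  have epsi k : even_on_sphere (psi k) by move=> u _; rewrite /psi opprK addrC.
  have psi2 k u : `|psi k u| <= 2.
    have /andP[? ?] := phi01 k u; have /andP[? ?] := phi01 k (- u).
    by rewrite /psi ger0_norm ?addr_ge0// -[2]/(1 + 1) lerD.
  have psil u : psi ^~ u @ \oo --> lim u.
    apply: cvgD; first exact: phil.
    have -> : \1_(opp @^-1` A) u = \1_A (- u) :> R.
      by rewrite !indicE; congr (_ %:R); apply/idP/idP; rewrite !inE.
    exact: phil.
  have [_ limI] := Rint_dominated smu.2.1 mS (fk := psi) (f := lim) (M := 2)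
    (fun k => sphere_continuous_borel mS (@subset_refl _ S) (cpsi k)) (fun k u _ => psi2 k u)
    (fun u _ => psil u).
  pose fJ k x := density G p x * (dual_density Psi p (al x) * psi k (al x)).
  have M0 x : D x -> 0 <= M by move=> Dx; exact: le_trans (hM x Dx).
  have fJb k x : D x -> `|fJ k x| <= M * 2.
    by move=> Dx; rewrite /fJ mulrA normrM ler_pM ?hM.
  have [mlJ limJ] := Rint_dominated lamM.1.2.1 mD (fk := fJ) (f := fun x => f x * lim (al x)) (M := M * 2)
    (fun k => (J_int n0 lamM cG cPsi dPsi gp (cpsi k)).1) fJb
    (fun x Dx => eq_ind_r (fun g => g @ \oo --> f x * lim (al x)) (cvgM (cvg_cst (f x)) (psil (al x)))
       (funext (fun k => mulrA (density G p x) (dual_density Psi p (al x)) (psi k (al x))))).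
  have lim2 u : `|lim u| <= 2.
    rewrite /lim !indicE; case: (_ \in _); case: (_ \in _); rewrite ?addr0 ?add0r ?normr0 ?normr1 ?ler1n//.
    by rewrite ger0_norm.
  have eqI : Rintegral mu S lim = kap * Rintegral lam D (fun x => f x * lim (al x)).
    apply: (@cvg_unique _ _ (Rintegral mu S (psi k) @[k --> \oo])) => //.
    have -> : (fun k => Rintegral mu S (psi k)) = (fun k => kap * Rintegral lam D (fJ k)).
      by apply/funext => k; rewrite EL.
    by apply: cvgM => //; exact: cvg_cst.
  have i1 (B : set T) u : `|\1_B u| <= 1 :> R.
    by rewrite indicE; case: (_ \in _); rewrite ?normr1 ?normr0.
  have lhs : Rintegral mu S lim = fine (mu A) + fine (mu A).
    rewrite (RintD smu.2.1 mS (f := \1_A) (g := \1_(opp @^-1` A)) (M := 1)); last 4 first.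
    - exact: measurable_indic.
    - exact: measurable_indic.
    - by move=> u _; exact: i1.
    - by move=> u _; exact: i1.
    by rewrite !ind_mu// even_measure_preimage.
  have mind (B : set T) : measurable B ->
      measurable_fun (D : set T) ((fun x => kap * (f x * \1_B (al x))) : T -> R).
    move=> mB; apply: measurable_funM; first exact: measurable_cst.
    apply: measurable_funM => //.
    by apply: (@measurable_comp _ _ _ T T R setT \1_B) => //; exact: measurable_indic.
  have bind (B : set T) x : D x -> `|kap * (f x * \1_B (al x))| <= kap * (M * 1).
    by move=> Dx; rewrite normrM (gtr0_norm kap0) ler_pM2l// normrM ler_pM ?hM.
  have rhs : kap * Rintegral lam D (fun x => f x * lim (al x)) = fine (m A) + fine (m A).
    rewrite -(RintZ lamM.1.2.1 mD kap (f := fun x => f x * lim (al x)) (M := M * 2)) //; last first.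
      by move=> x Dx; rewrite normrM ler_pM ?hM.
    rewrite -{2}mN// -!ind_m// -(RintD lamM.1.2.1 mD (M := kap * (M * 1))); last 4 first.
    - exact: mind.
    - exact: mind.
    - by move=> x Dx; exact: bind.
    - by move=> x Dx; exact: bind.
    by apply: eq_Rintegral => x _; rewrite /lim; ring.
  have e2 : fine (mu A) = fine (m A) by move: eqI; rewrite lhs rhs; lra.
  by rewrite -(fineK (mufin A mA)) -(fineK (mfin A mA)) e2.
move=> A mA; rewrite -mE.
apply: (@measure_unique _ R T (@open_sets R n) (fun=> setT) erefl _ _ _ mu m open_eq _ A mA).
- by move=> B C; exact: openI.
- by move=> i; exact: openT.
- by apply/seteqP; split => // x _; exists 0%N.
- by move=> k; exact: smu.2.1.
Qed.

End MassIdentity.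

(** * Convex bodies *)

Section WulffBody.
Variables (R : realType) (n : nat).
Implicit Types (u v x y xi : 'rV[R]_n).
Local Notation S := (@sphere R n).
Local Notation T := (borelRn R n).
Variable p : 'rV[R]_n -> R.
Hypotheses (n0 : (0 < n)%N) (gp : good p) (bp : forall x, S x -> polar (polar p) x = p x).
Local Notation h := (polar p).
Local Notation w := (wulff_weight p).

Definition wulff_shape : set 'rV[R]_n := [set x | forall u, S u -> dotv x u <= h u].
Local Notation K := wulff_shape.

Lemma wulff_body : convex_body_e K.
Proof.
have gh := good_polar n0 gp; have [a [b [a0 b0 hab]]] := good_bounds gh.
have nR : 0 < n%:R :> R by rewrite ltr0n.
split; last first.
  move=> x Kx u Su; have [_ _ eh] := gh.
  by rewrite dotvNl -dotvNr -eh//; apply: Kx; exact: sphereN.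
split; last split.
- apply: bounded_closed_compact.
    exists b; split; first exact: num_real.
    move=> M bM x Kx; apply: le_trans (ltW bM).
    have [->|x0] := eqVneq x 0; first by rewrite normr0 ltW.
    have [t t0 [u Su xE]] := sphere_scale x0.
    have /andP[_ hb] := hab u Su; apply: le_trans hb.
    have := Kx u Su; rewrite {1}xE dotvZl Su mulr1; apply: le_trans.
    rewrite xE normrZ (gtr0_norm t0) -[leRHS]mulr1 ler_pM2l//.
    exact: sphere_norm_le1.
  rewrite (_ : K = \bigcap_(u in S) ((fun x => dotv x u) @^-1` [set t | t <= h u])).
    apply: closed_bigI => u Su; apply: preimage_closed; last exact: closed_le.
    move=> x _; apply: (@continuous_dotv _ _ _ idfun (cst u) (nbhs x)); [exact: cvg_id|exact: cvg_cst].
  by apply/seteqP; split => x Kx u Su; exact: Kx.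
- move=> x y t Kx Ky /andP[t0 t1] u Su; rewrite dotvDl !dotvZl.
  have -> : h u = t * h u + (1 - t) * h u by ring.
  by rewrite lerD// ler_wpM2l ?subr_ge0 ?Kx ?Ky.
- apply/nbhs_ballP; exists (a / n%:R) => /=; first by rewrite divr_gt0.
  move=> x; rewrite -ball_normE /= sub0r normrN => xa u Su.
  have /andP[ha _] := hab u Su; apply: le_trans ha.
  apply: le_trans (ler_norm _) _; apply: le_trans (dotv_norm_le _ Su) _.
  by rewrite -ler_pdivlMl// mulrC ltW.
Qed.

(** The gauge of the Wulff shape is [pol S (1/h)], which is [p] by the bipolar hypothesis. *)
Lemma wulff_shape_scale x t : S x -> 0 <= t -> K (t *: x) <-> t * p x <= 1.
Proof.
move=> Sx t0; have [_ h0 _] := good_polar n0 gp; have gw := good_weight n0 gp.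
split => [Kx|tp u Su].
  have [->|t_neq0] := eqVneq t 0; first by rewrite mul0r.
  have tp : 0 < t by rewrite lt0r t_neq0.
  rewrite -(bp Sx) -ler_pdivlMl// mulr1; apply: (good_pol_le n0 gw) => u Su.
  rewrite -[t^-1]mulr1 ler_pdivlMl// mulrA -dotvZl ler_pdivrMr ?h0// mul1r.
  exact: Kx.
rewrite dotvZl -[h u]mul1r -ler_pdivrMr ?h0// -mulrA.
apply: le_trans tp; apply: ler_wpM2l => //.
by rewrite -(bp Sx); exact: (good_pol_ub n0 _ gw).
Qed.

Lemma radial_wulff x : S x -> radial_fun K x = (p x)^-1.
Proof.
move=> Sx; have [_ p0 _] := gp; have px := p0 x Sx.
have pV : 0 <= (p x)^-1 by rewrite invr_ge0 ltW.
have mem : [set t : R | 0 <= t /\ K (t *: x)] (p x)^-1.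
  by split => //; apply/(wulff_shape_scale Sx pV); rewrite mulVf// gt_eqF.
have ub : ubound [set t : R | 0 <= t /\ K (t *: x)] (p x)^-1.
  by move=> t [t0 /(wulff_shape_scale Sx t0)]; rewrite -ler_pdivlMr// mul1r.
apply/eqP; rewrite eq_le; apply/andP; split.
  by apply: ge_sup => //; exists (p x)^-1.
by apply: sup_upper_bound => //; split; exists (p x)^-1.
Qed.

Lemma supp_wulff u : S u -> supp_fun K u = h u.
Proof.
move=> Su; have [_ p0 _] := gp.
have ub : ubound [set dotv u y | y in K] (h u).
  by move=> _ [y Ky <-]; rewrite dotvC; exact: Ky.
have mem x : S x -> [set dotv u y | y in K] (dotv u x * (p x)^-1).
  move=> Sx; exists ((p x)^-1 *: x); last by rewrite dotvZr mulrC.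
  have px := p0 x Sx; have pV : 0 <= (p x)^-1 by rewrite invr_ge0 ltW.
  by apply/(wulff_shape_scale Sx pV); rewrite mulVf// gt_eqF.
have hs : has_sup [set dotv u y | y in K].
  by split; [exists (dotv u u * (p u)^-1); exact: mem|exists (h u)].
apply/eqP; rewrite eq_le; apply/andP; split; first by apply: ge_sup => //; exact: hs.1.
by apply: (good_pol_le n0 (good_inv gp)) => x Sx; apply: sup_upper_bound => //; exact: mem.
Qed.

Lemma normals_wulff x : S x -> normals K x = maximizers w x.
Proof.
move=> Sx; have [_ p0 _] := gp; have [_ h0 _] := good_polar n0 gp; have px := p0 x Sx.
rewrite /normals radial_wulff// /maximizers (_ : pol S w x = p x); last exact: bp.
have px0 : p x != 0 by rewrite gt_eqF.
apply/seteqP; split => u [Su e]; split => //; have hu0 : h u != 0 by rewrite gt_eqF// h0.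
  rewrite supp_wulff// dotvZr dotvC in e.
  have -> : dotv x u = p x * h u by rewrite -e mulVKf.
  by rewrite /wulff_weight mulfK.
rewrite supp_wulff// dotvZr dotvC.
have -> : dotv x u = p x * h u by rewrite -e mulfVK.
by rewrite mulKf.
Qed.

Lemma radial_gauss_wulff x : S x -> radial_gauss K x = gauss_map p x.
Proof. by move=> Sx; rewrite /radial_gauss normals_wulff. Qed.

Variables (lam mu : {measure set T -> \bar R}) (G Psi : 'rV[R]_n -> R -> R).
Hypotheses (lamM : class_M lam) (smu : sphere_measure mu)
  (elam : even_measure lam) (emu : even_measure mu)
  (cG : class_C G) (cPsi : class_C Psi) (eG : even_fun G) (ePsi : even_fun Psi)
  (dG : forall v r, S v -> 0 < r -> dt G v r < 0)
  (dPsi : forall v r, S v -> 0 < r -> 0 < dt Psi v r).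
Hypothesis pareto : forall q, good q -> (forall x, sphere x -> polar (polar q) x = q x) ->
  ~ (energyG lam G q < energyG lam G p /\ energyPsi mu Psi q < energyPsi mu Psi p).
Local Notation D := (regular_set p).
Local Notation al := (gauss_map p).
Local Notation f := (gauss_density G Psi p).

(** The sign [s] allows [Psi' = Psi] as well as the decreasing [Psi' = - Psi]. *)
Lemma Ctilde_wulff (Psi' : 'rV[R]_n -> R -> R) (s : bool) (A : set T) :
  (forall u t, S u -> 0 < t -> dt Psi' u t = (-1) ^+ s * dt Psi u t) ->
  Ctilde G Psi' lam K A =
    ((- (-1) ^+ s)%:E * \int[lam]_(x in D `&` al @^-1` A) (f x)%:E)%E.
Proof.
move=> sP; have gh := good_polar n0 gp; have [_ h0 _] := gh; have [_ p0 _] := gp.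
have [mN N0] := regular_null n0 lamM gp.
pose Z := rev_radial_gauss K A.
have ZS : Z `<=` S by move=> x [].
(* Off the singular set the normal is unique, so the reverse image is a preimage under the Gauss
   map, which is measurable when [A] is. *)
have DZ : Z `\` singular w = D `&` al @^-1` A.
  apply/seteqP; split => [x [[Sx [u [nu Au]]] ns]|x [Dx Ax]].
    have Dx : D x by split.
    split => //; rewrite normals_wulff// in nu.
    by change (A (al x)); rewrite -(gauss_map_uniq n0 gp Dx nu).
  have Sx := Dx.1; split; last exact: Dx.2.
  split => //; exists (al x); split => //.
  by rewrite normals_wulff//; exact: (gauss_mapP n0 gp).
have fZ x : Z x -> (0 <= (f x)%:E)%E.
  by move=> /ZS Sx; rewrite lee_fin ltW// (gauss_density_gt0 n0 dG dPsi gp).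
rewrite /Ctilde -/Z.
transitivity (\int[lam]_(x in Z) ((- (-1) ^+ s) * f x)%:E)%E.
  apply: eq_integral => x /set_mem/ZS Sx; congr (_%:E).
  have Sal := sphere_gauss_map n0 gp Sx.
  rewrite radial_wulff// radial_gauss_wulff// supp_wulff// sP ?h0//.
  rewrite /gauss_density /density /dual_density.
  have P0 := dPsi Sal (h0 _ Sal); have H0 := h0 _ Sal; have X0 := p0 _ Sx.
  by case: s sP => _; rewrite ?expr1 ?expr0; field; rewrite ?gt_eqF.
rewrite -DZ -(ge0_integral_setD_null mN N0 fZ).
case: s {sP} => /=; rewrite ?expr1 ?expr0 ?opprK.
  by rewrite mul1e; apply: eq_integral => x _; rewrite mul1r.
rewrite EFinN mulN1e -integral_ge0N//.
by apply: eq_integral => x _; rewrite mulN1r EFinN.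
Qed.

Lemma normalized_wulff (Psi' : 'rV[R]_n -> R -> R) (s : bool) :
  (forall u t, S u -> 0 < t -> dt Psi' u t = (-1) ^+ s * dt Psi u t) ->
  normalized_eq G Psi' lam mu K.
Proof.
move=> sP; have mS := @measurable_sphere R n.
have mD := measurable_regular n0 lamM gp; have mal := measurable_gauss_map n0 lamM gp.
have [kap kap0 muE] := mass_identity n0 lamM smu elam emu cG cPsi eG ePsi dG dPsi gp bp pareto.
have [mf [M hM]] := gauss_density_int n0 lamM cG cPsi dPsi gp.
pose m (A : set T) := (\int[lam]_(x in D `&` al @^-1` A) (f x)%:E)%E.
have f0 x : D x -> 0 <= f x by move=> Dx; rewrite ltW// (gauss_density_gt0 n0 dG dPsi gp)//; exact: Dx.1.
have mfin (A : set T) : measurable A -> m A \is a fin_num.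
  move=> mA; apply: integrable_fin_num; first exact: mal.
  apply: (integrableS mD _ _ (bounded_integrable lamM.1.2.1 mD mf hM)); first exact: mal.
  by move=> x [].
have muE' (A : set T) : measurable A -> mu A = (kap%:E * m A)%E.
  move=> mA; rewrite muE// /m -ge0_integralZl_EFin//.
  - exact: mal.
  - by move=> x [Dx _]; rewrite lee_fin f0.
  - apply/measurable_EFinP; apply: (measurable_funS mD _ mf) => x [] //.
  - exact: ltW.
have fmu (A : set T) : measurable A -> fine (mu A) = kap * fine (m A).
  by move=> mA; rewrite muE'// fineM// mfin.
have mSp : 0 < fine (m S).
  by have := mass_sphere_gt0 smu; rewrite fmu// pmulr_rgt0.
have s0 : - (-1) ^+ s != 0 :> R by rewrite oppr_eq0 signr_eq0.
have CE (A : set T) : measurable A -> Ctilde G Psi' lam K A = (- (-1) ^+ s * fine (m A))%:E.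
  by move=> mA; rewrite (Ctilde_wulff A sP) EFinM fineK// mfin.
split; first by rewrite CE.
split; first by rewrite CE// eqe mulf_neq0// gt_eqF.
move=> A mA AS; rewrite !CE//; split => //=.
(* The sign [s] and the factor [kap] cancel in the normalised quotients. *)
by rewrite !fmu// -!mulf_div (divff s0) divff ?mul1r// gt_eqF.
Qed.

End WulffBody.

(** * Arbitrary convex bodies and the necessity of non-concentration *)

Section ConvexBodies.
Variables (R : realType) (n : nat).
Implicit Types (u v x y z xi : 'rV[R]_n) (K : set 'rV[R]_n).
Local Notation S := (@sphere R n).
Local Notation T := (borelRn R n).
Hypothesis n0 : (0 < n)%N.

Lemma dotv_norm_mul x y : `|dotv x y| <= n%:R * (`|x| * `|y|).
Proof.
apply: le_trans (ler_norm_sum _ _ _) _.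
apply: (@le_trans _ _ (\sum_(i < n) `|x| * `|y|)); last by rewrite sumr_const card_ord mulr_natl.
by apply: ler_sum => i _; rewrite normrM ler_pM// norm_coord_le.
Qed.

Lemma dotv_sqB x y t :
  dotv (x - t *: y) (x - t *: y) = dotv x x - 2 * (t * dotv x y) + t * (t * dotv y y).
Proof. by rewrite dotvBl !dotvBr !dotvZl !dotvZr (dotvC y x); ring. Qed.

(** The separating normal points from the nearest point [z] of [K] to [y]: a point of [K] beyond the
    hyperplane through [z] would allow moving closer to [y]. *)
Lemma convex_separation K y : compact K -> Defs.convex_set K -> K !=set0 -> ~ K y ->
  exists2 u, S u & exists2 s, s < dotv u y & forall x, K x -> dotv u x <= s.
Proof.
move=> cK convK K0 nKy.
have cd : {within K, continuous (fun x => dotv (y - x) (y - x))}.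
  apply: continuous_subspaceT => x.
  by apply: (@continuous_dotv _ _ _ (fun x => y - x) (fun x => y - x) (nbhs x));
    apply: (@cvgB _ _ _ (nbhs x)); [exact: cvg_cst|exact: cvg_id|exact: cvg_cst|exact: cvg_id].
have [z /set_mem Kz zmin] := compact_EVT_min K0 cK cd.
pose e := y - z.
have e0 : e != 0 by rewrite subr_eq0; apply/eqP => yz; apply: nKy; rewrite yz.
have ez x : K x -> dotv e (x - z) <= 0.
  move=> Kx; rewrite leNgt; apply/negP => c0.
  set c := dotv e (x - z) in c0; pose d := dotv (x - z) (x - z).
  have d0 : 0 <= d by exact: dotvv_ge0.
  have cd0 : 0 < c + d by rewrite ltr_pwDl.
  (* The denominator [c + d] keeps [t <= 1] and gives [t * d = c - t * c], so the squared distance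
     drops by [t * c + t * (t * c)]. *)
  pose t := c / (c + d).
  have t0 : 0 < t by rewrite divr_gt0.
  have t1 : t <= 1 by rewrite ler_pdivrMr// mul1r lerDl.
  have td : t * (c + d) = c by rewrite /t mulfVK// gt_eqF.
  have Kt : K (t *: x + (1 - t) *: z) by apply: convK => //; rewrite (ltW t0).
  have := zmin _ (mem_set Kt).
  have -> : y - (t *: x + (1 - t) *: z) = e - t *: (x - z).
    by rewrite /e scalerBl scale1r scalerBr; apply/rowP => i; rewrite !mxE; ring.
  rewrite dotv_sqB -/e -/c -/d.
  have : 0 < t * c by rewrite mulr_gt0.
  have e2 : t * (t * d) = t * c - t * (t * c) by rewrite -[in X in X - _]td; ring.
  have : 0 < t * (t * c) by rewrite mulr_gt0// mulr_gt0.
  by rewrite e2; lra.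
have [s s0 [u Su es]] := sphere_scale e0.
exists u => //; exists (dotv u z).
  have : 0 < dotv u e by rewrite es dotvZr Su mulr1.
  by rewrite /e dotvBr subr_gt0.
move=> x Kx; have := ez x Kx; rewrite es dotvZl pmulr_rle0// dotvBr subr_le0.
exact.
Qed.

Section OneBody.
Variables (K : set 'rV[R]_n).
Hypothesis bK : convex_body_o K.

Lemma body_bounds : exists a b, [/\ 0 < a, 0 < b,
  forall u, S u -> a <= supp_fun K u <= b &
  forall u, S u -> a <= radial_fun K u <= b].
Proof.
have [cK [convK iK]] := bK; have nR : 0 < n%:R :> R by rewrite ltr0n.
have [r r0 hr] : exists2 r, 0 < r & ball 0 r `<=` K by have /nbhs_ballP[r r0 hr] := iK; exists r.
have [M [_ hM]] := compact_bounded cK; pose B := `|M| + 1.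
have B0 : 0 < B by rewrite ltr_wpDl.
have KB y : K y -> `|y| <= B by apply: hM; rewrite ltr_pwDr// ler_norm.
pose b := n%:R * B; have b0 : 0 < b by rewrite mulr_gt0.
have Kr u : S u -> K ((r / 2) *: u).
  move=> Su; apply: hr; rewrite -ball_normE /= sub0r normrN normrZ gtr0_norm ?divr_gt0//.
  apply: le_lt_trans (_ : r / 2 * 1 < r); last by lra.
  by rewrite ler_pM2l ?divr_gt0// sphere_norm_le1.
exists (r / 2), b; split; rewrite ?divr_gt0// => u Su.
  have ub : ubound [set dotv u y | y in K] b.
    move=> _ [y Ky <-]; rewrite dotvC; apply: le_trans (ler_norm _) _.
    by apply: le_trans (dotv_norm_le _ Su) _; rewrite ler_pM2l// KB.
  have mem : [set dotv u y | y in K] (r / 2).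
    by exists ((r / 2) *: u); [exact: Kr|rewrite dotvZr Su mulr1].
  apply/andP; split; last by apply: ge_sup => //; exists (r / 2).
  by apply: sup_upper_bound => //; split; [exists (r / 2)|exists b].
have ub : ubound [set t : R | 0 <= t /\ K (t *: u)] b.
  move=> t [t0 Kt]; have -> : t = dotv (t *: u) u by rewrite dotvZl Su mulr1.
  apply: le_trans (ler_norm _) _.
  by apply: le_trans (dotv_norm_le _ Su) _; rewrite ler_pM2l// KB.
have mem : [set t : R | 0 <= t /\ K (t *: u)] (r / 2).
  by split; [rewrite ltW ?divr_gt0|exact: Kr].
apply/andP; split; last by apply: ge_sup => //; exists (r / 2).
by apply: sup_upper_bound => //; split; [exists (r / 2)|exists b].
Qed.

Lemma supp_has_sup u : has_sup [set dotv u y | y in K].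
Proof.
have [cK [_ iK]] := bK; have [M [_ hM]] := compact_bounded cK.
split; first by exists (dotv u 0); exists 0 => //; exact: nbhs_singleton iK.
exists (n%:R * (`|u| * (`|M| + 1))) => _ [y Ky <-].
apply: le_trans (ler_norm _) _; apply: le_trans (dotv_norm_mul _ _) _.
rewrite ler_wpM2l// ler_wpM2l//; apply: hM => //.
by rewrite ltr_pwDr// ler_norm.
Qed.

Lemma supp_ub u y : K y -> dotv u y <= supp_fun K u.
Proof. by move=> Ky; apply: sup_upper_bound; [exact: supp_has_sup|exists y]. Qed.

Lemma continuous_supp : {within S, continuous (supp_fun K)}.
Proof.
have [cK _] := bK; have [M [_ hM]] := compact_bounded cK.
pose B := n%:R * (`|M| + 1); have B0 : 0 < B + 1.
  by rewrite ltr_wpDl// mulr_ge0// addr_ge0.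
have lip u v : supp_fun K u <= supp_fun K v + (B + 1) * `|u - v|.
  apply: ge_sup; first exact: (supp_has_sup u).1.
  move=> _ [y Ky <-]; have -> : dotv u y = dotv v y + dotv (u - v) y by rewrite dotvBl; ring.
  rewrite lerD ?supp_ub//; apply: le_trans (ler_norm _) _.
  apply: le_trans (dotv_norm_mul _ _) _; rewrite mulrCA mulrC ler_wpM2r//.
  apply: (@le_trans _ _ B); last by rewrite lerDl.
  by rewrite ler_wpM2l// hM// ltr_pwDr// ler_norm.
apply: continuous_subspaceT => u.
apply/(@cvgrPdist_le _ _ _ (nbhs u) (nbhs_filter u)) => e e0.
apply/nbhs_ballP; exists (e / (B + 1)) => /=; first by rewrite divr_gt0.
move=> v; rewrite -ball_normE /= ltr_pdivlMr// mulrC => uv.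
have := lip u v; have := lip v u; rewrite (distrC v u) ler_norml; move: uv; lra.
Qed.

(** The slack [g u] between the support function and the boundary point is nonnegative and has a
    minimum over the sphere. If the minimum were positive, a slightly larger multiple of the
    boundary point could not be separated from [K]. *)
Lemma normals_nonempty x : S x -> normals K x !=set0.
Proof.
move=> Sx; have [cK [convK iK]] := bK.
have [a [b [a0 b0 hab rab]]] := body_bounds.
have K0 : K !=set0 by exists 0; exact: nbhs_singleton iK.
set rho := radial_fun K x; have /andP[ra rb] := rab x Sx.
have r0 : 0 < rho := lt_le_trans a0 ra.
pose g u := supp_fun K u - dotv u (rho *: x).
have g0 u : S u -> 0 <= g u.
  move=> Su; rewrite subr_ge0 dotvZr mulrC.
  have /andP[ha _] := hab u Su; have h0 := lt_le_trans a0 ha.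
  have [ux|ux] := leP (dotv u x) 0.
    by rewrite (le_trans _ (ltW h0))// mulr_le0_ge0// ltW.
  rewrite mulrC -ler_pdivlMr//; apply: ge_sup.
    exists 0; split => //; rewrite scale0r; exact: nbhs_singleton iK.
  by move=> t [t0 Kt]; rewrite ler_pdivlMr// -dotvZr supp_ub.
have cg : {within S, continuous g}.
  apply/subspace_continuousP => u Su; apply: cvgB.
    exact: ((subspace_continuousP _ _).1 continuous_supp u Su).
  by apply: (@continuous_dotv _ _ _ idfun (cst (rho *: x))); [exact: cvg_within|exact: cvg_cst].
have [u /set_mem Su umin] := compact_EVT_min (sphere_nonempty R n0) (@compact_sphere R n) cg.
exists u; split => //; apply/eqP; rewrite eq_sym -subr_eq0 -/(g u) eq_le g0// andbT.
rewrite leNgt; apply/negP => gu.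
(* The enlargement changes every pairing by at most [g u / 2], so the separating direction would
   have slack below the minimum. *)
pose t := g u / (2 * rho).
have t0 : 0 < t by rewrite divr_gt0 ?mulr_gt0.
have nK : ~ K ((1 + t) *: (rho *: x)).
  rewrite scalerA => Kt; have : (1 + t) * rho <= rho.
    apply: sup_upper_bound => //; last by split => //; rewrite mulr_ge0 ?addr_ge0 ?ltW.
    split; first by exists 0; split => //; rewrite scale0r; exact: nbhs_singleton iK.
    exists (n%:R * (`|projT1 (cid (compact_bounded cK))| + 1)) => s [s0 Ks].
    have -> : s = dotv (s *: x) x by rewrite dotvZl Sx mulr1.
    apply: le_trans (ler_norm _) _; apply: le_trans (dotv_norm_le _ Sx) _.
    rewrite ler_wpM2l//; case: cid => M /= [_ hM]; apply: hM => //.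
    by rewrite ltr_pwDr// ler_norm.
  by rewrite mulrDl mul1r gerDl leNgt mulr_gt0.
have [v Sv [s sv hs]] := convex_separation cK convK K0 nK.
have hv : supp_fun K v <= s by apply: ge_sup; [exact: (supp_has_sup v).1|move=> _ [y Ky <-]; exact: hs].
have := umin v (mem_set Sv); rewrite {2}/g leNgt => /negP; apply.
have : t * dotv v (rho *: x) <= g u / 2.
  have -> : g u / 2 = t * rho by rewrite /t; field; rewrite gt_eqF.
  rewrite dotvZr ler_pM2l// -[leRHS]mulr1 ler_pM2l//.
  exact: dotv_sphere_le1.
move: hv sv; rewrite dotvZr mulrDl mul1r; lra.
Qed.

End OneBody.

Lemma Ctilde_lt0 K (lam : {measure set T -> \bar R}) (G Psi : 'rV[R]_n -> R -> R) v :
  convex_body_o K -> class_C G -> class_C Psi ->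
  (forall v r, S v -> 0 < r -> dt G v r < 0) ->
  (forall v r, S v -> 0 < r -> 0 < dt Psi v r) ->
  positive_on_open lam -> S v -> (Ctilde G Psi lam K (S `\` great_subsphere v) < 0)%E.
Proof.
move=> bK cG cPsi dG dPsi lampos Sv.
have [a [b [a0 b0 hab rab]]] := body_bounds bK.
have nR : 0 < n%:R :> R by rewrite ltr0n.
have rgP x : S x -> normals K x (radial_gauss K x).
  move=> Sx; have [u nu] := normals_nonempty bK Sx.
  by rewrite /radial_gauss; case: xgetP => [z _ //|/(_ u)].
have cNG : continuousC (fun u t => - dt G u t).
  apply/subspace_continuousP => z Sz; apply: cvgN.
  exact: ((subspace_continuousP _ _).1 cG.2.2 z Sz).
have [c1 c10 h1] := continuousC_lbound (a := a) b cNG a0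
  (fun u s Su s0 => etrans (oppr_gt0 _) (dG u s Su s0)).
have [c2 c20 h2] := continuousC_bounded b cPsi.2.2 a0.
(* A lower bound for minus the integrand on the sphere, from [a <= rho], [c1 <= -dt G], [h <= b] and
   [dt Psi <= c2 + 1]. *)
pose c := a * c1 / (b * (c2 + 1)).
have c21 : 0 < c2 + 1 by rewrite ltr_wpDl.
have c0 : 0 < c by rewrite divr_gt0 ?mulr_gt0.
(* A normal [u] at direction [x] has [u . x = h u / rho x >= a / b]. If [u] were orthogonal to [v],
   this pairing would equal [|(v - x) . u|], which is less than [a / b] within distance [d] of
   [v]. *)
pose d := a / b / n%:R; have d0 : 0 < d by rewrite !divr_gt0.
pose A := rev_radial_gauss K (S `\` great_subsphere v).
pose U := ball v d `&` S.
have UA : U `<=` A.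
  move=> x [vx Sx]; split => //; exists (radial_gauss K x); split; first exact: rgP.
  have [Su e] := rgP x Sx; set u := radial_gauss K x in Su e *.
  split => // -[_ vu].
  have /andP[ra rb] := rab x Sx; have /andP[ha hb] := hab u Su.
  have r0 := lt_le_trans a0 ra.
  have ux : a / b <= dotv u x.
    rewrite ler_pdivrMr// (le_trans ha)// -e dotvZr mulrC.
    apply: ler_wpM2l => //; rewrite -(pmulr_rge0 _ r0) -dotvZr e.
    exact: le_trans (ltW a0) ha.
  have : `|dotv (v - x) u| < a / b.
    apply: le_lt_trans (dotv_norm_le _ Su) _.
    by move: vx; rewrite -ball_normE /= /d ltr_pdivlMr// mulrC.
  rewrite dotvBl vu sub0r normrN (dotvC x u) => h.
  by have := lt_le_trans (le_lt_trans (ler_norm _) h) ux; rewrite ltxx.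
pose H x := radial_fun K x * dt G x (radial_fun K x) /
      (supp_fun K (radial_gauss K x) *
       dt Psi (radial_gauss K x) (supp_fun K (radial_gauss K x))).
have HS x : S x -> c <= - H x.
  move=> Sx; have [Su _] := rgP x Sx; have /andP[ra rb] := rab x Sx; have /andP[ha hb] := hab _ Su.
  have h0 := lt_le_trans a0 ha; have r0 := lt_le_trans a0 ra.
  have P0 := dPsi _ _ Su h0.
  rewrite /H -mulNr -mulrN /c ler_pdivlMr ?mulr_gt0//.
  have g1 := h1 x _ Sx (rab x Sx).
  have p1 : dt Psi (radial_gauss K x) (supp_fun K (radial_gauss K x)) <= c2 + 1.
    by rewrite (le_trans (ler_norm _))// (le_trans (h2 _ _ Su (hab _ Su)))// lerDl.
  apply: (@le_trans _ _ (a * c1)); last first.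
    by apply: ler_pM => //; [exact: ltW|exact: ltW].
  rewrite mulrAC ler_pdivrMr ?mulr_gt0// ler_pM2l ?mulr_gt0//.
  by apply: ler_pM => //; exact: ltW.
have AS x : A x -> S x by case.
have cH x : A x -> (0 <= (- H x)%:E)%E.
  by move=> /AS Sx; rewrite lee_fin (le_trans (ltW c0))// HS.
have mU : measurable (U : set T).
  by apply: measurableI; [apply: open_borel; exact: ball_open|exact: measurable_sphere].
have lU : (0 < lam U)%E.
  by apply: lampos; [exact: ball_open|exists v; split => //; exact: ballxx].
have -> : Ctilde G Psi lam K (S `\` great_subsphere v) = (- \int[lam]_(x in A) (- H x)%:E)%E.
  rewrite -integral_ge0N//; apply: eq_integral => x _.
  by rewrite EFinN oppeK.
rewrite oppe_lt0; apply: (@lt_le_trans _ _ (\int[lam]_(x in U) (cst c%:E) x)%E).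
  by rewrite integral_cst// mule_gt0// lte_fin.
(* The domain [A] need not be measurable; it contains the measurable cap [U], which [lam]
   charges. *)
apply: le_integral_nonmeasurable => // [x _|x]; first by rewrite lee_fin ltW.
rewrite !patchE; case: ifPn => [/set_mem Ux|_].
  by rewrite mem_set ?lee_fin ?HS//; [exact: Ux.2|exact: UA].
by case: ifPn => // /set_mem/cH.
Qed.

Lemma not_concentrated_of_normalized K (lam mu : {measure set T -> \bar R})
    (G Psi : 'rV[R]_n -> R -> R) :
  convex_body_o K -> class_C G -> class_C Psi ->
  (forall v r, S v -> 0 < r -> dt G v r < 0) ->
  (forall v r, S v -> 0 < r -> 0 < dt Psi v r) ->
  positive_on_open lam -> normalized_eq G Psi lam mu K -> not_concentrated mu.
Proof.
move=> bK cG cPsi dG dPsi lampos [finS [S0 eq_om]] v Sv.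
have mV : measurable (S `\` great_subsphere v : set T).
  apply: measurableD; first exact: measurable_sphere.
  apply: closed_borel; rewrite (_ : great_subsphere v = S `&` dotv v @^-1` [set 0]) //.
  apply: closed_within_preimage; [exact: closed_sphere|exact: closed_eq|].
  apply: continuous_subspaceT => x.
  by apply: (@continuous_dotv _ _ _ (cst v) idfun (nbhs x)); [exact: cvg_cst|exact: cvg_id].
have VS : S `\` great_subsphere v `<=` S by move=> x [].
have [finV e] := eq_om _ mV VS.
have CV := Ctilde_lt0 bK cG cPsi dG dPsi lampos Sv.
rewrite lt0e measure_ge0 andbT; apply/eqP => m0; move: e; rewrite m0 mul0r => /esym/eqP.
rewrite mulf_eq0 invr_eq0 !fine_eq0// (negbTE S0) orbF => /eqP C0.
by move: CV; rewrite C0 ltxx.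
Qed.

End ConvexBodies.

(** * Assembling existence and necessity *)

Section Existence.
Variables (R : realType) (n : nat).
Local Notation S := (@sphere R n).
Local Notation T := (borelRn R n).

Lemma diverges_at0 (G : 'rV[R]_n -> R -> R) :
  (forall u, S u -> G u t @[t --> 0^'+] --> +oo) ->
  forall u, S u -> forall M, exists2 s, 0 < s & M <= G u s.
Proof.
move=> h u Su M; have /cvgryPge/(_ M) hM := h u Su.
have pos : \forall t \near (0 : R)^'+, 0 < t by exact: nbhs_right_gt.
by have [s [s0 Ms]] := filter_ex (filterI pos hM); exists s.
Qed.

Lemma diverges_at_infty (Psi : 'rV[R]_n -> R -> R) :
  (forall u, S u -> Psi u t @[t --> +oo] --> +oo) ->
  forall u, S u -> forall M, exists2 s, 0 < s & M <= Psi u s.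
Proof.
move=> h u Su M; have /cvgryPge/(_ M) hM := h u Su.
have pos : \forall t \near (+oo : set_system R), 0 < t by exact: nbhs_pinfty_gt.
by have [s [s0 Ms]] := filter_ex (filterI pos hM); exists s.
Qed.

Lemma dt_opp (Psi : 'rV[R]_n -> R -> R) u t : class_C Psi -> S u -> 0 < t ->
  dt (fun v s => - Psi v s) u t = - dt Psi u t.
Proof. by move=> [dP _] Su t0; rewrite /dt !derive1E deriveN//; exact: dP. Qed.

Lemma class_C_opp (Psi : 'rV[R]_n -> R -> R) : class_C Psi -> class_C (fun u t => - Psi u t).
Proof.
move=> cP; have [dP [c1 c2]] := cP; split; last split.
- by move=> u t Su t0; apply: derivableN; exact: dP.
- apply/subspace_continuousP => z Sz; apply: cvgN.
  exact: ((subspace_continuousP _ _).1 c1 z Sz).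
- apply: (@subspace_eq_continuous _ _ _ (fun z => - dt Psi z.1 z.2)).
    by move=> z /set_mem[Su t0]; apply/esym; exact: dt_opp.
  apply/subspace_continuousP => z Sz; apply: cvgN.
  exact: ((subspace_continuousP _ _).1 c2 z Sz).
Qed.

Lemma coercive_existence (lam mu : {measure set T -> \bar R}) (G Psi Psi' : 'rV[R]_n -> R -> R)
    (s : bool) : (0 < n)%N -> class_M lam -> sphere_measure mu ->
  even_measure lam -> even_measure mu -> class_C G -> class_C Psi -> even_fun G -> even_fun Psi ->
  (forall v r, S v -> 0 < r -> dt G v r < 0) ->
  (forall v r, S v -> 0 < r -> 0 < dt Psi v r) -> coercive lam mu G Psi ->
  (forall u t, S u -> 0 < t -> dt Psi' u t = (-1) ^+ s * dt Psi u t) ->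
  exists K0 : set 'rV[R]_n, convex_body_e K0 /\ normalized_eq G Psi' lam mu K0.
Proof.
move=> n0 lamM smu elam emu cG cPsi eG ePsi dG dPsi co sP.
have [p [gp bp pareto]] := pareto_exists n0 lamM.1 smu cG cPsi dG co.
exists (wulff_shape p); split; first exact: wulff_body.
exact: (normalized_wulff n0 gp bp lamM smu elam emu cG cPsi eG ePsi dG dPsi pareto sP).
Qed.

End Existence.

Theorem theorem6p3 (R : realType) (n : nat) (n_ge2 : (2 <= n)%N)
    (lam : {measure set borelRn R n -> \bar R})
    (G Psi : 'rV[R]_n -> R -> R) :
  class_M lam -> even_measure lam -> not_concentrated lam ->
  class_C G -> class_C Psi -> even_fun G -> even_fun Psi ->
  let case_i :=
    (class_CI Psi /\ (forall u, sphere u -> Psi u t @[t --> +oo] --> +oo) /\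
       class_Gd G) \/
    (class_Cd G /\ (forall u, sphere u -> G u t @[t --> 0^'+] --> +oo) /\
       class_GI Psi) in
  (* (i), existence *)
  (case_i ->
   forall mu : {measure set borelRn R n -> \bar R},
     sphere_measure mu -> even_measure mu -> not_concentrated mu ->
     exists K0 : set 'rV[R]_n,
       convex_body_e K0 /\ normalized_eq G Psi lam mu K0) /\
  (* (i), necessity of the non-concentration condition *)
  (case_i -> positive_on_open lam ->
   forall mu : {measure set borelRn R n -> \bar R},
     sphere_measure mu -> even_measure mu ->
     (exists K0 : set 'rV[R]_n,
        convex_body_e K0 /\ normalized_eq G Psi lam mu K0) ->
     not_concentrated mu) /\
  (* (ii) *)
  (class_Cd Psi -> class_Gd G ->
   forall mu : {measure set borelRn R n -> \bar R},
     sphere_measure mu -> even_measure mu -> not_concentrated mu ->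
     vanishes_on_great_subspheres mu ->
     exists K0 : set 'rV[R]_n,
       convex_body_e K0 /\ normalized_eq G Psi lam mu K0).
Proof.
move=> lamM elam nclam cG cPsi eG ePsi case_i.
have n0 : (0 < n)%N by exact: ltn_trans n_ge2.
have signs : case_i -> (forall v r, sphere v -> 0 < r -> dt G v r < 0) /\
    (forall v r, sphere v -> 0 < r -> 0 < dt Psi v r).
  by case=> [[[_ dPsi] [_ [_ [_ [dG _]]]]]|[[_ dG] [_ [_ [_ [dPsi _]]]]]].
split; [|split].
- move=> ci mu smu emu ncmu; have [dG dPsi] := signs ci.
  apply: (@coercive_existence _ _ _ _ _ Psi _ false) => //; last first.
    by move=> u t _ _; rewrite expr0 mul1r.
  case: ci => [[_ [iPsi [_ [G0 [_ [iG _]]]]]]|[_ [iG [_ [P0 [_ [_ iPsi]]]]]]].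
    apply: coercive_infty_pos => //; first exact: lamM.1.
      exact: diverges_at0.
    exact: diverges_at_infty.
  apply: coercive_pos_infty => //; first exact: lamM.1.
    exact: diverges_at0.
  exact: diverges_at_infty.
- move=> ci lampos mu smu emu [K0 [bK0 nK0]]; have [dG dPsi] := signs ci.
  exact: (not_concentrated_of_normalized n0 bK0.1 cG cPsi dG dPsi lampos nK0).
- move=> [_ dPsi] [_ [G0 [dG [iG _]]]] mu smu emu ncmu vmu.
  have dPsi' v r : sphere v -> 0 < r -> 0 < dt (fun u t => - Psi u t) v r.
    by move=> Sv r0; rewrite dt_opp// oppr_gt0 dPsi.
  have cPsi' := class_C_opp cPsi.
  (* The energies use the increasing function [-Psi]; the change of sign disappears in the
     normalised identity. *)
  apply: (@coercive_existence _ _ _ _ _ (fun u t => - Psi u t) _ true) => //.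
  + by move=> u t Su t0; rewrite (ePsi u t Su t0).
  + apply: coercive_vanishing => //; first exact: lamM.1.
    exact: diverges_at0.
  + by move=> u t Su t0; rewrite dt_opp// expr1 mulN1r opprK.
Qed.
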